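(* Let $f\in\mathcal{E}$, let $J_1,\dots,J_k$ be the minimal components of $f$, let $A=\mathrm{Per}(f)\setminus\mathrm{Fix}(f)$ and $B=\mathrm{Fix}(f)$. Set $C_i=C(f)\cap\mathcal{E}_{J_i}$ and $C_A=C(f)\cap\mathcal{E}_A$. Then $$C(f)\cong\Big(\Big(\prod_{i=1}^k C_i\Big)\rtimes F\Big)\times C_A\times\mathcal{E}_B,$$ where $F$ is (a finite group isomorphic to) a direct product of symmetric groups, each $C_i$ is either an infinite virtually cyclic group or a subgroup of $(\mathbb{R}/\mathbb{Z})^m\rtimes\Sigma_m$ (for some $m$, with $\Sigma_m$ permuting coordinates) containing the diagonal of $(\mathbb{R}/\mathbb{Z})^m$, and $C_A$ is a direct product of finitely many groups of the form $G_m=P_m\rtimes\mathcal{E}^m_\Delta$. The factors $C_A$ and $\mathcal{E}_B$ are trivial if $\mathrm{Per}(f)=\emptyset$, and the factors $C_i$ and $F$ are trivial if $f$ has finite order.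
   Context: Identify $\mathbb{T}^1=\mathbb{R}/\mathbb{Z}$ with $[0,1)$. An interval exchange transformation is a bijection of $\mathbb{T}^1$ that is a translation on each piece of some partition of $[0,1)$ into finitely many half-open intervals $[a,b)$; $\mathcal{E}$ is the group of these, and $C(g)=\{h\in\mathcal{E}:gh=hg\}$. The support of $g$ is the complement of $\mathrm{Fix}(g)$. For a finite union $X$ of half-open intervals, $\mathcal{E}_X$ is the subgroup of interval exchanges with support contained in $X$. A minimal component of $f$ is an $f$-invariant finite union $J$ of half-open intervals such that the $f$-orbit of every $x\in J$ is dense in $J$; the set of non-periodic points of any $f\in\mathcal{E}$ is a finite union of minimal components. For $m\ge2$, with $I_i=[\frac{i-1}{m},\frac im)$ and $r_{1/m}(x)=x+1/m$: $\mathcal{E}^m_\Delta=\{g\in C(r_{1/m}): g(I_i)=I_i\ \forall i\}$, $P_m=\{g\in C(r_{1/m}):\forall x\ \exists k\in\mathbb{Z},\ g(x)=x+k/m \bmod 1\}$, and $G_m=P_m\rtimes\mathcal{E}^m_\Delta=C(r_{1/m})$; $G_1=\mathcal{E}$. *)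

(* Defs.v *)
From Stdlib Require Import Reals Lra Lia List.
Open Scope R_scope.

Definition frac1 (x : R) : R := frac_part x.

Definition in01 (x : R) : Prop := 0 <= x < 1.

Fixpoint iter (n : nat) (g : R -> R) (x : R) : R :=
  match n with O => x | S n' => g (iter n' g x) end.

(* An interval exchange transformation, represented as a map R -> R that
   is the identity outside [0,1) and, on [0,1), a bijection of [0,1) which on
   each piece [a_i, a_{i+1}) of a finite partition of [0,1) is a translation
   mod 1. *)
Definition is_iet (g : R -> R) : Prop :=
  (forall x, ~ in01 x -> g x = x) /\
  (forall x, in01 x -> in01 (g x)) /\
  (forall x y, in01 x -> in01 y -> g x = g y -> x = y) /\
  (forall y, in01 y -> exists x, in01 x /\ g x = y) /\
  exists (n : nat) (a t : nat -> R),
    a O = 0 /\ a n = 1 /\ (forall i, (i < n)%nat -> a i < a (S i)) /\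
    (forall i x, (i < n)%nat -> a i <= x < a (S i) -> g x = frac1 (x + t i)).

Definition commute_fun (g h : R -> R) : Prop := forall x, g (h x) = h (g x).

Definition Fix (g : R -> R) (x : R) : Prop := in01 x /\ g x = x.
Definition Per (g : R -> R) (x : R) : Prop :=
  in01 x /\ exists n : nat, iter (S n) g x = x.

Definition supported_in (h : R -> R) (X : R -> Prop) : Prop :=
  forall x, in01 x -> h x <> x -> X x.

Definition finite_union_intervals (J : R -> Prop) : Prop :=
  exists (n : nat) (a b : nat -> R),
    (forall i, (i < n)%nat -> 0 <= a i /\ a i <= b i /\ b i <= 1) /\
    (forall x, J x <-> exists i, (i < n)%nat /\ a i <= x < b i).

(* y lies in the (two-sided, Z-) orbit of x under the bijection f *)
Definition in_orbit (f : R -> R) (x y : R) : Prop :=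
  exists n : nat, iter n f x = y \/ iter n f y = x.

(* distance on the circle R/Z for points of [0,1) *)
Definition cdist (x y : R) : R := Rmin (Rabs (x - y)) (1 - Rabs (x - y)).

Definition minimal_component (f : R -> R) (J : R -> Prop) : Prop :=
  finite_union_intervals J /\
  (exists x, J x) /\
  (forall x, in01 x -> (J x <-> J (f x))) /\
  (forall x y, J x -> J y -> forall eps, eps > 0 ->
     exists z, in_orbit f x z /\ J z /\ cdist z y < eps).

Definition finite_order (f : R -> R) : Prop :=
  exists n : nat, (1 <= n)%nat /\ forall x, iter n f x = x.

Definition rot (m : nat) (x : R) : R :=
  match Rle_dec 0 x with
  | left _ => match Rlt_dec x 1 with
              | left _ => frac1 (x + / INR m)
              | right _ => x end
  | right _ => x end.

Record grpOn (T : Type) := GrpOn {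
  gmem : T -> Prop;
  gmul : T -> T -> T;
  gone : T }.
Arguments GrpOn {T}.
Arguments gmem {T}.
Arguments gmul {T}.
Arguments gone {T}.

Definition is_group {T} (G : grpOn T) : Prop :=
  gmem G (gone G) /\
  (forall x y, gmem G x -> gmem G y -> gmem G (gmul G x y)) /\
  (forall x y z, gmem G x -> gmem G y -> gmem G z ->
     gmul G x (gmul G y z) = gmul G (gmul G x y) z) /\
  (forall x, gmem G x -> gmul G (gone G) x = x /\ gmul G x (gone G) = x) /\
  (forall x, gmem G x -> exists y, gmem G y /\
     gmul G x y = gone G /\ gmul G y x = gone G).

Definition subgroup {T} (G : grpOn T) (S : T -> Prop) : Prop :=
  (forall x, S x -> gmem G x) /\ S (gone G) /\
  (forall x y, S x -> S y -> S (gmul G x y)) /\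
  (forall x, S x -> exists y, S y /\ gmul G x y = gone G /\ gmul G y x = gone G).

Definition restrict {T} (G : grpOn T) (S : T -> Prop) : grpOn T :=
  GrpOn S (gmul G) (gone G).

Definition trivial_grp {T} (G : grpOn T) : Prop :=
  forall x, gmem G x -> x = gone G.

Definition grp_iso {T U} (G : grpOn T) (H : grpOn U) : Prop :=
  exists phi : T -> U,
    (forall x, gmem G x -> gmem H (phi x)) /\
    (forall x y, gmem G x -> gmem G y -> phi x = phi y -> x = y) /\
    (forall y, gmem H y -> exists x, gmem G x /\ phi x = y) /\
    (forall x y, gmem G x -> gmem G y -> phi (gmul G x y) = gmul H (phi x) (phi y)).

Definition dprod {T U} (G : grpOn T) (H : grpOn U) : grpOn (T * U) :=
  GrpOn (fun p => gmem G (fst p) /\ gmem H (snd p))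
        (fun p q => (gmul G (fst p) (fst q), gmul H (snd p) (snd q)))
        (gone G, gone H).

Definition prodFam {T} (G : nat -> grpOn T) (r : nat) : grpOn (nat -> T) :=
  GrpOn (fun x => forall j, ((j < r)%nat -> gmem (G j) (x j)) /\
                            ((r <= j)%nat -> x j = gone (G j)))
        (fun x y j => gmul (G j) (x j) (y j))
        (fun j => gone (G j)).

Definition is_action {T U} (H : grpOn U) (N : grpOn T) (phi : U -> T -> T) : Prop :=
  (forall h, gmem H h ->
     (forall n, gmem N n -> gmem N (phi h n)) /\
     (forall n m, gmem N n -> gmem N m -> phi h (gmul N n m) = gmul N (phi h n) (phi h m)) /\
     (forall n m, gmem N n -> gmem N m -> phi h n = phi h m -> n = m) /\
     (forall m, gmem N m -> exists n, gmem N n /\ phi h n = m)) /\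
  (forall n, gmem N n -> phi (gone H) n = n) /\
  (forall h1 h2 n, gmem H h1 -> gmem H h2 -> gmem N n ->
     phi (gmul H h1 h2) n = phi h1 (phi h2 n)).

Definition sdprod {T U} (N : grpOn T) (H : grpOn U) (phi : U -> T -> T) : grpOn (T * U) :=
  GrpOn (fun p => gmem N (fst p) /\ gmem H (snd p))
        (fun p q => (gmul N (fst p) (phi (snd p) (fst q)), gmul H (snd p) (snd q)))
        (gone N, gone H).

Fixpoint gpow {T} (G : grpOn T) (g : T) (n : nat) : T :=
  match n with O => gone G | S n' => gmul G g (gpow G g n') end.

Definition infinite_grp {T} (G : grpOn T) : Prop :=
  forall l : list T, exists x, gmem G x /\ ~ In x l.

Definition virtually_cyclic {T} (G : grpOn T) : Prop :=
  exists g, gmem G g /\ exists l : list T, (forall a, In a l -> gmem G a) /\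
    forall x, gmem G x -> exists a n, In a l /\
      (x = gmul G a (gpow G g n) \/ gmul G x (gpow G g n) = a).

Fixpoint first_pre (s : nat -> nat) (j k : nat) : option nat :=
  match k with
  | O => None
  | S k' => match first_pre s j k' with
            | Some i => Some i
            | None => if Nat.eqb (s k') j then Some k' else None end end.

Definition perm_inv (n : nat) (s : nat -> nat) (j : nat) : nat :=
  match first_pre s j n with Some i => i | None => j end.

Definition Sym (n : nat) : grpOn (nat -> nat) :=
  GrpOn (fun s => (forall i, (i < n)%nat -> (s i < n)%nat) /\
                  (forall i j, (i < n)%nat -> (j < n)%nat -> s i = s j -> i = j) /\
                  (forall i, (n <= i)%nat -> s i = i))
        (fun s t i => s (t i))
        (fun i => i).

Definition Torus (m : nat) : grpOn (nat -> R) :=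
  GrpOn (fun v => (forall j, (j < m)%nat -> in01 (v j)) /\
                  (forall j, (m <= j)%nat -> v j = 0))
        (fun v w j => frac1 (v j + w j))
        (fun _ => 0).

Definition torus_act (m : nat) (s : nat -> nat) (v : nat -> R) : nat -> R :=
  fun j => v (perm_inv m s j).

Definition TorusSym (m : nat) : grpOn ((nat -> R) * (nat -> nat)) :=
  sdprod (Torus m) (Sym m) (torus_act m).

Definition diagonal (m : nat) (p : (nat -> R) * (nat -> nat)) : Prop :=
  exists t, in01 t /\
    p = ((fun j => if Nat.ltb j m then t else 0), (fun i => i)).

Definition IETgrp (P : (R -> R) -> Prop) : grpOn (R -> R) :=
  GrpOn (fun h => is_iet h /\ P h) (fun g h x => g (h x)) (fun x => x).

Definition Egrp : grpOn (R -> R) := IETgrp (fun _ => True).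
Definition Cent (f : R -> R) : grpOn (R -> R) := IETgrp (commute_fun f).
Definition E_on (X : R -> Prop) : grpOn (R -> R) :=
  IETgrp (fun h => supported_in h X).
Definition Cent_on (f : R -> R) (X : R -> Prop) : grpOn (R -> R) :=
  IETgrp (fun h => commute_fun f h /\ supported_in h X).
(* G_m = P_m ⋊ E^m_Δ = C(r_{1/m}) ;  G_1 = E *)
Definition Ggrp (m : nat) : grpOn (R -> R) := Cent (rot m).

Definition setA (f : R -> R) (x : R) : Prop := Per f x /\ ~ Fix f x.
Definition setB (f : R -> R) (x : R) : Prop := Fix f x.

(* Main.v *)
(** The core notion is [pcw Q]: away from finitely many cut points, [Q] relates any two
    points of the same half-open piece.  Interval exchanges, finite unions of half-open
    intervals and their piecewise affine charts are all instances.

    Non-periodic points lie in minimal components: first return times to an interval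
    are bounded, so the saturation of an interval is again a finite union of
    intervals; the break points of an invariant set inside the aperiodic part lie on orbit
    segments joining two discontinuities, of which there are finitely many, so a
    smallest invariant set around a point exists, and it is minimal.

    For a minimal component [J], [f] acts on the points of [J] (right germs) and
    on its left germs.  Every left germ is eventually adjacent, in the future and in the
    past, to some right germ; if the two disagree the germ is singular.  A centralising map
    permutes the finitely many orbits of singular germs and is determined by one value on a
    dense orbit, so a singular germ makes the centraliser virtually cyclic.  Without
    singular germs, regluing each left germ to its right germ turns [J] into finitely many
    circles on which [f], and hence its whole centraliser, acts by isometries.

    On points of minimal period [n], an affine chart conjugates [f] to the rotation by [1/n].
    Finally the centraliser permutes the minimal components, and identifying each component
    with a chosen representative of its class splits this permutation action. *)

From Stdlib Require Import Reals Lra Lia List Arith ZArith FinFun.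
From Stdlib Require Import Classical ClassicalEpsilon FunctionalExtensionality PropExtensionality.
Require Import Defs.
Import ListNotations.
Open Scope R_scope.

(** * Piecewise properties *)

(** Half-open pieces make every interval exchange a translation to the right of every point, so
    agreement of two centralising maps at one point spreads by density; the difficulties sit in the
    left germs. The main finiteness principle is elementary: an orbit without repetition visits a
    finite set only finitely often.

    The gluing map sends a left germ to the right germ that it is adjacent to in the far future. It
    commutes with [f] by construction, whatever the singularities. Absence of singular germs enters
    only to identify it with gluing in the far past: a germ that is moved must then have a
    discontinuity ahead and one behind, so finitely many are moved, and travelling rightwards with
    jumps at these germs defines a flow. For small [t] and a centralising [h], the two composites of
    [h] with the time-[t] map are translations near one point and agree there, hence on all of [J];
    larger times are multiples of small ones.

    The base points of the circles lie on one orbit [x0, f x0, ...], and the value at [x0] alone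
    determines a centralising map on [J]. *)

(* Pieces are half-open: a cut point belongs to the piece on its right. *)
Definition avoids (D : list R) (x y : R) : Prop :=
  forall d, In d D -> ~ (x < d <= y).

Definition pcw (Q : R -> R -> Prop) : Prop :=
  exists D, forall x y, in01 x -> in01 y -> x < y -> avoids D x y -> Q x y.

Lemma next_exists (D : list R) (u : R) : u < 1 ->
  exists v, u < v <= 1 /\ (v = 1 \/ In v D) /\ forall d, In d D -> ~ (u < d < v).
Proof.
  intros Hu. induction D as [|d D IH].
  - exists 1. repeat split; try lra; auto.
  - destruct IH as [v [Hv [H1 H2]]].
    destruct (Rlt_dec u d) as [Hd|Hd]; [destruct (Rlt_dec d v) as [Hdv|Hdv]|].
    + exists d. split; [lra|]. split; [right; left; auto|].
      intros e [He|He]; [lra|]. intro; apply (H2 e He); lra.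
    + exists v. split; [lra|]. split; [destruct H1; [left|right; right]; auto|].
      intros e [He|He]; [lra|]. apply H2; auto.
    + exists v. split; [lra|]. split; [destruct H1; [left|right; right]; auto|].
      intros e [He|He]; [lra|]. apply H2; auto.
Qed.

Lemma prev_exists (D : list R) (u : R) : 0 <= u ->
  exists v, 0 <= v <= u /\ (v = 0 \/ In v D) /\ avoids D v u.
Proof.
  intros Hu. induction D as [|d D IH].
  - exists 0. repeat split; try lra; auto. intros d [].
  - destruct IH as [v [Hv [H1 H2]]].
    destruct (Rlt_dec v d) as [Hd|Hd]; [destruct (Rle_dec d u) as [Hdv|Hdv]|].
    + exists d. split; [lra|]. split; [right; left; auto|].
      intros e [He|He]; [lra|]. intro; apply (H2 e He); lra.
    + exists v. split; [lra|]. split; [destruct H1; [left|right; right]; auto|].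
      intros e [He|He]; [lra|]. apply H2; auto.
    + exists v. split; [lra|]. split; [destruct H1; [left|right; right]; auto|].
      intros e [He|He]; [lra|]. apply H2; auto.
Qed.

Lemma left_gap (D : list R) (p : R) :
  exists e, 0 < e /\ forall d, In d D -> ~ (p - e <= d < p).
Proof.
  induction D as [|d D [e [He H]]].
  - exists 1. split; [lra|]. intros d [].
  - destruct (Rlt_dec d p) as [Hd|Hd].
    + exists (Rmin e ((p - d) / 2)). split; [apply Rmin_pos; lra|].
      intros c [Hc|Hc].
      * subst c. pose proof (Rmin_r e ((p - d) / 2)). lra.
      * intro Hi. apply (H c Hc). pose proof (Rmin_l e ((p - d) / 2)). lra.
    + exists e. split; auto. intros c [Hc|Hc]; [lra|]. auto.
Qed.

Lemma avoids_app D1 D2 x y : avoids (D1 ++ D2) x y <-> avoids D1 x y /\ avoids D2 x y.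
Proof.
  unfold avoids; split.
  - intro H; split; intros d Hd; apply H; apply in_or_app; auto.
  - intros [H1 H2] d Hd. apply in_app_or in Hd. destruct Hd; auto.
Qed.

Lemma avoids_sub D x y x' y' : avoids D x y -> x <= x' -> y' <= y -> avoids D x' y'.
Proof. intros H Hx Hy d Hd Hi. apply (H d Hd). lra. Qed.

Lemma avoids_incl D D' x y : incl D D' -> avoids D' x y -> avoids D x y.
Proof. intros H H' d Hd. apply H'. auto. Qed.

Lemma pcw_impl (Q Q' : R -> R -> Prop) :
  (forall x y, in01 x -> in01 y -> x < y -> Q x y -> Q' x y) -> pcw Q -> pcw Q'.
Proof. intros H [D HD]. exists D. intros. apply H; auto. Qed.

Lemma pcw_and (Q1 Q2 : R -> R -> Prop) : pcw Q1 -> pcw Q2 -> pcw (fun x y => Q1 x y /\ Q2 x y).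
Proof.
  intros [D1 H1] [D2 H2]. exists (D1 ++ D2). intros x y Hx Hy Hxy Ha.
  apply avoids_app in Ha. destruct Ha. split; auto.
Qed.

Lemma pcw_true (Q : R -> R -> Prop) : (forall x y, in01 x -> in01 y -> x < y -> Q x y) -> pcw Q.
Proof. intro H. exists nil. auto. Qed.

Lemma pcw_all {T} (l : list T) (Q : T -> R -> R -> Prop) :
  (forall i, In i l -> pcw (Q i)) -> pcw (fun x y => forall i, In i l -> Q i x y).
Proof.
  induction l as [|i l IH]; intro H.
  - apply pcw_true. intros x y _ _ _ i [].
  - destruct (pcw_and _ _ (H i (or_introl eq_refl)) (IH (fun j Hj => H j (or_intror Hj))))
      as [D HD].
    exists D. intros x y Hx Hy Hxy Ha j Hj. destruct (HD x y Hx Hy Hxy Ha) as [H1 H2].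
    destruct Hj as [<-|Hj]; auto.
Qed.

Lemma pcw_all_lt (n : nat) (Q : nat -> R -> R -> Prop) :
  (forall i, (i < n)%nat -> pcw (Q i)) ->
  pcw (fun x y => forall i, (i < n)%nat -> Q i x y).
Proof.
  intro H. apply (pcw_impl (fun x y => forall i, In i (seq 0 n) -> Q i x y)).
  - intros x y _ _ _ HH i Hi. apply HH. apply in_seq. lia.
  - apply pcw_all. intros i Hi. apply H. apply in_seq in Hi. lia.
Qed.

Lemma pcw_hereditary (Q : R -> R -> Prop) : pcw Q ->
  pcw (fun x y => forall x' y', x <= x' -> x' < y' -> y' <= y -> Q x' y').
Proof.
  intros [D HD]. exists D. unfold in01 in *. intros x y Hx Hy Hxy Ha x' y' H1 H2 H3.
  apply HD; try lra. apply (avoids_sub D x y); auto.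
Qed.

Lemma pcw_right (Q : R -> R -> Prop) (x : R) : pcw Q -> in01 x ->
  exists e, 0 < e /\ x + e <= 1 /\ forall s s', 0 <= s -> s < s' -> s' < e -> Q (x + s) (x + s').
Proof.
  intros [D HD] Hx. destruct (next_exists D x) as [v [Hv [_ H]]]; [unfold in01 in Hx; lra|].
  exists (v - x). unfold in01 in *. split; [lra|]. split; [lra|].
  intros s s' K1 K2 K3. apply HD; unfold in01; try lra.
  intros d Hd Hi. apply (H d Hd). lra.
Qed.

Lemma pcw_left (Q : R -> R -> Prop) (p : R) : pcw Q -> 0 < p <= 1 ->
  exists e, 0 < e /\ e <= p /\ forall s s', 0 < s' -> s' < s -> s <= e -> Q (p - s) (p - s').
Proof.
  intros [D HD] Hp. destruct (left_gap D p) as [e [He H]].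
  exists (Rmin e p). pose proof (Rmin_l e p). pose proof (Rmin_r e p).
  split; [apply Rmin_pos; lra|]. split; [lra|].
  intros s s' K1 K2 K3. apply HD; unfold in01; try lra.
  intros d Hd Hi. apply (H d Hd). lra.
Qed.

(** The value [s' = 0] is allowed here, so [p] itself is compared with the points on its left; this
    is why [p] must not be a cut. *)
Lemma pcw_left_closed (Q : R -> R -> Prop) : pcw Q ->
  exists D, forall p, 0 < p < 1 -> ~ In p D ->
    exists e, 0 < e /\ e <= p /\ forall s s', 0 <= s' -> s' < s -> s <= e -> Q (p - s) (p - s').
Proof.
  intros [D HD]. exists D. intros p Hp Hn. destruct (left_gap D p) as [e [He H]].
  exists (Rmin e p). pose proof (Rmin_l e p). pose proof (Rmin_r e p).
  split; [apply Rmin_pos; lra|]. split; [lra|].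
  intros s s' K1 K2 K3. apply HD; unfold in01; try lra.
  intros d Hd Hi. destruct (Req_dec d p) as [->|Hne]; [auto|]. apply (H d Hd). lra.
Qed.

(** Constancy on the pieces means that [X] meets [0,1) in a finite union of half-open intervals. *)
Definition pset (X : R -> Prop) : Prop := pcw (fun x y => X x <-> X y).
Definition paff (c : R) (A : R -> Prop) (g : R -> R) : Prop :=
  pcw (fun x y => A x -> g y - g x = c * (y - x)).
(** A genuine translation of the reals, without reduction mod 1: a point where the circle wraps
    around counts as a cut. *)
Definition pt (g : R -> R) : Prop := pcw (fun x y => g y - g x = y - x).

Lemma paff_pt g : paff 1 in01 g <-> pt g.
Proof.
  unfold paff, pt. split; apply pcw_impl; intros x y Hx Hy Hxy.
  - intro H. rewrite H by auto. ring.
  - intros H _. rewrite H. ring.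
Qed.

Lemma pset_ext (X Y : R -> Prop) : (forall x, in01 x -> X x <-> Y x) -> pset X -> pset Y.
Proof. intro H. apply pcw_impl. intros x y Hx Hy _ HX. rewrite <- !H; auto. Qed.

Lemma pset_and X Y : pset X -> pset Y -> pset (fun x => X x /\ Y x).
Proof. intros H1 H2. apply (pcw_impl _ _ (fun x y _ _ _ H => H)).
  eapply pcw_impl; [|apply (pcw_and _ _ H1 H2)]. cbv beta. tauto. Qed.

Lemma pset_not X : pset X -> pset (fun x => ~ X x).
Proof. apply pcw_impl. tauto. Qed.

Lemma pset_in01 : pset in01.
Proof. apply pcw_true. tauto. Qed.

Lemma pset_interval a b : pset (fun x => a <= x < b).
Proof.
  exists [a; b]. intros x y _ _ Hxy Ha.
  pose proof (Ha a (or_introl eq_refl)). pose proof (Ha b (or_intror (or_introl eq_refl))). lra.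
Qed.

Lemma pset_exists_lt n (X : nat -> R -> Prop) : (forall i, (i < n)%nat -> pset (X i)) ->
  pset (fun x => exists i, (i < n)%nat /\ X i x).
Proof.
  intro H. eapply pcw_impl; [|apply (pcw_all_lt n _ H)]. cbv beta.
  intros x y _ _ _ HH. split; intros [i [Hi Hx]]; exists i; split; auto; apply (HH i Hi); auto.
Qed.

Lemma pset_forall_lt n (X : nat -> R -> Prop) : (forall i, (i < n)%nat -> pset (X i)) ->
  pset (fun x => forall i, (i < n)%nat -> X i x).
Proof.
  intro H. eapply pcw_impl; [|apply (pcw_all_lt n _ H)]. cbv beta.
  intros x y _ _ _ HH. split; intros Hx i Hi; apply (HH i Hi); auto.
Qed.

Definition inj_on (A : R -> Prop) (g : R -> R) : Prop :=
  forall x y, A x -> A y -> g x = g y -> x = y.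

Lemma preimage_list (A : R -> Prop) (g : R -> R) (L : list R) : inj_on A g ->
  exists P, forall z, A z -> In (g z) L -> In z P.
Proof.
  intro Hinj. induction L as [|d L [P HP]].
  - exists nil. intros z _ [].
  - destruct (classic (exists z, A z /\ g z = d)) as [[z [Hz Hd]]|Hn].
    + exists (z :: P). intros w Hw [Hi|Hi]; [left|right; auto].
      apply Hinj; auto. congruence.
    + exists P. intros w Hw [Hi|Hi]; [|auto]. exfalso. apply Hn. exists w. auto.
Qed.

(** The cuts are those of [A] and [g] together with the preimages of the cuts of [Q]; injectivity
    keeps these preimages finite in number. *)
Lemma pcw_pullback (c : R) (A : R -> Prop) (g : R -> R) (Q : R -> R -> Prop) :
  0 < c -> pset A -> paff c A g -> inj_on A g -> (forall x, A x -> in01 (g x)) ->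
  pcw Q -> pcw (fun x y => A x -> A y /\ Q (g x) (g y)).
Proof.
  intros Hc HA Hg Hinj Hm [DQ HQ].
  destruct (pcw_hereditary _ (pcw_and _ _ HA Hg)) as [D HD].
  destruct (preimage_list A g DQ Hinj) as [P HP].
  exists (D ++ P). intros x y Hx Hy Hxy Ha HAx. apply avoids_app in Ha. destruct Ha as [Ha1 Ha2].
  specialize (HD x y Hx Hy Hxy Ha1).
  assert (HAz : forall z, x < z -> z <= y -> A z /\ g z - g x = c * (z - x)).
  { intros z H1 H2. destruct (HD x z) as [H3 H4]; try lra. split; [tauto|auto]. }
  assert (HAy : A y) by (apply HAz; lra).
  split; [auto|]. destruct (HAz y) as [_ Hgy]; try lra.
  assert (0 < c * (y - x)) by (apply Rmult_lt_0_compat; lra).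
  apply HQ; auto; try lra.
  intros d Hd [Hi1 Hi2].
  (* The point at which the affine branch through [x] takes the value [d]. *)
  set (z := x + (d - g x) / c).
  assert (Hz1 : x < z). { unfold z. assert (0 < (d - g x) / c) by (apply Rdiv_lt_0_compat; lra). lra. }
  assert (Hz2 : z <= y).
  { unfold z. assert ((d - g x) / c <= y - x); [|lra].
    apply (Rmult_le_reg_l c); auto. replace (c * ((d - g x) / c)) with (d - g x) by (field; lra). lra. }
  destruct (HAz z Hz1 Hz2) as [HAz' Hgz].
  assert (g z = d). { replace (c * (z - x)) with (d - g x) in Hgz by (unfold z; field; lra). lra. }
  apply (Ha2 z); [|lra]. apply HP; auto. congruence.
Qed.

(* The only obstruction to extending the inverse branch at [x] up to [y] is the
   image of a break point of [g]: where the branch stops, the next point is hit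
   from the left by the branch of [g] ending there, by injectivity. *)
Lemma paff_inverse (c : R) (A B : R -> Prop) (g k : R -> R) :
  0 < c -> pset A -> pset B -> paff c A g ->
  (forall x, A x -> in01 x) ->
  (forall x, A x -> B (g x)) -> (forall y, B y -> A (k y)) ->
  (forall x, A x -> k (g x) = x) -> (forall y, B y -> g (k y) = y) ->
  paff (/ c) B k.
Proof.
  intros Hc HA HB Hg HA01 HAB HBA Hkg Hgk.
  destruct (pcw_hereditary _ (pcw_and _ _ HA Hg)) as [D HD].
  destruct (pcw_hereditary _ HB) as [DB HDB].
  (* The image of 0 is a cut too: a piece of [g] starts there with nothing on its left, even when 0
     is not in [D]. *)
  exists (DB ++ map g (0 :: D)). intros x y Hx Hy Hxy Ha HBx.
  apply avoids_app in Ha. destruct Ha as [Ha1 Ha2]. specialize (HDB x y Hx Hy Hxy Ha1).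
  assert (Hu : A (k x)) by auto. pose proof (HA01 _ Hu) as Hu01.
  set (u := k x) in *. assert (Hgu : g u = x) by (apply Hgk; auto).
  destruct (next_exists D u) as [v [Hv [Hv1 Hv2]]]; [unfold in01 in Hu01; lra|].
  assert (Hbr : forall s, 0 < s -> u + s < v -> A (u + s) /\ g (u + s) = x + c * s).
  { intros s Hs1 Hs2. destruct (HD u (u + s)) with (x' := u) (y' := u + s) as [H1 H2]; auto;
      unfold in01 in *; try lra.
    - intros d Hd Hi. apply (Hv2 d Hd). lra.
    - split; [tauto|]. specialize (H2 Hu). replace (u + s - u) with s in H2 by ring. lra. }
  assert (Hcc : / c * c = 1) by (field; lra).
  destruct (Rlt_dec y (x + c * (v - u))) as [Hlt|Hge].
  - set (s := (y - x) / c).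
    assert (Hs : c * s = y - x) by (unfold s; field; lra).
    assert (Hs1 : 0 < s) by (unfold s; apply Rdiv_lt_0_compat; lra).
    assert (Hs2 : u + s < v). { assert (s < v - u); [|lra]. apply (Rmult_lt_reg_l c); lra. }
    destruct (Hbr s Hs1 Hs2) as [H1 H2].
    replace (k y) with (u + s). { unfold s, Rdiv. ring. }
    rewrite <- (Hkg _ H1). f_equal. lra.
  (* [z] is the limit of the branch at its end [v]. Its preimage [w] is not a break, so the values
     just below [z] are also taken just left of [w]; injectivity forces [w = v], although [v] is 1
     or a break. *)
  - exfalso. set (z := x + c * (v - u)) in *.
    assert (0 < c * (v - u)) by (apply Rmult_lt_0_compat; lra).
    assert (HBz : B z). { apply (HDB x z); unfold z in *; lra || auto. }
    set (w := k z). assert (HAw : A w) by (apply HBA; auto).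
    pose proof (HA01 _ HAw) as Hw01. assert (Hgw : g w = z) by (apply Hgk; auto).
    assert (Hnw : ~ In w (0 :: D)).
    { intro Hin. apply (Ha2 z); [|unfold z in *; lra]. rewrite <- Hgw. apply in_map. auto. }
    destruct (left_gap (0 :: D) w) as [e [He Hgap]].
    assert (Hw0 : 0 < w). { destruct (Req_dec w 0) as [H0|H0]; [exfalso; apply Hnw; left; auto|]. unfold in01 in Hw01; lra. }
    set (s := Rmin (Rmin e w) (v - u) / 2).
    assert (Hs : 0 < s /\ s < e /\ s < w /\ s < v - u).
    { unfold s. pose proof (Rmin_l (Rmin e w) (v - u)). pose proof (Rmin_r (Rmin e w) (v - u)).
      pose proof (Rmin_l e w). pose proof (Rmin_r e w).
      assert (0 < Rmin (Rmin e w) (v - u)) by (repeat apply Rmin_pos; lra). lra. }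
    destruct Hs as [Hs0 [Hs1 [Hs2 Hs3]]].
    destruct (HD (w - s) w) with (x' := w - s) (y' := w) as [H1 H2]; unfold in01 in *; try lra.
    { intros d Hd Hi. destruct (Req_dec d w) as [->|Hne]; [apply Hnw; right; auto|].
      apply (Hgap d); [right; auto|lra]. }
    assert (HAws : A (w - s)) by tauto. specialize (H2 HAws).
    destruct (Hbr (v - s - u)) as [H3 H4]; try lra.
    replace (u + (v - s - u)) with (v - s) in * by ring.
    assert (Heq : v - s = w - s).
    { rewrite <- (Hkg _ H3), <- (Hkg _ HAws). f_equal.
      replace (w - (w - s)) with s in H2 by ring. rewrite H4. unfold z in Hgw.
      replace (x + c * (v - s - u)) with (x + c * (v - u) - c * s) by ring. lra. }
    assert (v = w) by lra. destruct Hv1 as [Hv1|Hv1]; [lra|].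
    apply Hnw. right. congruence.
Qed.

(** * Interval exchanges as piecewise translations *)

(** Induction on the list: a point interior to a cell splits that cell, any other point leaves the
    partition alone. Points outside (0,1) are thereby ignored. *)
Lemma sorted_partition (D : list R) :
  exists (n : nat) (a : nat -> R),
    a O = 0 /\ a n = 1 /\ (forall i, (i < n)%nat -> a i < a (S i)) /\
    (forall i d, (i < n)%nat -> In d D -> ~ (a i < d < a (S i))).
Proof.
  induction D as [|d D (n & a & H0 & H1 & Hlt & HD)].
  - exists 1%nat, INR. simpl. repeat split; auto.
    intros i Hi. replace i with O by lia. simpl; lra.
  - destruct (classic (exists i, (i < n)%nat /\ a i < d < a (S i))) as [(i & Hi & Hd)|Hn].
    (* The new point takes position [S i], and the later endpoints are shifted by one, hence
       [a (pred j)]. *)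
    + exists (S n), (fun j => if le_dec j i then a j else if Nat.eq_dec j (S i) then d else a (pred j)).
      repeat split.
      * destruct (le_dec 0 i); [auto|lia].
      * destruct (le_dec (S n) i); [lia|]. destruct (Nat.eq_dec (S n) (S i)); [lia|]. auto.
      * intros j Hj. destruct (le_dec j i), (le_dec (S j) i), (Nat.eq_dec j (S i)), (Nat.eq_dec (S j) (S i)); try lia.
        -- apply Hlt; lia.
        -- replace j with i by lia. lra.
        -- subst j. simpl. lra.
        -- simpl. destruct j; [lia|]. apply Hlt. lia.
      * intros j e Hj He.
        assert (HD' : In e D -> forall i, (i < n)%nat -> ~ a i < e < a (S i)) by (intros; apply HD; auto).
        destruct (le_dec j i), (le_dec (S j) i), (Nat.eq_dec j (S i)), (Nat.eq_dec (S j) (S i)); try lia.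
        -- destruct He as [<-|He]; [|apply HD'; auto; lia].
           intro. assert (HH : forall p q, (p <= q)%nat -> (q <= n)%nat -> a p <= a q).
           { intros p q Hpq. induction Hpq; intros; [lra|]. pose proof (Hlt m). assert (a p <= a m) by (apply IHHpq; lia).
             assert (a m < a (S m)) by (apply Hlt; lia). lra. }
           pose proof (HH (S j) i). assert (a (S j) <= a i) by (apply HH; lia). lra.
        -- replace j with i by lia. destruct He as [<-|He]; [lra|]. intro. apply (HD' He i); auto; lra.
        -- subst j. simpl. destruct He as [<-|He]; [lra|]. intro. apply (HD' He i); auto; lra.
        -- simpl. destruct j; [lia|]. simpl. destruct He as [<-|He]; [|apply HD'; auto; lia].
           intro. assert (HH : forall p q, (p <= q)%nat -> (q <= n)%nat -> a p <= a q).
           { intros p q Hpq. induction Hpq; intros; [lra|]. assert (a p <= a m) by (apply IHHpq; lia).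
             assert (a m < a (S m)) by (apply Hlt; lia). lra. }
           assert (a (S i) <= a j) by (apply HH; lia). lra.
    + exists n, a. repeat split; auto. intros i e Hi [<-|He]; [|auto].
      intro. apply Hn. exists i. auto.
Qed.

Lemma partition_locate (n : nat) (a : nat -> R) (x : R) :
  a O <= x < a n -> exists i, (i < n)%nat /\ a i <= x < a (S i).
Proof.
  induction n as [|n IH]; intro H; [lra|].
  destruct (Rlt_dec x (a n)) as [Hx|Hx].
  - destruct IH as [i [Hi Hi']]; [lra|]. exists i. split; [lia|auto].
  - exists n. split; [lia|lra].
Qed.

Lemma partition_range (n : nat) (a : nat -> R) : a O = 0 -> a n = 1 ->
  (forall i, (i < n)%nat -> a i < a (S i)) -> forall i, (i <= n)%nat -> 0 <= a i <= 1.
Proof.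
  intros H0 H1 Hlt i Hi. split.
  - induction i; [lra|]. assert (a i < a (S i)) by (apply Hlt; lia). assert (0 <= a i) by (apply IHi; lia). lra.
  - rewrite <- H1. clear H1. induction Hi as [|m Hm IH]; [lra|].
    assert (a m < a (S m)) by (apply Hlt; lia).
    assert (a i <= a m) by (apply IH; intros; apply Hlt; lia). lra.
Qed.

Lemma frac1_unique (x y : R) (z : Z) : in01 y -> x = y + IZR z -> frac1 x = y.
Proof.
  intros Hy Hx. unfold frac1. pose proof (base_fp x) as [H1 H2]. unfold frac_part in *.
  unfold in01 in Hy. assert (Int_part x = z).
  { assert (H3 : IZR (Int_part x) - IZR z < 1) by lra.
    assert (H4 : -1 < IZR (Int_part x) - IZR z) by lra.
    rewrite <- minus_IZR in H3, H4. apply lt_IZR in H3, H4. lia. }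
  subst z. lra.
Qed.

Lemma frac1_id x : in01 x -> frac1 x = x.
Proof. intro H. apply (frac1_unique x x 0); auto. lra. Qed.

Lemma frac1_in01 x : in01 (frac1 x).
Proof. unfold in01, frac1. pose proof (base_fp x). lra. Qed.

Lemma frac1_int x : exists z, x = frac1 x + IZR z.
Proof. exists (Int_part x). unfold frac1, frac_part. lra. Qed.

(** On one piece the translation mod 1 wraps around at most once, namely at [frac1 (- t i)]. With
    these points added as cuts, it becomes a translation of the reals. *)
Lemma iet_pt g : is_iet g -> pt g.
Proof.
  intros (_ & _ & _ & _ & n & a & t & H0 & H1 & Hlt & Hg).
  exists (map a (seq 0 (S n)) ++ map (fun i => frac1 (- t i)) (seq 0 n)).
  intros x y Hx Hy Hxy Ha. apply avoids_app in Ha. destruct Ha as [Ha1 Ha2].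
  destruct (partition_locate n a x) as [i [Hi Hxi]]; [unfold in01 in Hx; lra|].
  assert (Hyi : y < a (S i)).
  { destruct (Rlt_dec y (a (S i))); auto. exfalso. apply (Ha1 (a (S i))); [|lra].
    apply in_map. apply in_seq. lia. }
  rewrite (Hg i x), (Hg i y) by (auto; lra).
  set (c := frac1 (- t i)).
  assert (Hc : ~ (x < c <= y)).
  { apply Ha2. apply (in_map (fun i => frac1 (- t i))). apply in_seq. lia. }
  pose proof (frac1_in01 (- t i)) as Hc01. fold c in Hc01.
  destruct (frac1_int (- t i)) as [z Hz]. fold c in Hz. unfold in01 in *.
  destruct (Rle_dec c x).
  - rewrite (frac1_unique (x + t i) (x - c) (- z)), (frac1_unique (y + t i) (y - c) (- z));
      unfold in01; try rewrite opp_IZR; lra.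
  - rewrite (frac1_unique (x + t i) (x - c + 1) (- z - 1)), (frac1_unique (y + t i) (y - c + 1) (- z - 1));
      unfold in01; try rewrite minus_IZR, opp_IZR; lra.
Qed.

(** The translation on a cell is read off at its left endpoint; since the values already lie in
    [0,1), [frac1] does nothing. *)
Lemma iet_intro g :
  (forall x, ~ in01 x -> g x = x) -> (forall x, in01 x -> in01 (g x)) ->
  inj_on in01 g -> (forall y, in01 y -> exists x, in01 x /\ g x = y) -> pt g -> is_iet g.
Proof.
  intros H1 H2 H3 H4 [D HD]. repeat split; auto; try (apply H2; auto).
  destruct (sorted_partition D) as (n & a & Ha0 & Ha1 & Hlt & Hav).
  exists n, a, (fun i => g (a i) - a i). repeat split; auto.
  intros i x Hi Hx. pose proof (partition_range n a Ha0 Ha1 Hlt i) as Hr.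
  pose proof (partition_range n a Ha0 Ha1 Hlt (S i)) as Hr'.
  assert (0 <= a i <= 1) by (apply Hr; lia). assert (0 <= a (S i) <= 1) by (apply Hr'; lia).
  assert (Hx01 : in01 x) by (unfold in01; lra).
  symmetry. apply (frac1_unique _ _ 0); [apply H2; auto|].
  destruct (Req_dec x (a i)) as [->|Hne]; [lra|].
  assert (g x - g (a i) = x - a i); [|lra].
  apply HD; unfold in01; try lra.
  intros d Hd Hi'. apply (Hav i d Hi Hd). lra.
Qed.

Lemma fui_pset J : finite_union_intervals J -> pset J /\ forall x, J x -> in01 x.
Proof.
  intros (n & a & b & Hab & HJ). split.
  - apply (pset_ext (fun x => exists i, (i < n)%nat /\ a i <= x < b i)).
    + intros x _. rewrite HJ. tauto.
    + apply pset_exists_lt. intros i _. apply pset_interval.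
  - intros x Hx. apply HJ in Hx. destruct Hx as [i [Hi Hx]]. specialize (Hab i Hi).
    unfold in01. lra.
Qed.

Lemma pset_fui J : pset J -> (forall x, J x -> in01 x) -> finite_union_intervals J.
Proof.
  intros [D HD] HJ. destruct (sorted_partition D) as (n & a & Ha0 & Ha1 & Hlt & Hav).
  (* A cell outside [J] stays in the list as the empty interval from [a i] to [a i], which avoids
     renumbering. *)
  exists n, a, (fun i => if excluded_middle_informative (J (a i)) then a (S i) else a i).
  pose proof (partition_range n a Ha0 Ha1 Hlt) as Hr.
  split.
  - intros i Hi. assert (0 <= a i <= 1) by (apply Hr; lia). assert (0 <= a (S i) <= 1) by (apply Hr; lia).
    specialize (Hlt i Hi). destruct (excluded_middle_informative (J (a i))); lra.
  - assert (Hc : forall i x, (i < n)%nat -> a i <= x < a (S i) -> (J (a i) <-> J x)).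
    { intros i x Hi Hx. destruct (Req_dec x (a i)) as [->|Hne]; [tauto|].
      assert (0 <= a i <= 1) by (apply Hr; lia). assert (0 <= a (S i) <= 1) by (apply Hr; lia).
      apply HD; unfold in01; try lra. intros d Hd Hi'. apply (Hav i d Hi Hd). lra. }
    intro x. split.
    + intro Hx. destruct (partition_locate n a x) as [i [Hi Hxi]].
      { specialize (HJ x Hx). unfold in01 in HJ. lra. }
      exists i. split; auto. destruct (excluded_middle_informative (J (a i))) as [|Hn]; auto.
      exfalso. apply Hn. apply (Hc i x); auto.
    + intros [i [Hi Hx]]. destruct (excluded_middle_informative (J (a i))) as [Hy|]; [|lra].
      apply (Hc i x); auto.
Qed.

(** * Inverses, composites and iterates of interval exchanges *)

Definition inv (g : R -> R) (y : R) : R := epsilon (inhabits 0) (fun x => g x = y).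

Lemma iet_out g x : is_iet g -> ~ in01 x -> g x = x.
Proof. intros [H _]. auto. Qed.

Lemma iet_in g x : is_iet g -> in01 x -> in01 (g x).
Proof. intros (_ & H & _). auto. Qed.

Lemma iet_in_iff g x : is_iet g -> in01 (g x) <-> in01 x.
Proof.
  intro H. split; [|apply iet_in; auto].
  intro Hx. destruct (classic (in01 x)) as [|Hn]; auto. rewrite (iet_out g x H Hn) in Hx. auto.
Qed.

Lemma iet_inj g x y : is_iet g -> g x = g y -> x = y.
Proof.
  intros Hg Heq. destruct (classic (in01 x)) as [Hx|Hx].
  - assert (Hy : in01 y) by (apply (iet_in_iff g y Hg); rewrite <- Heq; apply iet_in; auto).
    destruct Hg as (_ & _ & H & _). apply H; auto.
  - assert (Hy : ~ in01 y) by (intro Hy; apply Hx; apply (iet_in_iff g x Hg); rewrite Heq; apply iet_in; auto).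
    rewrite (iet_out g x), (iet_out g y) in Heq; auto.
Qed.

Lemma iet_surj g y : is_iet g -> exists x, g x = y.
Proof.
  intros Hg. destruct (classic (in01 y)) as [Hy|Hy].
  - destruct Hg as (_ & _ & _ & H & _). destruct (H y Hy) as [x [_ Hx]]. eauto.
  - exists y. apply iet_out; auto.
Qed.

Lemma inv_r g y : is_iet g -> g (inv g y) = y.
Proof. intro Hg. apply (epsilon_spec (inhabits 0) (fun x => g x = y)). apply iet_surj; auto. Qed.

Lemma inv_l g x : is_iet g -> inv g (g x) = x.
Proof. intro Hg. apply (iet_inj g); auto. apply inv_r; auto. Qed.

Lemma inv_eq g x y : is_iet g -> g x = y -> inv g y = x.
Proof. intros Hg <-. apply inv_l; auto. Qed.

(** Preservation of [0,1) comes for free: if [g x] were outside, it would be fixed by [g], hence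
    equal to [x] by injectivity. *)
Lemma iet_of_inverse g k :
  (forall x, ~ in01 x -> g x = x) -> (forall x, k (g x) = x) -> (forall y, g (k y) = y) ->
  pt g -> is_iet g.
Proof.
  intros H1 H2 H3 H4.
  assert (Hinj : forall x y, g x = g y -> x = y) by (intros x y E; rewrite <- (H2 x), <- (H2 y), E; auto).
  assert (Hin : forall x, in01 x -> in01 (g x)).
  { intros x Hx. destruct (classic (in01 (g x))) as [|Hn]; auto.
    exfalso. apply Hn. apply H1 in Hn. apply Hinj in Hn. rewrite Hn. auto. }
  apply iet_intro; auto.
  - intros x y _ _. auto.
  - intros y Hy. exists (k y). split; auto.
    destruct (classic (in01 (k y))) as [|Hn]; auto.
    exfalso. pose proof (H1 _ Hn) as E. rewrite H3 in E. rewrite <- E in Hn. auto.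
Qed.

Lemma iet_id : is_iet (fun x => x).
Proof. apply (iet_of_inverse _ (fun x => x)); auto. apply pcw_true. auto. Qed.

Lemma iet_pullback g Q : is_iet g -> pcw Q -> pcw (fun x y => Q (g x) (g y)).
Proof.
  intros Hg HQ. eapply pcw_impl; [|apply (pcw_pullback 1 in01 g Q)]; auto; try lra.
  - cbv beta. intros x y Hx _ _ H. apply H; auto.
  - apply pset_in01.
  - apply paff_pt. apply iet_pt; auto.
  - intros x y _ _. apply iet_inj; auto.
  - intros x. apply iet_in; auto.
Qed.

Lemma iet_comp g h : is_iet g -> is_iet h -> is_iet (fun x => g (h x)).
Proof.
  intros Hg Hh. apply (iet_of_inverse _ (fun x => inv h (inv g x))).
  - intros x Hx. rewrite (iet_out h), (iet_out g); auto.
  - intro x. rewrite inv_l, inv_l; auto.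
  - intro x. rewrite inv_r, inv_r; auto.
  - eapply pcw_impl; [|apply (pcw_and _ _ (iet_pullback h _ Hh (iet_pt g Hg)) (iet_pt h Hh))].
    cbv beta. intros x y _ _ _ [H1 H2]. lra.
Qed.

Lemma inv_out g x : is_iet g -> ~ in01 x -> inv g x = x.
Proof. intros Hg Hx. apply inv_eq; auto. apply iet_out; auto. Qed.

Lemma inv_in g x : is_iet g -> in01 x -> in01 (inv g x).
Proof. intros Hg Hx. apply (iet_in_iff g); auto. rewrite inv_r; auto. Qed.

Lemma iet_inv g : is_iet g -> is_iet (inv g).
Proof.
  intro Hg. apply (iet_of_inverse _ g).
  - intros x. apply inv_out; auto.
  - intro. apply inv_r; auto.
  - intro. apply inv_l; auto.
  - assert (HH : paff (/ 1) in01 (inv g)).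
    { apply (paff_inverse 1 in01 in01 g); auto; try lra; try apply pset_in01.
      - apply paff_pt, iet_pt; auto.
      - intros; apply iet_in; auto.
      - intros; apply inv_in; auto.
      - intros; apply inv_l; auto.
      - intros; apply inv_r; auto. }
    rewrite Rinv_1 in HH. apply paff_pt; auto.
Qed.

Lemma iet_iter n g : is_iet g -> is_iet (iter n g).
Proof.
  intro Hg. induction n; simpl.
  - apply iet_id.
  - apply (iet_comp g (iter n g)); auto.
Qed.

Lemma pset_preimage g X : is_iet g -> pset X -> pset (fun x => X (g x)).
Proof. intros Hg HX. apply (iet_pullback g _ Hg HX). Qed.

Lemma commute_inv f h : is_iet h -> commute_fun f h -> commute_fun f (inv h).
Proof. intros Hh Hc x. apply (iet_inj h); auto. rewrite inv_r, <- Hc, inv_r; auto. Qed.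

Lemma commute_sym f h : commute_fun f h -> commute_fun h f.
Proof. intros H x. symmetry. apply H. Qed.

Lemma commute_comp f g h : commute_fun f g -> commute_fun f h -> commute_fun f (fun x => g (h x)).
Proof. intros H1 H2 x. rewrite H1, H2. auto. Qed.

Lemma iter_add g m n x : iter (m + n) g x = iter m g (iter n g x).
Proof. induction m; simpl; auto. rewrite IHm; auto. Qed.

Lemma iter_comm g n x : iter n g (g x) = g (iter n g x).
Proof. induction n; simpl; auto. rewrite IHn; auto. Qed.

Lemma commute_iter f h n : commute_fun f h -> commute_fun f (iter n h).
Proof. intros H. induction n; intro x; simpl; auto. rewrite H, IHn; auto. Qed.

Lemma iter_inv_l g n x : is_iet g -> iter n (inv g) (iter n g x) = x.
Proof.
  intro Hg. induction n; simpl; auto.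
  rewrite <- iter_comm, inv_l; auto.
Qed.

Lemma iter_inv_r g n x : is_iet g -> iter n g (iter n (inv g) x) = x.
Proof.
  intro Hg. induction n; simpl; auto.
  rewrite <- iter_comm, inv_r; auto.
Qed.

Lemma iter_fix g n x : g x = x -> iter n g x = x.
Proof. intro H. induction n; simpl; auto. rewrite IHn; auto. Qed.

Lemma iter_mult g n m x : iter n g x = x -> iter (m * n) g x = x.
Proof. intro H. induction m; simpl; auto. rewrite iter_add, IHm; auto. Qed.

Lemma pt_glue (n : nat) (X : nat -> R -> Prop) (g : nat -> R -> R) (h : R -> R) :
  (forall i, (i < n)%nat -> pset (X i)) -> (forall i, (i < n)%nat -> pt (g i)) ->
  (forall x, in01 x -> exists i, (i < n)%nat /\ X i x) ->
  (forall i x, (i < n)%nat -> in01 x -> X i x -> h x = g i x) -> pt h.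
Proof.
  intros HX Hg Hcov Hh.
  eapply pcw_impl; [|apply (pcw_and _ _ (pcw_all_lt n _ HX) (pcw_all_lt n _ Hg))].
  cbv beta. intros x y Hx Hy Hxy [H1 H2]. destruct (Hcov x Hx) as [i [Hi Hxi]].
  rewrite (Hh i x), (Hh i y); auto. apply (H1 i Hi); auto.
Qed.

Definition ifp {T} (P : Prop) (a b : T) : T := if excluded_middle_informative P then a else b.

Lemma ifp_true {T} (P : Prop) (a b : T) : P -> ifp P a b = a.
Proof. intro H. unfold ifp. destruct (excluded_middle_informative P); tauto. Qed.

Lemma ifp_false {T} (P : Prop) (a b : T) : ~ P -> ifp P a b = b.
Proof. intro H. unfold ifp. destruct (excluded_middle_informative P); tauto. Qed.

Definition res (X : R -> Prop) (h : R -> R) (x : R) : R := ifp (X x) (h x) x.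

Lemma res_in X h x : X x -> res X h x = h x.
Proof. apply ifp_true. Qed.

Lemma res_out X h x : ~ X x -> res X h x = x.
Proof. apply ifp_false. Qed.

Lemma pt_res X h : pset X -> pt h -> pt (res X h).
Proof.
  intros HX Hh. eapply pcw_impl; [|apply (pcw_and _ _ HX Hh)].
  cbv beta. intros x y _ _ _ [H1 H2]. destruct (classic (X x)) as [Hx|Hx].
  - rewrite !res_in; tauto.
  - rewrite !res_out; tauto.
Qed.

Lemma inv_invariant (X : R -> Prop) h : is_iet h -> (forall x, X x <-> X (h x)) ->
  forall x, X x <-> X (inv h x).
Proof. intros Hh H x. rewrite (H (inv h x)), inv_r; tauto. Qed.

Lemma iet_res X h : pset X -> is_iet h -> (forall x, X x <-> X (h x)) -> is_iet (res X h).
Proof.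
  intros HX Hh Hinv. apply (iet_of_inverse _ (res X (inv h))).
  - intros x Hx. unfold res, ifp. destruct (excluded_middle_informative (X x)); auto.
    apply iet_out; auto.
  - intro x. destruct (classic (X x)) as [H|H].
    + rewrite (res_in X h x H), res_in by (apply (proj1 (Hinv x)); auto). apply inv_l; auto.
    + rewrite (res_out X h x H), res_out; auto.
  - intro x. destruct (classic (X x)) as [H|H].
    + rewrite (res_in X (inv h) x H), res_in by (apply (proj1 (inv_invariant X h Hh Hinv x)); auto). apply inv_r; auto.
    + rewrite (res_out X (inv h) x H), res_out; auto.
  - apply pt_res; auto. apply iet_pt; auto.
Qed.

Lemma commute_res f X h : commute_fun f h -> (forall x, X x <-> X (f x)) -> commute_fun f (res X h).
Proof.
  intros Hc HX x. destruct (classic (X x)) as [H|H].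
  - rewrite !res_in; auto. apply (proj1 (HX x)); auto.
  - rewrite !res_out; auto. intro H'. apply H, HX; auto.
Qed.

Lemma res_supported X h : supported_in (res X h) X.
Proof. intros x _ H. destruct (classic (X x)); auto. rewrite res_out in H; tauto. Qed.

(** * Periodic points *)

Lemma fun_choice {A B : Type} (P : A -> B -> Prop) :
  (forall a, exists b, P a b) -> exists F : A -> B, forall a, P a (F a).
Proof.
  intro H. exists (fun a => proj1_sig (constructive_indefinite_description _ (H a))).
  intro a. apply (proj2_sig (constructive_indefinite_description _ (H a))).
Qed.

Lemma least_nat (P : nat -> Prop) : (exists n, P n) -> exists n, P n /\ forall m, (m < n)%nat -> ~ P m.
Proof.
  intros [n Hn]. apply NNPP. intro Hno.
  assert (H : forall m, ~ P m); [|apply (H n Hn)].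
  intro m. induction m as [m IH] using lt_wf_ind. intro Hm.
  apply Hno. exists m. auto.
Qed.

Lemma argmin_lt (n : nat) (w : nat -> R) : (1 <= n)%nat ->
  exists i, (i < n)%nat /\ forall j, (j < n)%nat -> w i <= w j.
Proof.
  induction n as [|n IH]; intro H; [lia|].
  destruct n as [|n].
  - exists O. split; [lia|]. intros j Hj. replace j with O by lia. lra.
  - destruct IH as [i [Hi Hm]]; [lia|].
    destruct (Rle_dec (w i) (w (S n))) as [Hle|Hgt].
    + exists i. split; [lia|]. intros j Hj. destruct (Nat.eq_dec j (S n)) as [->|Hne]; auto.
      apply Hm; lia.
    + exists (S n). split; [lia|]. intros j Hj. destruct (Nat.eq_dec j (S n)) as [->|Hne]; [lra|].
      assert (w i <= w j) by (apply Hm; lia). lra.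
Qed.

(** Each entry of the list is taken at most once. Applied to orbits without repetition, this carries
    a germ or a point past the last discontinuity on its way. *)
Lemma seq_eventually_avoids {T} (w : nat -> T) (L : list T) :
  (forall i j, w i = w j -> i = j) -> exists N, forall n, (N <= n)%nat -> ~ In (w n) L.
Proof.
  intro Hinj. induction L as [|d L [N HN]].
  - exists O. intros n _ [].
  - destruct (classic (exists i, w i = d)) as [[i Hi]|Hn].
    + exists (Nat.max N (S i)). intros n Hn [Hd|Hd]; [|apply (HN n); auto; lia].
      rewrite <- Hi in Hd. apply Hinj in Hd. lia.
    + exists N. intros n Hn' [Hd|Hd]; [apply Hn; eauto|]. apply (HN n); auto.
Qed.

(** Pigeonhole: terms at distance at least [e] fall into different cells of length [e], and [0,1)
    meets only finitely many cells. *)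
Lemma no_separated_sequence (w : nat -> R) (e : R) : 0 < e -> (forall n, in01 (w n)) ->
  ~ (forall i j, (i < j)%nat -> e <= Rabs (w i - w j)).
Proof.
  intros He Hw Hsep.
  assert (Hc : exists z : nat -> Z, forall n, IZR (z n) <= w n / e < IZR (z n) + 1).
  { apply (fun_choice (fun n z => IZR z <= w n / e < IZR z + 1)). intro n.
    exists (Int_part (w n / e)). pose proof (base_Int_part (w n / e)). lra. }
  destruct Hc as [z Hz].
  assert (Hinj : forall i j, (i < j)%nat -> z i <> z j).
  { intros i j Hij E. pose proof (Hz i). pose proof (Hz j). rewrite E in H.
    assert (Rabs (w i / e - w j / e) < 1) by (apply Rabs_def1; lra).
    replace (w i / e - w j / e) with ((w i - w j) / e) in H1 by (field; lra).
    unfold Rdiv in H1. rewrite Rabs_mult, (Rabs_right (/ e)) in H1 by (left; apply Rinv_0_lt_compat; auto).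
    specialize (Hsep i j Hij).
    assert (e * / e <= Rabs (w i - w j) * / e) by (apply Rmult_le_compat_r; [left; apply Rinv_0_lt_compat|]; auto).
    rewrite Rinv_r in H2 by lra. lra. }
  destruct (archimed (1 / e)) as [Hup _].
  destruct (seq_eventually_avoids z (map Z.of_nat (seq 0 (Z.to_nat (up (1 / e)))))) as [N HN].
  { intros i j E. destruct (Nat.lt_trichotomy i j) as [H|[H|H]]; auto.
    - exfalso. apply (Hinj i j H E).
    - exfalso. apply (Hinj j i H). auto. }
  apply (HN N (le_n N)).
  pose proof (Hw N) as Hwn. unfold in01 in Hwn. specialize (Hz N).
  assert (H1 : 0 <= w N / e) by (apply Rmult_le_pos; [lra|left; apply Rinv_0_lt_compat; auto]).
  assert (H2 : w N / e < 1 / e) by (apply Rmult_lt_compat_r; [apply Rinv_0_lt_compat; auto|lra]).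
  assert (H3 : (-1 < z N)%Z) by (apply lt_IZR; simpl; lra).
  assert (H4 : (z N < up (1 / e))%Z) by (apply lt_IZR; lra).
  rewrite <- (Z2Nat.id (z N)) by lia. apply in_map. apply in_seq. lia.
Qed.

Definition min_period (f : R -> R) (n : nat) (x : R) : Prop :=
  in01 x /\ (1 <= n)%nat /\ iter n f x = x /\ forall m, (1 <= m < n)%nat -> iter m f x <> x.

Lemma Per_min_period f x : Per f x -> exists n, min_period f n x.
Proof.
  intros [Hx [n Hn]]. destruct (least_nat (fun n => iter (S n) f x = x)) as [m [Hm Hl]]; [eauto|].
  exists (S m). repeat split; auto; try lia; try apply Hx.
  intros [|j] Hj; [lia|]. apply Hl. lia.
Qed.

Lemma min_period_Per f n x : min_period f n x -> Per f x.
Proof. intros (Hx & Hn & E & _). split; auto. destruct n; [lia|]. eauto. Qed.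

Lemma min_period_unique f n m x : min_period f n x -> min_period f m x -> n = m.
Proof.
  intros (_ & H1 & H2 & H3) (_ & H4 & H5 & H6).
  destruct (Nat.lt_trichotomy n m) as [H|[H|H]]; auto; exfalso.
  - apply (H6 n); auto.
  - apply (H3 m); auto.
Qed.

Lemma iter_iter_comm g m n x : iter m g (iter n g x) = iter n g (iter m g x).
Proof. rewrite <- !iter_add, Nat.add_comm. auto. Qed.

Lemma iter_mod g n m x : (1 <= n)%nat -> iter n g x = x -> iter m g x = iter (m mod n) g x.
Proof.
  intros Hn H. rewrite (Nat.div_mod m n) at 1 by lia.
  rewrite Nat.add_comm, iter_add, Nat.mul_comm, iter_mult; auto.
Qed.

(* Sliding the whole orbit of [x] to the left until it meets a break point
   changes neither the itinerary nor the minimal period. *)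
Lemma min_period_break f D n x : is_iet f ->
  (forall x y, in01 x -> in01 y -> x < y -> avoids D x y -> f y - f x = y - x) ->
  min_period f n x -> exists d, In d (0 :: D) /\ min_period f n d.
Proof.
  intros Hf HD (Hx & Hn & Hp & Hmin).
  assert (Horb : forall m, in01 (iter m f x)) by (intro; apply iet_in; auto; apply iet_iter; auto).
  assert (Hv : exists v : nat -> R, forall m, 0 <= v m <= iter m f x /\ (v m = 0 \/ In (v m) D) /\ avoids D (v m) (iter m f x)).
  { apply (fun_choice (fun m v => 0 <= v <= iter m f x /\ (v = 0 \/ In v D) /\ avoids D v (iter m f x))).
    intro m. apply prev_exists. apply Horb. }
  destruct Hv as [v Hv].
  (* [v m] is the last break point, or 0, at or before the [m]-th orbit point. The smallest gap
     along one period is the longest slide under which no orbit point passes a break; it carries the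
     [i]-th point exactly onto [v i]. *)
  destruct (argmin_lt n (fun m => iter m f x - v m) Hn) as [i [Hi Hmi]].
  set (dl := iter i f x - v i) in *.
  assert (Hdl : forall m, dl <= iter m f x /\ avoids D (iter m f x - dl) (iter m f x)).
  { intro m. rewrite (iter_mod f n m x Hn Hp).
    assert (Hm : (m mod n < n)%nat) by (apply Nat.mod_upper_bound; lia).
    specialize (Hmi _ Hm). destruct (Hv (m mod n)) as [H1 [H2 H3]].
    split; [unfold dl in *; lra|]. apply (avoids_sub D _ _ _ _ H3); lra. }
  assert (Hdl0 : 0 <= dl) by (unfold dl; pose proof (Hv i); lra).
  assert (Hsl : forall j, iter j f (iter i f x - dl) = iter j f (iter i f x) - dl).
  { induction j as [|j IH]; simpl; [auto|]. rewrite IH.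
    rewrite <- !iter_add. pose proof (Hdl (j + i)%nat) as [H1 H2]. pose proof (Horb (j + i)%nat) as H3.
    destruct (Req_dec dl 0) as [->|Hne]; [rewrite !Rminus_0_r; auto|].
    assert (f (iter (j + i) f x) - f (iter (j + i) f x - dl) = dl).
    { rewrite HD; auto; unfold in01 in *; lra. }
    lra. }
  assert (Hy : iter i f x - dl = v i) by (unfold dl; lra).
  exists (v i). destruct (Hv i) as [H1 [H2 _]]. split.
  - destruct H2 as [->|H2]; [left|right]; auto.
  - rewrite <- Hy. split.
    + pose proof (Horb i). unfold in01 in *. lra.
    + split; auto. split.
      * rewrite Hsl, iter_iter_comm, Hp; auto.
      * intros m Hm E. rewrite Hsl in E. apply (Hmin m Hm).
        apply (iet_inj (iter i f)); [apply iet_iter; auto|]. rewrite iter_iter_comm. lra.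
Qed.

(** By [min_period_break] every minimal period already occurs at one of the finitely many points of
    [0 :: D]. *)
Lemma periods_bounded f : is_iet f -> exists N, forall n x, min_period f n x -> (n <= N)%nat.
Proof.
  intro Hf. destruct (iet_pt f Hf) as [D HD].
  assert (Hl : forall l : list R, exists N, forall d n, In d l -> min_period f n d -> (n <= N)%nat).
  { induction l as [|d l [N HN]].
    - exists O. intros d n [].
    - destruct (classic (exists m, min_period f m d)) as [[m Hm]|Hno].
      + exists (Nat.max N m). intros e n [<-|He] Hn.
        * rewrite (min_period_unique f n m d Hn Hm). lia.
        * specialize (HN e n He Hn). lia.
      + exists N. intros e n [<-|He] Hn; [exfalso; apply Hno; eauto|]. eapply HN; eauto. }
  destruct (Hl (0 :: D)) as [N HN]. exists N. intros n x Hx.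
  destruct (min_period_break f D n x Hf HD Hx) as [d [Hd Hd']]. eapply HN; eauto.
Qed.

Lemma pset_iter_fix f n : is_iet f -> pset (fun x => iter n f x = x).
Proof.
  intro Hf. eapply pcw_impl; [|apply (iet_pt _ (iet_iter n f Hf))].
  cbv beta. intros x y _ _ _ H. split; intro; lra.
Qed.

Lemma pset_min_period f n : is_iet f -> pset (min_period f n).
Proof.
  intro Hf. unfold min_period. apply pset_and; [apply pset_in01|].
  apply pset_and; [apply pcw_true; tauto|]. apply pset_and; [apply pset_iter_fix; auto|].
  apply (pset_ext (fun x => forall m, (m < n)%nat -> (1 <= m)%nat -> iter m f x <> x)).
  - intros x _. split; intros H m; intros; apply H; lia.
  - apply pset_forall_lt. intros m _. destruct (classic (1 <= m)%nat) as [Hm|Hm].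
    + apply (pset_ext (fun x => ~ iter m f x = x)); [intros; tauto|].
      apply pset_not, pset_iter_fix; auto.
    + apply pcw_true. tauto.
Qed.

Lemma pset_Per f : is_iet f -> pset (Per f).
Proof.
  intro Hf. destruct (periods_bounded f Hf) as [N HN].
  apply (pset_ext (fun x => exists n, (n < S N)%nat /\ min_period f n x)).
  - intros x _. split.
    + intros [n [_ Hn]]. eapply min_period_Per; eauto.
    + intro H. destruct (Per_min_period f x H) as [n Hn]. exists n. split; auto.
      specialize (HN n x Hn). lia.
  - apply pset_exists_lt. intros. apply pset_min_period; auto.
Qed.

Lemma Per_invariant_gen f h x : is_iet f -> is_iet h -> commute_fun f h -> Per f x <-> Per f (h x).
Proof.
  intros Hf Hh Hc. unfold Per. rewrite (iet_in_iff h x Hh).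
  assert (E : forall n, iter n f (h x) = h (iter n f x)) by (intro n; symmetry; apply (commute_iter h f n (commute_sym _ _ Hc))).
  split; intros [H1 [n Hn]]; split; auto; exists n.
  - rewrite E, Hn; auto.
  - rewrite E in Hn. apply (iet_inj h); auto.
Qed.

Lemma min_period_invariant f h n x : is_iet f -> is_iet h -> commute_fun f h ->
  min_period f n x <-> min_period f n (h x).
Proof.
  intros Hf Hh Hc. unfold min_period. rewrite (iet_in_iff h x Hh).
  assert (E : forall n, iter n f (h x) = h (iter n f x)) by (intro; symmetry; apply (commute_iter h f _ (commute_sym _ _ Hc))).
  split; intros (H1 & H2 & H3 & H4); repeat split; auto; try apply H1.
  - rewrite E, H3; auto.
  - intros m Hm H. rewrite E in H. apply iet_inj in H; auto. apply (H4 m); auto.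
  - rewrite E in H3. apply iet_inj in H3; auto.
  - intros m Hm H. apply (H4 m); auto. rewrite E, H; auto.
Qed.

(** Stated for an arbitrary [F], because it is applied to the left-germ map [lft f] as well as to
    interval exchanges. *)
Definition wanders (F : R -> R) (p : R) : Prop := forall a b, iter a F p = iter b F p -> a = b.

Lemma nonper_wanders f x : is_iet f -> in01 x -> ~ Per f x -> wanders f x.
Proof.
  intros Hf Hx Hn.
  assert (H : forall a b, (a < b)%nat -> iter a f x = iter b f x -> False).
  { intros a b Hab E. apply Hn. split; auto. exists (b - a - 1)%nat.
    apply (iet_inj (iter a f)); [apply iet_iter; auto|].
    rewrite <- iter_add, E. f_equal. lia. }
  intros a b E. destruct (Nat.lt_trichotomy a b) as [Hab|[Hab|Hab]]; auto; exfalso; eauto.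
Qed.

Lemma Per_inv f x : is_iet f -> Per (inv f) x <-> Per f x.
Proof.
  intro Hf. unfold Per. split; intros [Hx [n Hn]]; split; auto; exists n.
  - rewrite <- Hn at 1. apply iter_inv_r; auto.
  - rewrite <- Hn at 1. apply iter_inv_l; auto.
Qed.

Lemma finite_union_lists {T S} (l : list T) (P : T -> S -> Prop) :
  (forall t, In t l -> exists L, forall p, P t p -> In p L) ->
  exists L, forall t p, In t l -> P t p -> In p L.
Proof.
  induction l as [|t l IH]; intro H.
  - exists nil. intros t p [].
  - destruct (H t (or_introl eq_refl)) as [L1 H1].
    destruct IH as [L2 H2]; [intros; apply H; right; auto|].
    exists (L1 ++ L2). intros t' p [<-|Ht] Hp; apply in_or_app; [left|right]; eauto.
Qed.

(** Fix the end [d] and the start [d']. The forward orbit of [d] inherits from [p] that it never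
    repeats, so all segments from [d'] to [d] have the same length, and [p] is one of the points on
    a single segment. *)
Lemma wandering_segments_finite (F : R -> R) (D D' : list R) :
  exists L, forall p, wanders F p -> (exists n, In (iter n F p) D) ->
    (exists m d', In d' D' /\ iter m F d' = p) -> In p L.
Proof.
  destruct (finite_union_lists (list_prod D D')
    (fun dd p => wanders F p /\ exists n m, iter n F p = fst dd /\ iter m F (snd dd) = p)) as [L HL].
  - intros [d d'] _. simpl.
    destruct (classic (exists p, wanders F p /\ exists n m, iter n F p = d /\ iter m F d' = p))
      as [(p & Hp & n & m & H1 & H2)|Hno].
    + exists (map (fun j => iter j F d') (seq 0 (S (n + m)))).
      intros p' (Hp' & n' & m' & H1' & H2').
      assert (Hd : wanders F d).
      { intros a b E. rewrite <- H1, <- !iter_add in E. apply Hp in E. lia. }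
      assert (E1 : iter (n + m) F d' = d) by (rewrite iter_add, H2; auto).
      assert (E2 : iter (n' + m') F d' = d) by (rewrite iter_add, H2'; auto).
      assert (Heq : (n' + m' = n + m)%nat).
      { destruct (Nat.lt_trichotomy (n' + m') (n + m)) as [H|[H|H]]; auto; exfalso.
        - assert (E : iter (n + m - (n' + m')) F d = iter 0 F d).
          { simpl. rewrite <- E2 at 1. rewrite <- iter_add, <- E1. f_equal. lia. }
          apply Hd in E. lia.
        - assert (E : iter (n' + m' - (n + m)) F d = iter 0 F d).
          { simpl. rewrite <- E1 at 1. rewrite <- iter_add, <- E2. f_equal. lia. }
          apply Hd in E. lia. }
      rewrite <- H2'. apply (in_map (fun j => iter j F d')). apply in_seq. lia.
    + exists nil. intros p' H. exfalso. apply Hno. exists p'. auto.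
  - exists L. intros p Hp [n Hn] (m & d' & Hd' & Hm).
    apply (HL (iter n F p, d')); [apply in_prod; auto|]. split; auto. exists n, m. auto.
Qed.

(** * Existence of minimal components *)

(* Each [e] has at most two such [c]: [e] itself ([s = 0]) and the last visit to [I] before [e]. *)
Definition first_entry (f : R -> R) (I : R -> Prop) (e c : R) : Prop :=
  exists s, iter s f c = e /\ I c /\ forall s', (0 < s' < s)%nat -> ~ I (iter s' f c).

(** Of two candidates with different positive times, the one with the longer time passes through the
    other on its way to [e], by injectivity, and so visits [I] too early. *)
Lemma first_entries_finite f (I : R -> Prop) (E : list R) : is_iet f ->
  exists P, forall e c, In e E -> first_entry f I e c -> In c P.
Proof.
  intro Hf. apply finite_union_lists. intros e _.
  destruct (classic (exists s c, (1 <= s)%nat /\ iter s f c = e /\ I c /\ forall s', (0 < s' < s)%nat -> ~ I (iter s' f c)))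
    as [(s & c & Hs & H1 & H2 & H3)|Hno].
  - exists [e; c]. intros c' (s' & H1' & H2' & H3').
    destruct s' as [|s']; [left; auto|right; left].
    assert (Hlt : forall s1 s2 c1 c2, (1 <= s1 < s2)%nat -> iter s1 f c1 = e -> iter s2 f c2 = e -> I c1 ->
      (forall s', (0 < s' < s2)%nat -> ~ I (iter s' f c2)) -> False).
    { intros s1 s2 c1 c2 Hs12 E1 E2 Hc1 Hc2. apply (Hc2 (s2 - s1)%nat); [lia|].
      replace (iter (s2 - s1) f c2) with c1; auto.
      apply (iet_inj (iter s1 f)); [apply iet_iter; auto|].
      rewrite <- iter_add, E1, <- E2. f_equal. lia. }
    destruct (Nat.lt_trichotomy (S s') s) as [H|[H|H]].
    + exfalso. apply (Hlt (S s') s c' c); auto; lia.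
    + subst s. apply (iet_inj (iter (S s') f)); [apply iet_iter; auto|]. congruence.
    + exfalso. apply (Hlt s (S s') c c'); auto; lia.
  - exists [e]. intros c' (s' & H1' & H2' & H3'). destruct s' as [|s']; [left; auto|].
    exfalso. apply Hno. exists (S s'), c'. repeat split; auto. lia.
Qed.

(** Up to the first return of any point, the piece moves as a rigid block, since a cut inside a
    translate would produce a first entry inside the piece. *)
Lemma return_piece f D P p q u v : is_iet f -> 0 <= p -> q <= 1 -> p <= u -> u < v -> v <= q ->
  (forall x y, in01 x -> in01 y -> x < y -> avoids D x y -> f y - f x = y - x) ->
  (forall e c, In e (p :: q :: D) -> first_entry f (fun x => p <= x < q) e c -> In c P) ->
  (forall d, In d P -> ~ (u < d < v)) ->
  exists n, (1 <= n)%nat /\ forall x, u <= x < v -> p <= iter n f x < q.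
Proof.
  intros Hf Hp0 Hq1 Hpu Huv Hvq HD HP HuvP.
  assert (Htr : forall t, (forall s x, (0 < s < t)%nat -> u <= x < v -> ~ p <= iter s f x < q) ->
     forall s, (s <= t)%nat -> forall x, u <= x < v -> iter s f x = iter s f u + (x - u)).
  { intros t Ht s. induction s as [|s IH]; intros Hs x Hx; simpl; [lra|].
    assert (IH' : forall x, u <= x < v -> iter s f x = iter s f u + (x - u)) by (apply IH; lia).
    destruct (Req_dec x u) as [->|Hne]; [lra|].
    assert (f (iter s f x) - f (iter s f u) = iter s f x - iter s f u); [|pose proof (IH' x Hx); lra].
    apply HD.
    - apply iet_in; [apply iet_iter; auto|]. unfold in01; lra.
    - apply iet_in; [apply iet_iter; auto|]. unfold in01; lra.
    - rewrite (IH' x Hx). lra.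
    - intros d Hd Hi. rewrite (IH' x Hx) in Hi.
      set (z := u + (d - iter s f u)). assert (Hz : u < z <= x) by (unfold z; lra).
      apply (HuvP z); [|lra]. apply (HP d z); [right; right; auto|].
      exists s. split; [|split].
      + rewrite (IH' z) by lra. unfold z. lra.
      + lra.
      + intros s' Hs'. apply Ht; [lia|lra]. }
  destruct (classic (exists t, (1 <= t)%nat /\ exists x, u <= x < v /\ p <= iter t f x < q)) as [Hex|Hno].
  - apply least_nat in Hex. destruct Hex as (t & (Ht1 & x1 & Hx1 & Hx1') & Hmin).
    assert (Hmin' : forall s x, (0 < s < t)%nat -> u <= x < v -> ~ p <= iter s f x < q).
    { intros s x Hs Hx Hi. apply (Hmin s); [lia|]. split; [lia|]. eauto. }
    pose proof (Htr t Hmin' t (le_n t)) as HT.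
    (* The returning block cannot stick out of the interval: an endpoint [p] or [q] in its interior
       would again come from a first entry strictly between [u] and [v]. *)
    assert (Hcut : forall e z, In e [p; q] -> u < z < v -> iter t f z = e -> False).
    { intros e z He Hz E. apply (HuvP z); [|lra]. apply (HP e z).
      - destruct He as [He|[He|[]]]; [left|right; left]; auto.
      - exists t. split; auto. split; [lra|]. intros s' Hs'. apply Hmin'; [lia|lra]. }
    exists t. split; auto. intros x Hx. pose proof (HT x Hx) as E. pose proof (HT x1 Hx1) as E1.
    split.
    + destruct (Rle_dec p (iter t f x)) as [|Hlt]; auto. exfalso.
      apply (Hcut p (u + (p - iter t f u))); [left; auto|lra|]. rewrite HT; lra.
    + destruct (Rlt_dec (iter t f x) q) as [|Hge]; auto. exfalso.
      apply (Hcut q (u + (q - iter t f u))); [right; left; auto|lra|]. rewrite HT; lra.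
  - exfalso.
    assert (Hn : forall s x, (0 < s)%nat -> u <= x < v -> ~ p <= iter s f x < q).
    { intros s x Hs Hx Hi. apply Hno. exists s. split; [lia|]. eauto. }
    (* If no point ever returned, the translates of the block would be pairwise disjoint: an overlap
       of the [i]-th and [j]-th, pulled back [i] steps, is a return after [j - i] steps. *)
    apply (no_separated_sequence (fun s => iter s f u) (v - u)); [lra| |].
    + intro n. apply iet_in; [apply iet_iter; auto|]. unfold in01; lra.
    + intros i j Hij.
      destruct (Rle_dec (v - u) (Rabs (iter i f u - iter j f u))) as [|Hlt]; auto. exfalso.
      assert (HT : forall s x, u <= x < v -> iter s f x = iter s f u + (x - u)).
      { intros s x Hx. apply (Htr s); auto. intros s' x' Hs' Hx'. apply Hn; auto; lia. }
      apply Rnot_le_lt in Hlt. apply Rabs_def2 in Hlt.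
      assert (Hx : exists x x', u <= x < v /\ u <= x' < v /\ iter i f x = iter j f x').
      { destruct (Rle_dec (iter i f u) (iter j f u)).
        - exists (u + (iter j f u - iter i f u)), u. split; [lra|]. split; [lra|].
          rewrite HT; lra.
        - exists u, (u + (iter i f u - iter j f u)). split; [lra|]. split; [lra|].
          rewrite (HT j); lra. }
      destruct Hx as (x & x' & Hx & Hx' & E).
      apply (Hn (j - i)%nat x'); [lia|auto|].
      replace (iter (j - i) f x') with x; [lra|].
      apply (iet_inj (iter i f)); [apply iet_iter; auto|]. rewrite <- iter_add, E. f_equal. lia.
Qed.

(** The first entries split the interval into finitely many pieces with one return time each; the
    bound is their maximum, found by recursion over the left endpoints. *)
Lemma return_bounded f p q : is_iet f -> 0 <= p -> p < q -> q <= 1 ->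
  exists N, forall x, p <= x < q -> exists n, (1 <= n <= N)%nat /\ p <= iter n f x < q.
Proof.
  intros Hf Hp Hpq Hq. destruct (iet_pt f Hf) as [D HD].
  destruct (first_entries_finite f (fun x => p <= x < q) (p :: q :: D) Hf) as [P HP].
  assert (Hl : forall l : list R, exists N, forall u, In u l -> p <= u < q ->
     exists n, (1 <= n <= N)%nat /\ forall x, u <= x < q -> avoids P u x -> p <= iter n f x < q).
  { induction l as [|u l [N HN]].
    - exists O. intros u [].
    - destruct (classic (p <= u < q)) as [Hu|Hu].
      + destruct (next_exists (q :: P) u) as [v [Hv [Hv1 Hv2]]]; [lra|].
        assert (Hvq : v <= q).
        { destruct (Rle_dec v q); auto. exfalso. apply (Hv2 q); [left; auto|lra]. }
        destruct (return_piece f D P p q u v) as [n [Hn1 Hn2]]; auto; try lra.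
        { intros d Hd. apply Hv2. right; auto. }
        exists (Nat.max N n). intros u' [<-|Hu'] Hu''.
        * exists n. split; [lia|]. intros x Hx Ha. apply Hn2. split; [lra|].
          destruct (Rlt_dec x v) as [|Hge]; auto. exfalso.
          destruct Hv1 as [Hv1|[Hv1|Hv1]]; try lra. apply (Ha v Hv1). lra.
        * destruct (HN u' Hu' Hu'') as [n' [Hn' Hn'']]. exists n'. split; [lia|auto].
      + exists N. intros u' [<-|Hu'] Hu''; [tauto|auto]. }
  destruct (Hl (p :: P)) as [N HN]. exists N. intros x Hx.
  destruct (prev_exists (p :: P) x) as [u [Hu [Hu1 Hu2]]]; [lra|].
  assert (Hpu : p <= u).
  { destruct (Rle_dec p u); auto. exfalso. apply (Hu2 p); [left; auto|lra]. }
  destruct (HN u) as [n [Hn1 Hn2]].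
  - destruct Hu1 as [Hu1|Hu1]; auto. left. lra.
  - lra.
  - exists n. split; auto. apply Hn2; [lra|]. intros d Hd. apply Hu2. right; auto.
Qed.

(** * Saturation of an interval and breaks of invariant sets *)

Definition hits (f : R -> R) (p q x : R) : Prop := exists n, p <= iter n f x < q.

(** A visit at time 0 is lost on passing to [f x]; recurrence supplies a later one to replace it. *)
Lemma hits_invariant f p q x : is_iet f -> 0 <= p -> p < q -> q <= 1 -> hits f p q x <-> hits f p q (f x).
Proof.
  intros Hf Hp Hpq Hq. destruct (return_bounded f p q Hf Hp Hpq Hq) as [N HN]. split.
  - intros [n Hn]. destruct (HN _ Hn) as [m [Hm Hm']].
    exists (m - 1 + n)%nat. rewrite iter_comm. change (p <= iter (S (m - 1 + n)) f x < q).
    replace (S (m - 1 + n)) with (m + n)%nat by lia. rewrite iter_add. auto.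
  - intros [n Hn]. exists (S n). simpl. rewrite <- iter_comm. auto.
Qed.

(** The first visit happens within a bounded time. If it came later than the return bound [N] of
    [inv f], running back from it would find an earlier visit. *)
Lemma pset_hits f p q : is_iet f -> 0 <= p -> p < q -> q <= 1 -> pset (hits f p q).
Proof.
  intros Hf Hp Hpq Hq.
  destruct (return_bounded (inv f) p q (iet_inv f Hf) Hp Hpq Hq) as [N HN].
  apply (pset_ext (fun x => exists n, (n < S N)%nat /\ p <= iter n f x < q)).
  - intros x _. split.
    + intros [n [_ Hn]]. exists n. auto.
    + intros Hh. apply least_nat in Hh. destruct Hh as [n [Hn Hmin]]. exists n. split; auto.
      destruct (le_lt_dec n N) as [|Hlt]; [lia|]. exfalso.
      destruct (HN _ Hn) as [m [Hm Hm']]. apply (Hmin (n - m)%nat); [lia|].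
      replace (iter n f x) with (iter m f (iter (n - m) f x)) in Hm' by (rewrite <- iter_add; f_equal; lia).
      rewrite iter_inv_l in Hm'; auto.
  - apply pset_exists_lt. intros n _. apply (pset_preimage (iter n f) (fun x => p <= x < q)).
    + apply iet_iter; auto.
    + apply pset_interval.
Qed.

Definition no_break (X : R -> Prop) (p : R) : Prop :=
  exists e, 0 < e /\ e <= p /\ forall s, 0 < s -> s <= e -> (X (p - s) <-> X p).

Lemma pset_no_break X : pset X -> exists D, forall p, 0 < p < 1 -> ~ In p D -> no_break X p.
Proof.
  intro HX. destruct (pcw_left_closed _ HX) as [D HD]. exists D. intros p Hp Hn.
  destruct (HD p Hp Hn) as [e [He [Hep H]]]. exists e. repeat split; auto; intro HH.
  - specialize (H s 0). rewrite Rminus_0_r in H. apply H; auto; lra.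
  - specialize (H s 0). rewrite Rminus_0_r in H. apply H; auto; lra.
Qed.

(** Among the finitely many cuts between [x] and [y] where membership differs from that of [x], the
    first one would be a break. *)
Lemma pset_const_no_break X x y : pset X -> in01 x -> in01 y -> x < y ->
  (forall p, x < p <= y -> no_break X p) -> (X x <-> X y).
Proof.
  intros [D HD] Hx Hy Hxy Hnb. apply NNPP. intro Hne.
  set (P := filter (fun d => if excluded_middle_informative (x < d <= y /\ ~ (X d <-> X x)) then true else false) D).
  assert (HP : forall d, In d P <-> In d D /\ x < d <= y /\ ~ (X d <-> X x)).
  { intro d. unfold P. rewrite filter_In. destruct (excluded_middle_informative _); intuition discriminate. }
  assert (Hfind : forall t, x < t <= y -> ~ (X t <-> X x) -> exists d, In d P /\ d <= t).
  { intros t Ht Hn. unfold in01 in *. destruct (prev_exists D t) as [v [Hv [Hv1 Hv2]]]; [lra|].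
    assert (Hxv : x < v).
    { destruct (Rlt_dec x v); auto. exfalso. apply Hn.
      assert (X x <-> X t); [|tauto]. apply HD; unfold in01; try lra.
      apply (avoids_sub D v t); auto; lra. }
    assert (HXv : X v <-> X t).
    { destruct (Req_dec v t) as [->|Hvt]; [tauto|]. apply HD; unfold in01; try lra; auto. }
    exists v. split; [|lra]. apply HP. split; [|split; [lra|tauto]]. destruct Hv1 as [->|]; auto; lra. }
  destruct (Hfind y) as [d0 [Hd0 _]]; [lra|tauto|].
  destruct (next_exists P x) as [v [Hv [Hv1 Hv2]]]; [unfold in01 in *; lra|].
  assert (Hvd : v <= d0).
  { destruct (Rle_dec v d0); auto. exfalso. apply (Hv2 d0); auto. apply HP in Hd0. lra. }
  assert (HvP : In v P). { destruct Hv1 as [Hv1|]; auto. apply HP in Hd0. unfold in01 in *. lra. }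
  apply HP in HvP. destruct HvP as (_ & Hvxy & HvX).
  destruct (Hnb v Hvxy) as [e [He [Hev Hc]]].
  set (s := Rmin e ((v - x) / 2)).
  assert (Hs : 0 < s /\ s <= e /\ s <= (v - x) / 2).
  { unfold s. split; [apply Rmin_pos; lra|]. split; [apply Rmin_l|apply Rmin_r]. }
  destruct (Hfind (v - s)) as [d [Hd Hdt]]; [lra| |].
  - rewrite Hc by lra. auto.
  - apply (Hv2 d Hd). apply HP in Hd. lra.
Qed.

(* A break of an invariant set propagates along the orbit as long as [g] has no break. *)
Lemma invariant_no_break g X Dg p : is_iet g -> pset X -> (forall x, X x <-> X (g x)) ->
  (forall p, 0 < p < 1 -> ~ In p Dg -> exists e, 0 < e /\ e <= p /\ forall s, 0 < s -> s <= e -> g (p - s) = g p - s) ->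
  in01 p -> wanders g p -> (forall n, ~ In (iter n g p) (0 :: Dg)) -> no_break X p.
Proof.
  intros Hg HX Hinv HDg Hp Hw Hav. apply NNPP. intro Hb.
  assert (Horb : forall n, in01 (iter n g p)) by (intro; apply iet_in; auto; apply iet_iter; auto).
  assert (Hpos : forall n, 0 < iter n g p).
  { intro n. specialize (Horb n). unfold in01 in Horb. specialize (Hav n).
    destruct (Req_dec (iter n g p) 0) as [E|]; [|lra]. exfalso. apply Hav. left; auto. }
  assert (Hall : forall n, ~ no_break X (iter n g p)).
  { induction n as [|n IH]; auto. simpl. intros [e [He [Hep H]]]. apply IH.
    destruct (HDg (iter n g p)) as [e' [He' [Hep' H']]].
    - specialize (Hpos n). specialize (Horb n). unfold in01 in Horb. lra.
    - intro. apply (Hav n). right; auto.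
    - exists (Rmin e e'). pose proof (Rmin_l e e'). pose proof (Rmin_r e e').
      split; [apply Rmin_pos; auto|]. split; [lra|]. intros s Hs1 Hs2.
      rewrite (Hinv (iter n g p - s)), (Hinv (iter n g p)), H' by lra. apply H; lra. }
  (* The breaks of [X] are finite in number, and the orbit, which never repeats, eventually leaves
     them. *)
  destruct (pset_no_break X HX) as [D HD].
  destruct (seq_eventually_avoids (fun n => iter n g p) D) as [N HN]; [apply Hw|].
  apply (Hall N). apply HD; auto.
  specialize (Hpos N). specialize (Horb N). unfold in01 in Horb. lra.
Qed.

Lemma iet_left_closed g : is_iet g -> exists D, forall p, 0 < p < 1 -> ~ In p D ->
  exists e, 0 < e /\ e <= p /\ forall s, 0 < s -> s <= e -> g (p - s) = g p - s.
Proof.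
  intro Hg. destruct (pcw_left_closed _ (iet_pt g Hg)) as [D HD]. exists D. intros p Hp Hn.
  destruct (HD p Hp Hn) as [e [He [Hep H]]]. exists e. repeat split; auto. intros s H1 H2.
  specialize (H s 0). rewrite Rminus_0_r in H. specialize (H (Rle_refl 0) H1 H2). lra.
Qed.

Definition nonper (f : R -> R) (x : R) : Prop := in01 x /\ ~ Per f x.

Lemma pset_nonper f : is_iet f -> pset (nonper f).
Proof. intro Hf. apply pset_and; [apply pset_in01|]. apply pset_not, pset_Per; auto. Qed.

Lemma nonper_invariant f h x : is_iet f -> is_iet h -> commute_fun f h -> nonper f x <-> nonper f (h x).
Proof. intros Hf Hh Hc. unfold nonper. rewrite (iet_in_iff h x Hh), <- (Per_invariant_gen f h x); tauto. Qed.

(** The point is that [L] is independent of [X]: it depends on the discontinuities of [f] and of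
    [inv f] and on the border of the aperiodic part. This uniformity lets finitely many points
    control all invariant sets at once. *)
Lemma invariant_sets_uniform f : is_iet f -> exists L, forall X, pset X ->
  (forall x, X x <-> X (f x)) -> (forall x, X x -> nonper f x) ->
  forall x y, in01 x -> in01 y -> x < y -> avoids L x y -> (X x <-> X y).
Proof.
  intro Hf. pose proof (iet_inv f Hf) as Hfi.
  destruct (pset_no_break _ (pset_nonper f Hf)) as [L1 HL1].
  destruct (iet_left_closed f Hf) as [D HD]. destruct (iet_left_closed (inv f) Hfi) as [D' HD'].
  destruct (wandering_segments_finite f (0 :: D) (0 :: D')) as [L2 HL2].
  exists (L1 ++ L2). intros X HX Hinv Hnp x y Hx Hy Hxy Ha. apply avoids_app in Ha. destruct Ha as [Ha1 Ha2].
  apply pset_const_no_break; auto. intros p Hp.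
  assert (Hp01 : in01 p) by (unfold in01 in *; lra).
  assert (Hp1 : ~ In p L1) by (intro H; apply (Ha1 p H); auto).
  assert (Hp2 : ~ In p L2) by (intro H; apply (Ha2 p H); auto).
  destruct (classic (Per f p)) as [Hper|Hper].
  (* A periodic [p] is outside [X], and so are the points just left of it, because the aperiodic
     part has no break at [p]. *)
  - destruct (HL1 p) as [e [He [Hep H]]]; [unfold in01 in *; lra|auto|].
    exists e. repeat split; auto; intro HH; exfalso.
    + apply Hnp in HH. apply H in HH; auto. destruct HH; auto.
    + apply Hnp in HH. destruct HH; auto.
  - pose proof (nonper_wanders f p Hf Hp01 Hper) as Hw.
    destruct (classic (exists n, In (iter n f p) (0 :: D))) as [[n Hn]|Hno].
    + apply (invariant_no_break (inv f) X D'); auto.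
      * apply inv_invariant; auto.
      * apply nonper_wanders; auto. rewrite Per_inv; auto.
      * intros m Hm. apply Hp2, HL2; auto; [eauto|].
        exists m, (iter m (inv f) p). split; auto. apply iter_inv_r; auto.
    + apply (invariant_no_break f X D); auto. intros n Hn. eauto.
Qed.

Definition countp (X : R -> Prop) (l : list R) : nat :=
  length (filter (fun d => if excluded_middle_informative (X d) then true else false) l).

Lemma countp_le (X Y : R -> Prop) l : (forall x, X x -> Y x) -> (countp X l <= countp Y l)%nat.
Proof.
  intro H. unfold countp. induction l as [|d l IH]; simpl; auto.
  destruct (excluded_middle_informative (X d)), (excluded_middle_informative (Y d)); simpl; try lia.
  exfalso; auto.
Qed.

Lemma countp_eq (X Y : R -> Prop) l : (forall x, X x -> Y x) -> (countp Y l <= countp X l)%nat ->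
  forall d, In d l -> Y d -> X d.
Proof.
  intros H. induction l as [|e l IH]; intros Hle d [].
  - subst e. intro HY. unfold countp in Hle. simpl in Hle. pose proof (countp_le X Y l H) as Hl. unfold countp in Hl.
    destruct (excluded_middle_informative (X d)), (excluded_middle_informative (Y d)); simpl in *; auto; try lia; tauto.
  - apply IH; auto. unfold countp in *. simpl in Hle.
    destruct (excluded_middle_informative (X e)), (excluded_middle_informative (Y e)); simpl in *; try lia.
    exfalso; auto.
Qed.

(** An invariant set of aperiodic points is determined by the entries of [0 :: L] that it contains,
    since every point shares its piece with the last entry before it. The count of these entries is
    thus a measure of size that cannot decrease forever. *)
Lemma minimal_component_exists f x : is_iet f -> nonper f x ->
  exists K, minimal_component f K /\ K x.
Proof.
  intros Hf Hx. destruct (invariant_sets_uniform f Hf) as [L HL].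
  set (Fam := fun X : R -> Prop => pset X /\ (forall x, X x <-> X (f x)) /\ (forall x, X x -> nonper f x) /\ X x).
  destruct (least_nat (fun n => exists X, Fam X /\ countp X (0%R :: L) = n)) as (n & (X & HX & HXn) & Hmin).
  { exists (countp (nonper f) (0%R :: L)), (nonper f). split; auto. split; [|split; [|split]]; auto.
    - apply pset_nonper; auto.
    - intro z. apply nonper_invariant; auto. intro; auto. }
  assert (Hsub : forall Y, Fam Y -> (forall z, Y z -> X z) -> forall z, X z -> Y z).
  { intros Y HY HYX z Hz. destruct HX as (HX1 & HX2 & HX3 & HX4). destruct HY as (HY1 & HY2 & HY3 & HY4).
    assert (Hcnt : (countp X (0%R :: L) <= countp Y (0%R :: L))%nat).
    { rewrite HXn. destruct (le_lt_dec n (countp Y (0%R :: L))) as [|Hlt]; auto. exfalso.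
      apply (Hmin _ Hlt). exists Y. split; auto. split; [|split; [|split]]; auto. }
    pose proof (countp_eq Y X (0%R :: L) HYX Hcnt) as Hpts.
    destruct (HX3 z Hz) as [Hz01 _]. assert (Hz0 : 0 <= z < 1) by exact Hz01.
    destruct (prev_exists (0%R :: L) z) as [v [Hv [Hv1 Hv2]]]; [lra|].
    assert (HvL : In v (0%R :: L)) by (destruct Hv1 as [->|]; [left|]; auto).
    destruct (Req_dec v z) as [<-|Hvz]; auto.
    assert (Hav : avoids L v z) by (intros d Hd; apply Hv2; right; auto).
    assert (Hv01 : in01 v) by (unfold in01; lra).
    assert (Hvz' : v < z) by lra.
    apply (HL Y HY1 HY2 HY3 v z Hv01 Hz01 Hvz' Hav). apply Hpts; auto.
    apply (HL X HX1 HX2 HX3 v z Hv01 Hz01 Hvz' Hav); auto. }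
  destruct HX as (HX1 & HX2 & HX3 & HX4).
  exists X. split; auto. split; [|split; [|split]].
  - apply pset_fui; auto. intros z Hz. apply HX3; auto.
  - exists x. auto.
  - intros z _. apply HX2.
  - intros y w Hy Hw eps Heps.
    assert (Hw01 : in01 w) by (apply HX3; auto). assert (Hw0 : 0 <= w < 1) by exact Hw01.
    destruct (pcw_right _ w HX1 Hw01) as [e0 [He0 [He1 HeX]]].
    set (e := Rmin e0 eps).
    assert (He : 0 < e /\ e <= e0 /\ e <= eps).
    { unfold e. split; [apply Rmin_pos; lra|]. split; [apply Rmin_l|apply Rmin_r]. }
    assert (HI : forall z, w <= z < w + e -> X z).
    { intros z Hz. destruct (Req_dec z w) as [->|]; auto.
      specialize (HeX 0 (z - w)). rewrite Rplus_0_r in HeX. replace (w + (z - w)) with z in HeX by ring.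
      apply HeX; auto; lra. }
    set (U := hits f w (w + e)).
    assert (HU1 : pset U) by (apply pset_hits; auto; lra).
    assert (HU2 : forall z, U z <-> U (f z)) by (intro z; apply hits_invariant; auto; lra).
    assert (HitX : forall m z, X z <-> X (iter m f z)).
    { induction m as [|m IH]; intro z; simpl; [tauto|]. rewrite <- HX2. apply IH. }
    assert (HUX : forall z, U z -> X z).
    { intros z [m Hm]. apply (HitX m). auto. }
    assert (HUw : U w) by (exists O; simpl; lra).
    assert (HUx : U x).
    (* Otherwise the complement of [U] in [X] would be an invariant set around [x], hence all of [X]
       by minimality, although it misses [w]. *)
    { apply NNPP. intro Hnx. apply (Hsub (fun z => X z /\ ~ U z)) in Hw; [tauto| |tauto].
      split; [|split; [|split]]; auto.
      - apply pset_and; auto. apply pset_not; auto.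
      - intro z. rewrite <- HX2, <- HU2. tauto.
      - intros z [Hz _]. auto. }
    assert (HUy : U y).
    { apply (Hsub U); auto. split; [|split; [|split]]; auto. }
    destruct HUy as [m Hm]. exists (iter m f y). split; [exists m; auto|]. split; [apply HI; auto|].
    unfold cdist. eapply Rle_lt_trans; [apply Rmin_l|]. apply Rabs_def1; lra.
Qed.

(** * Left germs and the virtually cyclic case *)

Lemma mc_pset f J : minimal_component f J -> pset J.
Proof. intros [H _]. apply fui_pset; auto. Qed.

Lemma mc_in01 f J x : minimal_component f J -> J x -> in01 x.
Proof. intros [H _]. apply fui_pset; auto. Qed.

Lemma mc_invariant f J : is_iet f -> minimal_component f J -> forall x, J x <-> J (f x).
Proof.
  intros Hf HJ x. destruct (classic (in01 x)) as [Hx|Hx].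
  - destruct HJ as (_ & _ & H & _). auto.
  - rewrite (iet_out f x Hf Hx). tauto.
Qed.

(** Density on the circle gives no control of the side. Aiming at [y + d] with tolerance at most [d]
    keeps the orbit point to the right of [y], and the tolerance is also small enough to exclude
    closeness through the point 0. *)
Lemma mc_dense_right f J x y e : is_iet f -> minimal_component f J -> J x -> J y -> 0 < e ->
  exists z, in_orbit f x z /\ J z /\ y < z < y + e.
Proof.
  intros Hf HJ Hx Hy He. pose proof (mc_in01 f J y HJ Hy) as Hy01.
  destruct (pcw_right _ y (mc_pset f J HJ) Hy01) as [e0 [He0 [He1 HeJ]]].
  set (d := Rmin e e0 / 2).
  assert (Hd : 0 < d /\ 2 * d <= e /\ 2 * d <= e0).
  { unfold d. assert (0 < Rmin e e0) by (apply Rmin_pos; lra).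
    pose proof (Rmin_l e e0). pose proof (Rmin_r e e0). lra. }
  unfold in01 in Hy01.
  assert (HJd : J (y + d)).
  { specialize (HeJ 0 d). rewrite Rplus_0_r in HeJ. apply HeJ; auto; lra. }
  set (eps := Rmin d (1 - (y + d))).
  assert (Heps : 0 < eps /\ eps <= d /\ eps <= 1 - (y + d)).
  { unfold eps. split; [apply Rmin_pos; lra|]. split; [apply Rmin_l|apply Rmin_r]. }
  pose proof HJ as (_ & _ & _ & Hdense).
  destruct (Hdense x (y + d) Hx HJd eps) as [z [Hz [HzJ Hc]]]; [lra|].
  exists z. split; auto. split; auto.
  pose proof (mc_in01 f J z HJ HzJ) as Hz01. unfold in01 in Hz01.
  unfold cdist in Hc.
  assert (Habs : Rabs (z - (y + d)) < eps).
  { unfold Rmin in Hc. destruct (Rle_dec _ _) in Hc; auto.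
    exfalso. unfold Rabs in Hc. destruct (Rcase_abs (z - (y + d))); lra. }
  apply Rabs_def2 in Habs. lra.
Qed.

(** A periodic orbit is finite and leaves a gap just to the right of [x], against one-sided
    density. *)
Lemma mc_aperiodic f J x : is_iet f -> minimal_component f J -> J x -> ~ Per f x.
Proof.
  intros Hf HJ Hx Hper. destruct (Per_min_period f x Hper) as [n (_ & Hn & Hp & _)].
  set (L := map (fun i => iter i f x) (seq 0 n)).
  assert (HL : forall i, In (iter i f x) L).
  { intro i. rewrite (iter_mod f n i x Hn Hp). apply (in_map (fun i => iter i f x)).
    apply in_seq. pose proof (Nat.mod_upper_bound i n). lia. }
  pose proof (mc_in01 f J x HJ Hx) as Hx01. unfold in01 in Hx01.
  destruct (next_exists L x) as [v [Hv [_ Hv2]]]; [lra|].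
  destruct (mc_dense_right f J x x (v - x) Hf HJ Hx Hx) as [z [[i Hz] [_ Hzv]]]; [lra|].
  apply (Hv2 z); [|lra]. destruct Hz as [<-|Hz]; auto.
  (* A backward iterate of a periodic point is a forward one: going back [i] steps equals going
     forward [i * n - i] steps. *)
  assert (E : z = iter (i * n - i) f x).
  { apply (iet_inj (iter i f)); [apply iet_iter; auto|]. rewrite <- iter_add, Hz.
    replace (i + (i * n - i))%nat with (i * n)%nat by nia. symmetry. apply iter_mult; auto. }
  rewrite E. auto.
Qed.

Definition right_transl (g : R -> R) (y : R) : Prop :=
  exists e, 0 < e /\ forall s, 0 < s < e -> g (y + s) = g y + s.

Lemma iet_right_transl g y : is_iet g -> in01 y -> right_transl g y.
Proof.
  intros Hg Hy. destruct (pcw_right _ y (iet_pt g Hg) Hy) as [e [He [_ H]]].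
  exists e. split; auto. intros s Hs. specialize (H 0 s). rewrite Rplus_0_r in H.
  assert (g (y + s) - g y = y + s - y) by (apply H; lra). lra.
Qed.

(* The maps agree along a dense orbit, and right germs spread the equality to all of [J]. *)
Lemma mc_agree f J g h x : is_iet f -> minimal_component f J ->
  (forall y, J y -> g (f y) = f (g y)) -> (forall y, J y -> h (f y) = f (h y)) ->
  (forall y, J y -> right_transl g y) -> (forall y, J y -> right_transl h y) ->
  J x -> g x = h x -> forall y, J y -> g y = h y.
Proof.
  intros Hf HJ Hg Hh Hgr Hhr Hx E y Hy.
  pose proof (mc_invariant f J Hf HJ) as Hinv.
  assert (HJn : forall n z, J z -> J (iter n f z)).
  { induction n as [|n IH]; intros z Hz; simpl; auto. apply (proj1 (Hinv _)); auto. }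
  assert (Hgn : forall n z, J z -> g (iter n f z) = iter n f (g z)).
  { induction n as [|n IH]; intros z Hz; simpl; auto. rewrite Hg by auto. rewrite IH; auto. }
  assert (Hhn : forall n z, J z -> h (iter n f z) = iter n f (h z)).
  { induction n as [|n IH]; intros z Hz; simpl; auto. rewrite Hh by auto. rewrite IH; auto. }
  destruct (Hgr y Hy) as [e1 [He1 H1]]. destruct (Hhr y Hy) as [e2 [He2 H2]].
  destruct (mc_dense_right f J x y (Rmin e1 e2) Hf HJ Hx Hy) as [z [[n Hz] [HzJ Hzy]]]; [apply Rmin_pos; auto|].
  pose proof (Rmin_l e1 e2). pose proof (Rmin_r e1 e2).
  assert (Ez : g z = h z).
  { destruct Hz as [Hz|Hz].
    - rewrite <- Hz, Hgn, Hhn, E; auto.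
    - apply (iet_inj (iter n f)); [apply iet_iter; auto|]. rewrite <- Hgn, <- Hhn, Hz; auto. }
  specialize (H1 (z - y)). specialize (H2 (z - y)).
  replace (y + (z - y)) with z in H1, H2 by ring.
  rewrite H1, H2 in Ez by lra. lra.
Qed.

Lemma mc_agree_iet f J g h x : is_iet f -> minimal_component f J -> is_iet g -> is_iet h ->
  commute_fun f g -> commute_fun f h -> J x -> g x = h x -> forall y, J y -> g y = h y.
Proof.
  intros Hf HJ Hg Hh Hcg Hch Hx E. apply (mc_agree f J g h x); auto.
  - intros y Hy. apply iet_right_transl; auto. eapply mc_in01; eauto.
  - intros y Hy. apply iet_right_transl; auto. eapply mc_in01; eauto.
Qed.

Lemma iter_invariant f (J : R -> Prop) n x : (forall x, J x <-> J (f x)) -> J x <-> J (iter n f x).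
Proof. intro H. induction n; simpl; [tauto|]. rewrite <- H. auto. Qed.

(** To the right of the common point [x], [K] contains a whole interval; the orbit of [y] meets it,
    and invariance carries membership back to [y]. *)
Lemma mc_sub f J K x : is_iet f -> minimal_component f J -> minimal_component f K ->
  J x -> K x -> forall y, J y -> K y.
Proof.
  intros Hf HJ HK Hx HKx y Hy.
  destruct (pcw_right _ x (mc_pset f K HK) (mc_in01 f K x HK HKx)) as [e [He [_ HeK]]].
  destruct (mc_dense_right f J y x e Hf HJ Hy Hx He) as [z [[n Hz] [_ Hzx]]].
  assert (HKz : K z).
  { specialize (HeK 0 (z - x)). rewrite Rplus_0_r in HeK. replace (x + (z - x)) with z in HeK by ring.
    apply HeK; auto; lra. }
  pose proof (mc_invariant f K Hf HK) as Hinv. destruct Hz as [Hz|Hz].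
  - apply (iter_invariant f K n y Hinv). rewrite Hz; auto.
  - rewrite <- Hz. apply (iter_invariant f K n z Hinv); auto.
Qed.

Lemma mc_eq f J K x : is_iet f -> minimal_component f J -> minimal_component f K -> J x -> K x -> J = K.
Proof.
  intros Hf HJ HK Hx HKx. extensionality y. apply propositional_extensionality.
  split; [apply (mc_sub f J K x)|apply (mc_sub f K J x)]; auto.
Qed.

Lemma mc_image f J h : is_iet f -> is_iet h -> commute_fun f h -> minimal_component f J ->
  minimal_component f (fun y => J (inv h y)).
Proof.
  intros Hf Hh Hc HJ. pose proof (iet_inv h Hh) as Hhi. pose proof (commute_inv f h Hh Hc) as Hci.
  split; [|split; [|split]].
  - apply pset_fui; [apply pset_preimage; auto; eapply mc_pset; eauto|].
    intros y Hy. apply (iet_in_iff (inv h)); auto. eapply mc_in01; eauto.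
  - destruct HJ as (_ & [x Hx] & _). exists (h x). rewrite inv_l; auto.
  - intros y _. rewrite <- Hci. apply mc_invariant; auto.
  - intros y w Hy Hw eps Heps.
    destruct (iet_right_transl h (inv h w) Hh (mc_in01 f J _ HJ Hw)) as [e [He H]].
    destruct (mc_dense_right f J (inv h y) (inv h w) (Rmin e eps) Hf HJ Hy Hw) as [z [[n Hz] [HzJ Hzw]]]; [apply Rmin_pos; auto|].
    pose proof (Rmin_l e eps). pose proof (Rmin_r e eps).
    exists (h z). split; [|split].
    + exists n. destruct Hz as [Hz|Hz]; [left|right].
      * rewrite <- Hz, (commute_iter h f n (commute_sym _ _ Hc)), inv_r; auto.
      * rewrite <- (commute_iter h f n (commute_sym _ _ Hc)), Hz, inv_r; auto.
    + rewrite inv_l; auto.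
    + unfold cdist. eapply Rle_lt_trans; [apply Rmin_l|].
      specialize (H (z - inv h w)). replace (inv h w + (z - inv h w)) with z in H by ring.
      rewrite H, inv_r by (auto; lra). apply Rabs_def1; lra.
Qed.

(** * Left limits and left germs *)

Definition left_limit (g : R -> R) (p v : R) : Prop :=
  exists e, 0 < e /\ forall s, 0 < s < e -> g (p - s) = v - s.

(* Meaningful only for [0 < p <= 1]: left germs live on [(0,1]]. *)
Definition lft (g : R -> R) (p : R) : R := epsilon (inhabits 0) (left_limit g p).

Lemma left_limit_unique g p v w : left_limit g p v -> left_limit g p w -> v = w.
Proof.
  intros [e1 [He1 H1]] [e2 [He2 H2]].
  set (s := Rmin e1 e2 / 2). assert (0 < Rmin e1 e2) by (apply Rmin_pos; auto).
  pose proof (Rmin_l e1 e2). pose proof (Rmin_r e1 e2).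
  specialize (H1 s). specialize (H2 s). unfold s in *. rewrite H1 in H2 by lra. lra.
Qed.

Lemma lft_spec g p : is_iet g -> 0 < p <= 1 -> left_limit g p (lft g p).
Proof.
  intros Hg Hp. unfold lft. apply epsilon_spec.
  destruct (pcw_left _ p (iet_pt g Hg) Hp) as [e [He [Hep H]]].
  exists (g (p - e) + e), e. split; auto. intros s Hs.
  specialize (H e s). assert (g (p - s) - g (p - e) = p - s - (p - e)) by (apply H; lra). lra.
Qed.

Lemma lft_eq g p v : left_limit g p v -> lft g p = v.
Proof.
  intro H. apply (left_limit_unique g p); auto. unfold lft. apply epsilon_spec. eauto.
Qed.

Lemma lft_range g p : is_iet g -> 0 < p <= 1 -> 0 < lft g p <= 1.
Proof.
  intros Hg Hp. destruct (lft_spec g p Hg Hp) as [e [He H]].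
  assert (H' : forall s, 0 < s < Rmin e p -> 0 <= lft g p - s < 1).
  { intros s Hs. pose proof (Rmin_l e p). pose proof (Rmin_r e p).
    rewrite <- H by lra. apply iet_in; auto. unfold in01; lra. }
  assert (Hm : 0 < Rmin e p) by (apply Rmin_pos; lra).
  pose proof (H' (Rmin e p / 2)). split; [lra|].
  destruct (Rle_dec (lft g p) 1) as [|Hn]; auto. exfalso.
  set (s := Rmin (Rmin e p / 2) ((lft g p - 1) / 2)).
  assert (0 < s) by (unfold s; apply Rmin_pos; lra).
  pose proof (Rmin_l (Rmin e p / 2) ((lft g p - 1) / 2)).
  pose proof (Rmin_r (Rmin e p / 2) ((lft g p - 1) / 2)). fold s in H2, H3.
  specialize (H' s). lra.
Qed.

Lemma left_limit_comp g h p v w : left_limit h p v -> left_limit g v w -> left_limit (fun x => g (h x)) p w.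
Proof.
  intros [e1 [He1 H1]] [e2 [He2 H2]]. exists (Rmin e1 e2). split; [apply Rmin_pos; auto|].
  pose proof (Rmin_l e1 e2). pose proof (Rmin_r e1 e2).
  intros s Hs. rewrite H1, H2; lra.
Qed.

Lemma lft_comp g h p : is_iet g -> is_iet h -> 0 < p <= 1 -> lft (fun x => g (h x)) p = lft g (lft h p).
Proof.
  intros Hg Hh Hp. apply lft_eq. apply (left_limit_comp g h p (lft h p)); apply lft_spec; auto.
  apply lft_range; auto.
Qed.

Lemma lft_id p : lft (fun x => x) p = p.
Proof. apply lft_eq. exists 1. split; [lra|auto]. Qed.

Lemma lft_iter f n p : is_iet f -> 0 < p <= 1 ->
  lft (iter n f) p = iter n (lft f) p /\ 0 < iter n (lft f) p <= 1.
Proof.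
  intros Hf Hp. induction n as [|n [IH1 IH2]]; simpl.
  - split; [apply lft_id|auto].
  - split; [|apply lft_range; auto]. rewrite <- IH1.
    apply (lft_comp f (iter n f)); auto. apply iet_iter; auto.
Qed.

Lemma lft_commute f h p : is_iet f -> is_iet h -> commute_fun f h -> 0 < p <= 1 ->
  lft f (lft h p) = lft h (lft f p).
Proof.
  intros Hf Hh Hc Hp. rewrite <- !lft_comp; auto. f_equal. apply functional_extensionality. auto.
Qed.

Lemma lft_inv_r g p : is_iet g -> 0 < p <= 1 -> lft g (lft (inv g) p) = p.
Proof.
  intros Hg Hp. rewrite <- lft_comp; auto; [|apply iet_inv; auto].
  rewrite <- (lft_id p) at 2. f_equal. apply functional_extensionality. intro. apply inv_r; auto.
Qed.

Lemma iter_lft_inv_r f n p : is_iet f -> 0 < p <= 1 -> iter n (lft f) (iter n (lft (inv f)) p) = p.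
Proof.
  intros Hf Hp. induction n as [|n IH]; simpl; auto.
  rewrite <- iter_comm, lft_inv_r; auto. apply lft_iter; auto. apply iet_inv; auto.
Qed.

Lemma iet_regular g : is_iet g -> exists D, forall p, 0 < p <= 1 -> ~ In p D -> lft g p = g p.
Proof.
  (* The point 1 carries a left germ but lies outside [0,1), where [g] is the identity, so it is
     listed as an exception. *)
  intro Hg. destruct (iet_left_closed g Hg) as [D HD]. exists (1 :: D). intros p Hp Hn.
  assert (Hp1 : p <> 1) by (intro; apply Hn; left; auto).
  destruct (HD p) as [e [He [_ H]]]; [lra|intro; apply Hn; right; auto|].
  apply lft_eq. exists e. split; auto. intros s Hs. apply H; lra.
Qed.

Definition left_in (J : R -> Prop) (l : R) : Prop :=
  exists e, 0 < e /\ forall s, 0 < s < e -> J (l - s).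

Lemma left_in_range (J : R -> Prop) l : (forall x, J x -> in01 x) -> left_in J l -> 0 < l <= 1.
Proof.
  intros HJ [e [He H]].
  pose proof (HJ _ (H (e / 2) ltac:(lra))) as H1. unfold in01 in H1. split; [lra|].
  destruct (Rle_dec l 1) as [|Hn]; auto. exfalso.
  set (s := Rmin (e / 2) ((l - 1) / 2)).
  assert (0 < s) by (unfold s; apply Rmin_pos; lra).
  pose proof (Rmin_l (e / 2) ((l - 1) / 2)). pose proof (Rmin_r (e / 2) ((l - 1) / 2)). fold s in H2, H3.
  pose proof (HJ _ (H s ltac:(lra))) as H4. unfold in01 in H4. lra.
Qed.

Lemma left_in_lft (J : R -> Prop) h l : (forall x, J x -> in01 x) -> is_iet h -> (forall x, J x <-> J (h x)) ->
  left_in J l -> left_in J (lft h l).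
Proof.
  intros HJ Hh Hinv Hl. pose proof (left_in_range J l HJ Hl) as Hr.
  destruct Hl as [e [He H]]. destruct (lft_spec h l Hh Hr) as [e' [He' H']].
  exists (Rmin e e'). split; [apply Rmin_pos; auto|].
  pose proof (Rmin_l e e'). pose proof (Rmin_r e e').
  intros s Hs. rewrite <- H' by lra. apply (proj1 (Hinv _)). apply H; lra.
Qed.

Lemma pset_left_in J : pset J -> exists D, forall p, 0 < p <= 1 -> ~ In p D -> (left_in J p <-> J p).
Proof.
  intro HJ. destruct (pset_no_break J HJ) as [D HD]. exists (1 :: D). intros p Hp Hn.
  assert (Hp1 : p <> 1) by (intro; apply Hn; left; auto).
  destruct (HD p) as [e [He [_ H]]]; [lra|intro; apply Hn; right; auto|].
  split.
  - intros [e' [He' H']]. assert (0 < Rmin e e') by (apply Rmin_pos; auto).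
    pose proof (Rmin_l e e'). pose proof (Rmin_r e e').
    apply (H (Rmin e e' / 2)); try lra. apply H'. lra.
  - intro Hp'. exists e. split; auto. intros s Hs. apply H; auto; lra.
Qed.

(** What the germ arguments use of a minimal component, without density. It passes to [inv f], so
    each lemma serves both directions of time. *)
Definition aperiodic_domain (f : R -> R) (J : R -> Prop) : Prop :=
  is_iet f /\ pset J /\ (forall x, J x -> in01 x) /\ (forall x, J x <-> J (f x)) /\
  (forall x, J x -> ~ Per f x).

Lemma mc_aperiodic_domain f J : is_iet f -> minimal_component f J -> aperiodic_domain f J.
Proof.
  intros Hf HJ. split; auto. split; [eapply mc_pset; eauto|]. split; [intros; eapply mc_in01; eauto|].
  split; [apply mc_invariant; auto|]. intros; eapply mc_aperiodic; eauto.
Qed.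

Lemma aperiodic_domain_inv f J : aperiodic_domain f J -> aperiodic_domain (inv f) J.
Proof.
  intros (Hf & H1 & H2 & H3 & H4). split; [apply iet_inv; auto|]. split; auto. split; auto.
  split; [apply inv_invariant; auto|]. intros x Hx. rewrite Per_inv; auto.
Qed.

Lemma left_in_iter f J l n : aperiodic_domain f J -> left_in J l -> left_in J (iter n (lft f) l).
Proof.
  intros (Hf & H1 & H2 & H3 & H4) Hl. induction n; simpl; auto. apply left_in_lft; auto.
Qed.

(** A repetition in the orbit of the germ would be a repetition in the orbit of the actual points
    [l - s] of [J], which are not periodic. *)
Lemma lft_wanders f J l : aperiodic_domain f J -> left_in J l -> wanders (lft f) l.
Proof.
  intros (Hf & H1 & H2 & H3 & H4) Hl a b E.
  pose proof (left_in_range J l H2 Hl) as Hr.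
  destruct (lft_iter f a l Hf Hr) as [Ea _]. destruct (lft_iter f b l Hf Hr) as [Eb _].
  rewrite <- Ea, <- Eb in E.
  destruct (lft_spec (iter a f) l (iet_iter a f Hf) Hr) as [ea [Hea Ha]].
  destruct (lft_spec (iter b f) l (iet_iter b f Hf) Hr) as [eb [Heb Hb]].
  destruct Hl as [e [He HJ]].
  set (s := Rmin e (Rmin ea eb) / 2).
  assert (Hs : 0 < s /\ s < e /\ s < ea /\ s < eb).
  { unfold s. assert (0 < Rmin e (Rmin ea eb)) by (repeat apply Rmin_pos; auto).
    pose proof (Rmin_l e (Rmin ea eb)). pose proof (Rmin_r e (Rmin ea eb)).
    pose proof (Rmin_l ea eb). pose proof (Rmin_r ea eb). lra. }
  assert (HJs : J (l - s)) by (apply HJ; lra).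
  apply (nonper_wanders f (l - s)); auto.
  rewrite Ha, Hb, E by lra. auto.
Qed.

(* [x] is the right germ whose forward orbit is eventually adjacent to that of the left germ [l]. *)
Definition glue (f : R -> R) (l x : R) : Prop :=
  exists N, forall n, (N <= n)%nat -> iter n (lft f) l = iter n f x.

(** After time [N] the germ has passed all discontinuities of [f] and all breaks of [J]. From there
    on it moves together with the point [y] at which it is based, and pulling [y] back [N] steps
    gives the partner of [l]. *)
Lemma glue_exists f J l : aperiodic_domain f J -> left_in J l -> exists x, J x /\ glue f l x.
Proof.
  intros HD Hl. pose proof HD as (Hf & H1 & H2 & H3 & H4).
  destruct (iet_regular f Hf) as [D1 HD1]. destruct (pset_left_in J H1) as [D2 HD2].
  destruct (seq_eventually_avoids (fun n => iter n (lft f) l) (D1 ++ D2)) as [N HN].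
  { apply (lft_wanders f J); auto. }
  pose proof (left_in_range J l H2 Hl) as Hr.
  set (y := iter N (lft f) l).
  assert (Hy : J y).
  { apply (HD2 y).
    - apply lft_iter; auto.
    - intro Hi. apply (HN N); auto. apply in_or_app; auto.
    - apply (left_in_iter f J); auto. }
  exists (iter N (inv f) y). split.
  - apply (iter_invariant (inv f) J); auto. apply inv_invariant; auto.
  - exists N. intros n Hn. replace n with (n - N + N)%nat by lia.
    generalize (n - N)%nat. intro k. rewrite !iter_add. rewrite iter_inv_r by auto. fold y.
    induction k as [|k IH]; simpl; auto. rewrite IH. rewrite <- IH at 1.
    rewrite <- IH. unfold y. rewrite <- iter_add. apply HD1; [apply lft_iter; auto|].
    intro Hi. apply (HN (k + N)%nat); [lia|]. apply in_or_app; auto.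
Qed.

Lemma glue_unique f l x y : is_iet f -> glue f l x -> glue f l y -> x = y.
Proof.
  intros Hf [N1 H1] [N2 H2]. apply (iet_inj (iter (N1 + N2) f)); [apply iet_iter; auto|].
  rewrite <- H1, <- H2; auto; lia.
Qed.

(** Far enough along the orbit the germ also avoids the discontinuities of [h], and there the left
    germ and the point are moved by [h] alike. *)
Lemma glue_equivariant f J h l x : aperiodic_domain f J -> is_iet h -> commute_fun f h ->
  left_in J l -> glue f l x -> glue f (lft h l) (h x).
Proof.
  intros HD Hh Hc Hl [N HN]. pose proof HD as (Hf & H1 & H2 & H3 & H4).
  pose proof (left_in_range J l H2 Hl) as Hr.
  destruct (iet_regular h Hh) as [D1 HD1].
  destruct (seq_eventually_avoids (fun n => iter n (lft f) l) D1) as [M HM].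
  { apply (lft_wanders f J); auto. }
  exists (N + M)%nat. intros n Hn.
  assert (E : iter n (lft f) (lft h l) = lft h (iter n (lft f) l)).
  { destruct (lft_iter f n (lft h l) Hf (lft_range h l Hh Hr)) as [E1 _].
    destruct (lft_iter f n l Hf Hr) as [E2 _]. rewrite <- E1, <- E2.
    apply lft_commute; auto; [apply iet_iter; auto|].
    apply commute_sym, commute_iter, commute_sym; auto. }
  rewrite E, HD1.
  - rewrite HN by lia. symmetry. apply (commute_sym _ _ (commute_iter h f n (commute_sym _ _ Hc))).
  - apply lft_iter; auto.
  - apply (HM n). lia.
Qed.

Lemma glue_regular f l D : is_iet f -> 0 < l <= 1 ->
  (forall p, 0 < p <= 1 -> ~ In p D -> lft f p = f p) ->
  (forall n, ~ In (iter n (lft f) l) D) -> glue f l l.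
Proof.
  intros Hf Hl HD Hav. exists O. intros n _. induction n as [|n IH]; simpl; auto.
  rewrite <- IH. apply HD; auto. apply lft_iter; auto.
Qed.

Lemma cent_on_inv f J h : (forall x, J x -> in01 x) -> gmem (Cent_on f J) h -> forall x, J x <-> J (h x).
Proof.
  intros HJ (Hh & Hc & Hs) x.
  destruct (classic (h x = x)) as [->|Hne]; [tauto|].
  assert (Hx : J x).
  { apply Hs; auto. apply NNPP. intro Hn. apply Hne. apply iet_out; auto. }
  split; auto. intros _. apply Hs.
  - apply iet_in; auto.
  - intro E. apply Hne. apply iet_inj in E; auto.
Qed.

Lemma cent_on_out f J h x : gmem (Cent_on f J) h -> ~ J x -> h x = x.
Proof.
  intros (Hh & Hc & Hs) Hx. apply NNPP. intro Hne. apply Hx. apply Hs; auto.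
  apply NNPP. intro Hn. apply Hne. apply iet_out; auto.
Qed.

Lemma iter_res_in (J : R -> Prop) f n x : (forall x, J x <-> J (f x)) -> J x -> iter n (res J f) x = iter n f x.
Proof.
  intros Hinv Hx. induction n; simpl; auto. rewrite IHn. apply res_in.
  apply (iter_invariant f J n x Hinv); auto.
Qed.

Lemma iter_res_out (J : R -> Prop) f n x : ~ J x -> iter n (res J f) x = x.
Proof. intro Hx. apply iter_fix. apply res_out; auto. Qed.

Lemma gpow_iter f J g n : gpow (Cent_on f J) g n = iter n g.
Proof. induction n; simpl; [reflexivity|]. rewrite IHn. reflexivity. Qed.

Lemma cent_on_res f J : is_iet f -> pset J -> (forall x, J x <-> J (f x)) -> gmem (Cent_on f J) (res J f).
Proof.
  intros Hf HJ Hinv. split; [apply iet_res; auto|]. split; [|apply res_supported].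
  apply commute_res; auto. intro; auto.
Qed.

Lemma cent_on_iter f J h n : gmem (Cent_on f J) h -> gmem (Cent_on f J) (iter n h).
Proof.
  intros Hm. pose proof Hm as (Hh & Hc & Hs). split; [apply iet_iter; auto|]. split; [apply commute_iter; auto|].
  intros x Hx Hne. apply NNPP. intro Hn. apply Hne. apply iter_fix. apply (cent_on_out f J); auto.
Qed.

Lemma cent_on_infinite f J : is_iet f -> minimal_component f J -> infinite_grp (Cent_on f J).
Proof.
  intros Hf HJ l. pose proof (mc_aperiodic_domain f J Hf HJ) as (_ & H1 & H2 & H3 & H4).
  pose proof HJ as (_ & [x Hx] & _).
  destruct (seq_eventually_avoids (fun n => iter n (res J f)) l) as [N HN].
  - intros i j E. apply (nonper_wanders f x); auto.
    rewrite <- !(iter_res_in J f _ x H3 Hx), E; auto.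
  - exists (iter N (res J f)). split; [|apply HN; auto].
    apply cent_on_iter. apply cent_on_res; auto.
Qed.

(** * Singular germs *)

Definition singular_germ (f : R -> R) (J : R -> Prop) (l : R) : Prop :=
  left_in J l /\ exists x x', glue f l x /\ glue (inv f) l x' /\ x <> x'.

(** Orbits are compared through forward iterates only, which dispenses with inverting the germ
    map. *)
Definition same_orbit (F : R -> R) (x y : R) : Prop := exists a b, iter a F x = iter b F y.

Lemma same_orbit_join F x y e : same_orbit F x e -> same_orbit F y e -> same_orbit F x y.
Proof.
  intros (a & b & E1) (c & d & E2). exists (d + a)%nat, (b + c)%nat.
  rewrite !iter_add, E1, E2. apply iter_iter_comm.
Qed.

(** A germ meeting no discontinuity ahead is glued to [l] itself in the future, and likewise in the
    past. For a singular germ at most one of these holds, so its orbit contains an entry of [D1] or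
    [D2]. *)
Lemma singular_germ_orbits f J : aperiodic_domain f J ->
  exists E, forall l, singular_germ f J l -> exists e, In e E /\ same_orbit (lft f) l e.
Proof.
  intros HD. pose proof HD as (Hf & H1 & H2 & H3 & H4). pose proof (iet_inv f Hf) as Hfi.
  destruct (iet_regular f Hf) as [D1 HD1]. destruct (iet_regular (inv f) Hfi) as [D2 HD2].
  exists (D1 ++ D2). intros l (Hl & x & x' & Hx & Hx' & Hne).
  pose proof (left_in_range J l H2 Hl) as Hr.
  destruct (classic (exists n, In (iter n (lft f) l) D1)) as [[n Hn]|Hno1].
  - exists (iter n (lft f) l). split; [apply in_or_app; auto|]. exists n, O. auto.
  - destruct (classic (exists n, In (iter n (lft (inv f)) l) D2)) as [[n Hn]|Hno2].
    + exists (iter n (lft (inv f)) l). split; [apply in_or_app; auto|]. exists O, n. simpl.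
      symmetry. apply iter_lft_inv_r; auto.
    + exfalso. apply Hne. rewrite (glue_unique f l x l), (glue_unique (inv f) l x' l); auto.
      * apply (glue_regular (inv f) l D2); auto. intros n Hn. eauto.
      * apply (glue_regular f l D1); auto. intros n Hn. eauto.
Qed.

(* The centraliser permutes the finitely many orbits of singular left germs, and
   the stabiliser of one of them consists of powers of [f]. *)
Lemma cent_on_virtually_cyclic f J l0 : is_iet f -> minimal_component f J -> singular_germ f J l0 ->
  virtually_cyclic (Cent_on f J).
Proof.
  intros Hf HJ Hl0. pose proof (mc_aperiodic_domain f J Hf HJ) as HD.
  pose proof HD as (_ & H1 & H2 & H3 & H4).
  pose proof (aperiodic_domain_inv f J HD) as HDi.
  destruct (singular_germ_orbits f J HD) as [E HE].
  pose proof (left_in_range J l0 H2 (proj1 Hl0)) as Hr0.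
  assert (Hperm : forall h, gmem (Cent_on f J) h -> singular_germ f J (lft h l0)).
  { intros h Hm. pose proof Hm as (Hh & Hc & Hs). destruct Hl0 as (Hl & x & x' & Hx & Hx' & Hne).
    split; [apply left_in_lft; auto; apply (cent_on_inv f J); auto|].
    exists (h x), (h x'). split; [|split].
    - apply (glue_equivariant f J); auto.
    - apply (glue_equivariant (inv f) J); auto. apply commute_sym, commute_inv, commute_sym; auto.
    - intro E'. apply Hne. apply (iet_inj h); auto. }
  (* Equality of the two germs at [l0] is equality of the maps at an actual point [l0 - s] of [J],
     and one such point suffices for all of [J]. *)
  assert (Hstab : forall h a, gmem (Cent_on f J) h -> gmem (Cent_on f J) a ->
     same_orbit (lft f) (lft h l0) (lft a l0) ->
     exists p q, forall y, J y -> iter p f (h y) = iter q f (a y)).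
  { intros h a Hm Hma (p & q & Epq). pose proof Hm as (Hh & Hc & Hs). pose proof Hma as (Ha & Hca & Hsa).
    exists p, q.
    destruct (lft_iter f p (lft h l0) Hf (lft_range h l0 Hh Hr0)) as [Ep _].
    destruct (lft_iter f q (lft a l0) Hf (lft_range a l0 Ha Hr0)) as [Eq _].
    rewrite <- Ep, <- Eq, <- (lft_comp (iter p f) h), <- (lft_comp (iter q f) a) in Epq by (auto; apply iet_iter; auto).
    assert (Hi1 : is_iet (fun x => iter p f (h x))) by (apply iet_comp; auto; apply iet_iter; auto).
    assert (Hi2 : is_iet (fun x => iter q f (a x))) by (apply iet_comp; auto; apply iet_iter; auto).
    destruct (lft_spec _ l0 Hi1 Hr0) as [e1 [He1 Hl1]]. destruct (lft_spec _ l0 Hi2 Hr0) as [e2 [He2 Hl2]].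
    destruct Hl0 as ([e [He HeJ]] & _).
    set (s := Rmin e (Rmin e1 e2) / 2).
    assert (Hs' : 0 < s /\ s < e /\ s < e1 /\ s < e2).
    { unfold s. assert (0 < Rmin e (Rmin e1 e2)) by (repeat apply Rmin_pos; auto).
      pose proof (Rmin_l e (Rmin e1 e2)). pose proof (Rmin_r e (Rmin e1 e2)).
      pose proof (Rmin_l e1 e2). pose proof (Rmin_r e1 e2). lra. }
    apply (mc_agree_iet f J (fun x => iter p f (h x)) (fun x => iter q f (a x)) (l0 - s)); auto.
    - apply (commute_comp f (iter p f) h); auto. apply commute_iter. intro; auto.
    - apply (commute_comp f (iter q f) a); auto. apply commute_iter. intro; auto.
    - apply HeJ; lra.
    - cbv beta in Hl1, Hl2. rewrite Hl1, Hl2, Epq by lra. auto. }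
  (* Coset representatives: for each orbit in the list, one centralising map that takes [l0] into
     it, if there is any. *)
  assert (Hreps : exists l, (forall a, In a l -> gmem (Cent_on f J) a) /\
     forall e h, In e E -> gmem (Cent_on f J) h -> same_orbit (lft f) (lft h l0) e ->
       exists a, In a l /\ same_orbit (lft f) (lft a l0) e).
  { clear HE. induction E as [|e E [l [Hl Hl']]].
    - exists nil. split; [intros a []|]. intros e h [].
    - destruct (classic (exists h, gmem (Cent_on f J) h /\ same_orbit (lft f) (lft h l0) e)) as [[h [Hh He]]|Hno].
      + exists (h :: l). split; [intros a [<-|Ha]; auto|].
        intros e' h' [<-|He'] Hh' Hs'; [exists h; split; [left|]; auto|].
        destruct (Hl' e' h' He' Hh' Hs') as [a [Ha Hs'']]. exists a. split; [right|]; auto.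
      + exists l. split; auto. intros e' h' [<-|He'] Hh' Hs'; [exfalso; eauto|]. eauto. }
  destruct Hreps as [l [Hl Hl']].
  exists (res J f). split; [apply cent_on_res; auto|]. exists l. split; auto.
  intros h Hm. destruct (HE _ (Hperm h Hm)) as [e [He Hse]].
  destruct (Hl' e h He Hm Hse) as [a [Ha Hsa]].
  destruct (Hstab h a Hm (Hl a Ha) (same_orbit_join _ _ _ _ Hse Hsa)) as (p & q & Hpq).
  pose proof Hm as (Hh & Hc & Hs). pose proof (Hl a Ha) as Hma. pose proof Hma as (Hia & Hca & Hsupa).
  (* [h] is [a] times the power [q - p] of [f]. A negative power is expressed by moving it to the
     side of [h], the second clause of [virtually_cyclic]. *)
  destruct (le_lt_dec p q) as [Hle|Hlt].
  - exists a, (q - p)%nat. split; auto. left. rewrite gpow_iter. extensionality y. simpl.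
    destruct (classic (J y)) as [Hy|Hy].
    + rewrite iter_res_in by auto. rewrite (commute_iter a f (q - p) (commute_sym _ _ Hca)).
      apply (iet_inj (iter p f)); [apply iet_iter; auto|]. rewrite Hpq, <- iter_add by auto. f_equal. lia.
    + rewrite iter_res_out by auto. rewrite !(cent_on_out f J); auto.
  - exists a, (p - q)%nat. split; auto. right. rewrite gpow_iter. extensionality y. simpl.
    destruct (classic (J y)) as [Hy|Hy].
    + rewrite iter_res_in by auto. rewrite (commute_iter h f (p - q) (commute_sym _ _ Hc)).
      apply (iet_inj (iter q f)); [apply iet_iter; auto|]. rewrite <- Hpq, <- iter_add by auto. f_equal. lia.
    + rewrite iter_res_out by auto. rewrite !(cent_on_out f J); auto.
Qed.

(** * The flow on the reglued component *)

Lemma nat_floor (t d : R) : 0 <= t -> 0 < d -> exists n : nat, INR n * d <= t < (INR n + 1) * d.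
Proof.
  intros Ht Hd. destruct (base_Int_part (t / d)) as [H1 H2].
  assert (Hq : 0 <= t / d) by (apply Rmult_le_pos; [lra|left; apply Rinv_0_lt_compat; auto]).
  assert (Hz : (0 <= Int_part (t / d))%Z).
  { assert (-1 < Int_part (t / d))%Z by (apply lt_IZR; simpl; lra). lia. }
  exists (Z.to_nat (Int_part (t / d))). rewrite INR_IZR_INZ, Z2Nat.id by auto.
  assert (E : t = t / d * d) by (field; lra).
  split.
  - rewrite E at 2. apply Rmult_le_compat_r; lra.
  - rewrite E at 1. apply Rmult_lt_compat_r; lra.
Qed.

Section Walk.

Variables (f : R -> R) (J : R -> Prop).
Hypothesis Hf : is_iet f.
Hypothesis HJ : minimal_component f J.

Let HJ01 : forall x, J x -> in01 x := fun x => mc_in01 f J x HJ.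
Let HJinv : forall x, J x <-> J (f x) := mc_invariant f J Hf HJ.

(** [lam] tells where travel to the right continues after the left germ [l]; [nx x] is the next
    point of [Q]. All jumps and all breaks of [J] are in [Q], and [lam] maps germs at [Q] back into
    [Q], so the length of every stage after the first is bounded below. *)
Variables (lam nx : R -> R) (Q : list R).
Hypothesis lam_J : forall l, left_in J l -> J (lam l).
Hypothesis lam_f : forall l, left_in J l -> lam (lft f l) = f (lam l).
Hypothesis lam_id : forall l, left_in J l -> ~ In l Q -> lam l = l.
Hypothesis lam_Q : forall l, left_in J l -> In l Q -> In (lam l) Q.
Hypothesis Q_J : forall x y, in01 x -> in01 y -> x < y -> avoids Q x y -> (J x <-> J y).
Hypothesis nx_spec : forall x, x < 1 -> x < nx x <= 1 /\ In (nx x) Q /\ forall d, In d Q -> ~ (x < d < nx x).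

Let J_lt1 x : J x -> 0 <= x < 1.
Proof. intro H. exact (HJ01 x H). Qed.

Lemma nx_gt x : J x -> x < nx x <= 1.
Proof. intro H. apply nx_spec. apply J_lt1 in H. lra. Qed.

Lemma nx_left_gen x e : J x -> x < e <= nx x -> left_in J e.
Proof.
  intros Hx He. pose proof (J_lt1 x Hx). pose proof (nx_spec x ltac:(lra)) as (H1 & _ & H2).
  exists (e - x). split; [lra|]. intros s Hs.
  apply (Q_J x (e - s)); unfold in01; try lra; auto.
  intros d Hd Hi. apply (H2 d Hd). lra.
Qed.

Lemma nx_left x : J x -> left_in J (nx x).
Proof. intro Hx. apply (nx_left_gen x); auto. pose proof (nx_gt x Hx). lra. Qed.

Lemma nx_stay x s : J x -> 0 <= s -> x + s < nx x -> J (x + s) /\ nx (x + s) = nx x.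
Proof.
  intros Hx Hs Hlt. pose proof (J_lt1 x Hx). pose proof (nx_spec x ltac:(lra)) as (H1 & H2 & H3).
  split.
  - destruct (Req_dec s 0) as [->|Hne]; [rewrite Rplus_0_r; auto|].
    apply (Q_J x (x + s)); unfold in01; try lra; auto.
    intros d Hd Hi. apply (H3 d Hd). lra.
  - pose proof (nx_spec (x + s) ltac:(lra)) as (H4 & H5 & H6).
    destruct (Rtotal_order (nx (x + s)) (nx x)) as [Hl|[Hl|Hl]]; auto; exfalso.
    + apply (H3 _ H5). lra.
    + apply (H6 _ H2). lra.
Qed.

(** A relation, because the number of crossings is not bounded by any structural argument; existence
    is proved afterwards from the lower bound on gaps. *)
Inductive walk : R -> R -> R -> Prop :=
| walk_stay x t : J x -> 0 <= t -> x + t < nx x -> walk x t (x + t)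
| walk_cross x t y : J x -> nx x - x <= t -> walk (lam (nx x)) (t - (nx x - x)) y -> walk x t y.

Lemma walk_J x t y : walk x t y -> J x /\ J y /\ 0 <= t.
Proof.
  induction 1 as [x t Hx Ht Hlt|x t y Hx Ht Hw [IH1 [IH2 IH3]]].
  - split; auto. split; auto. apply nx_stay; auto.
  - split; auto. split; auto. pose proof (nx_gt x Hx). lra.
Qed.

Lemma walk_det x t y z : walk x t y -> walk x t z -> y = z.
Proof.
  intro H. revert z. induction H as [x t Hx Ht Hlt|x t y Hx Ht Hw IH]; intros z Hz.
  - inversion Hz; subst; auto. lra.
  - inversion Hz; subst; auto. lra.
Qed.

Lemma walk_add x s y t z : walk x s y -> walk y t z -> walk x (s + t) z.
Proof.
  intro H. revert t z. induction H as [x s Hx Hs Hlt|x s y Hx Hs Hw IH]; intros t z Hz.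
  - destruct (nx_stay x s Hx Hs Hlt) as [H1 H2].
    inversion Hz; subst.
    + rewrite H2 in *. rewrite Rplus_assoc. apply walk_stay; auto; lra.
    + rewrite H2 in *. apply walk_cross; auto; [lra|].
      replace (s + t - (nx x - x)) with (t - (nx x - (x + s))) by ring. auto.
  - apply walk_cross; auto.
    + apply walk_J in Hz. lra.
    + replace (s + t - (nx x - x)) with (s - (nx x - x) + t) by ring. auto.
Qed.

Lemma walk_zero x : J x -> walk x 0 x.
Proof.
  intro Hx. rewrite <- (Rplus_0_r x) at 2. apply walk_stay; auto; try lra. pose proof (nx_gt x Hx). lra.
Qed.

Lemma walk_end x : J x -> walk x (nx x - x) (lam (nx x)).
Proof.
  intro Hx. apply walk_cross; auto; [lra|].
  replace (nx x - x - (nx x - x)) with 0 by ring. apply walk_zero. apply lam_J, nx_left; auto.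
Qed.

Lemma lam_nx_Q x : J x -> In (lam (nx x)) Q.
Proof. intro Hx. apply lam_Q; [apply nx_left; auto|]. apply nx_spec. apply J_lt1 in Hx. lra. Qed.

Lemma list_gap (n : R -> R) (l : list R) : (forall x, x < 1 -> x < n x) ->
  exists e, 0 < e /\ forall q, In q l -> q < 1 -> e <= n q - q.
Proof.
  intro H. induction l as [|q l [e [He IH]]].
  - exists 1. split; [lra|]. intros q [].
  - destruct (Rlt_dec q 1) as [Hq|Hq].
    + exists (Rmin e (n q - q)). specialize (H q Hq). split; [apply Rmin_pos; lra|].
      intros q' [<-|Hq'] Hlt; [apply Rmin_r|]. eapply Rle_trans; [apply Rmin_l|auto].
    + exists e. split; auto. intros q' [<-|Hq'] Hlt; [lra|auto].
Qed.

Lemma walk_gap : exists e, 0 < e /\ forall q, In q Q -> q < 1 -> e <= nx q - q.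
Proof. apply list_gap. intros x Hx. apply nx_spec; auto. Qed.

(** After the first crossing the walk sits in [Q], and each further crossing takes at least the
    minimal gap [e], so about [t / e] of them suffice. *)
Lemma walk_total x t : J x -> 0 <= t -> exists y, walk x t y.
Proof.
  intros Hx Ht. destruct walk_gap as [e [He Hgap]].
  assert (HQ : forall n t x, J x -> In x Q -> 0 <= t -> t < INR n * e -> exists y, walk x t y).
  { induction n as [|n IH]; intros t' x' Hx' Hq Ht' Hlt; [simpl in Hlt; lra|].
    destruct (Rlt_dec (x' + t') (nx x')) as [Hs|Hs]; [eexists; apply walk_stay; eauto|].
    pose proof (Hgap x' Hq ltac:(apply J_lt1 in Hx'; lra)).
    destruct (IH (t' - (nx x' - x')) (lam (nx x'))) as [y Hy].
    - apply lam_J, nx_left; auto.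
    - apply lam_nx_Q; auto.
    - lra.
    - rewrite S_INR in Hlt. lra.
    - exists y. apply walk_cross; auto; lra. }
  destruct (Rlt_dec (x + t) (nx x)) as [Hs|Hs]; [eexists; apply walk_stay; eauto|].
  destruct (nat_floor (t - (nx x - x)) e) as [n Hn]; [lra|auto|].
  destruct (HQ (S n) (t - (nx x - x)) (lam (nx x))) as [y Hy].
  - apply lam_J, nx_left; auto.
  - apply lam_nx_Q; auto.
  - lra.
  - rewrite S_INR. lra.
  - exists y. apply walk_cross; auto; lra.
Qed.

Definition flow (t x : R) : R := ifp (J x) (epsilon (inhabits 0) (walk x t)) x.

Lemma flow_walk t x : J x -> 0 <= t -> walk x t (flow t x).
Proof. intros Hx Ht. unfold flow. rewrite ifp_true by auto. apply epsilon_spec. apply walk_total; auto. Qed.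

Lemma flow_eq t x y : walk x t y -> flow t x = y.
Proof. intro H. pose proof (walk_J x t y H) as (H1 & H2 & H3). apply (walk_det x t); auto. apply flow_walk; auto. Qed.

Lemma flow_out t x : ~ J x -> flow t x = x.
Proof. apply ifp_false. Qed.

Lemma flow_J t x : J x -> 0 <= t -> J (flow t x).
Proof. intros Hx Ht. eapply walk_J. apply flow_walk; auto. Qed.

Lemma flow_add s t x : J x -> 0 <= s -> 0 <= t -> flow (s + t) x = flow t (flow s x).
Proof.
  intros Hx Hs Ht. apply flow_eq. apply walk_add with (flow s x); apply flow_walk; auto. apply flow_J; auto.
Qed.

Lemma flow_zero x : flow 0 x = x.
Proof. destruct (classic (J x)); [apply flow_eq, walk_zero; auto|apply flow_out; auto]. Qed.

Lemma flow_small s x : J x -> 0 <= s -> x + s < nx x -> flow s x = x + s.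
Proof. intros. apply flow_eq, walk_stay; auto. Qed.

(** Small times are translations, and times commute: moving [y] by [s] and then by [t] is moving by
    [t] and then by [s]. *)
Lemma flow_right_transl t y : J y -> 0 <= t -> right_transl (flow t) y.
Proof.
  intros Hy Ht. set (z := flow t y). pose proof (flow_J t y Hy Ht) as Hz. fold z in Hz.
  pose proof (nx_gt y Hy). pose proof (nx_gt z Hz).
  exists (Rmin (nx y - y) (nx z - z)). split; [apply Rmin_pos; lra|]. intros s Hs.
  pose proof (Rmin_l (nx y - y) (nx z - z)). pose proof (Rmin_r (nx y - y) (nx z - z)).
  fold z. rewrite <- (flow_small s y) by (auto; lra). rewrite <- flow_add by (auto; lra).
  rewrite Rplus_comm, flow_add by (auto; lra). apply flow_small; auto; lra.
Qed.

(** The trips from [x] and from [f x] are followed in parallel, in stages short enough that neither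
    jumps before the end of a stage. At the end, equivariance of [lam] matches the two jumps. *)
Lemma flow_commutes t x : J x -> 0 <= t -> f (flow t x) = flow t (f x).
Proof.
  destruct (pcw_hereditary _ (iet_pt f Hf)) as [Df HDf].
  destruct (preimage_list in01 f Q) as [P HP]; [intros a b _ _; apply iet_inj; auto|].
  (* Stages end at jumps of the trip from [x], at breaks of [f], and at preimages of jumps of the
     trip from [f x]. *)
  set (S := Q ++ Df ++ P).
  assert (Hns : exists ns : R -> R, forall x, x < 1 -> x < ns x <= 1 /\ (ns x = 1 \/ In (ns x) S) /\ forall d, In d S -> ~ (x < d < ns x)).
  { apply (fun_choice (fun x v => x < 1 -> x < v <= 1 /\ (v = 1 \/ In v S) /\ forall d, In d S -> ~ (x < d < v))).
    intro z. destruct (Rlt_dec z 1) as [Hz|Hz].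
    - destruct (next_exists S z Hz) as [v Hv]. exists v. auto.
    - exists 0. intro; lra. }
  destruct Hns as [ns Hns].
  assert (HQS : forall d, In d Q -> In d S) by (intros; unfold S; apply in_or_app; auto).
  assert (Hstep : forall x, J x ->
     (forall s, 0 <= s -> x + s < ns x -> f (flow s x) = flow s (f x)) /\
     exists y, J y /\ In y S /\ walk x (ns x - x) y /\ walk (f x) (ns x - x) (f y)).
  { clear x t. intros x Hx. pose proof (J_lt1 x Hx) as Hx1. pose proof (Hns x ltac:(lra)) as (N1 & N2 & N3).
    pose proof (nx_spec x ltac:(lra)) as (M1 & M2 & M3).
    assert (Hle : ns x <= nx x).
    { destruct (Rle_dec (ns x) (nx x)); auto. exfalso. apply (N3 (nx x)); auto. lra. }
    assert (Hfx : J (f x)) by (apply (proj1 (HJinv x)); auto).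
    assert (Htr : forall s, 0 <= s -> x + s < ns x -> f (x + s) = f x + s).
    { intros s Hs Hlt. destruct (Req_dec s 0) as [->|Hne]; [rewrite !Rplus_0_r; auto|].
      assert (f (x + s) - f x = x + s - x); [|lra].
      apply (HDf x (x + s)); unfold in01; try lra.
      intros d Hd Hi. apply (N3 d); [unfold S; apply in_or_app; right; apply in_or_app; auto|lra]. }
    assert (HnoQ : forall q, In q Q -> ~ (f x < q < f x + (ns x - x))).
    { intros q Hq Hi. apply (N3 (x + (q - f x))); [|lra].
      unfold S. apply in_or_app; right; apply in_or_app; right. apply HP; [unfold in01; lra|].
      rewrite Htr by lra. replace (f x + (q - f x)) with q by ring. auto. }
    pose proof (J_lt1 _ Hfx) as Hfx1. pose proof (nx_spec (f x) ltac:(lra)) as (K1 & K2 & K3).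
    assert (Hle' : f x + (ns x - x) <= nx (f x)).
    { destruct (Rle_dec (f x + (ns x - x)) (nx (f x))); auto. exfalso. apply (HnoQ _ K2). lra. }
    split.
    - intros s Hs Hlt. rewrite (flow_small s x), (flow_small s (f x)) by (auto; lra). auto.
    - set (e := ns x) in *. assert (Hle_e : left_in J e) by (apply (nx_left_gen x); auto; lra).
      (* A stage may end before the next point of [Q]; then [lam] is the identity at [e'], so both
         cases have the same form. *)
      assert (Hgen : forall z e', J z -> z < e' <= nx z -> left_in J e' -> walk z (e' - z) (lam e')).
      { intros z e' Hz He' Hl. destruct (Req_dec e' (nx z)) as [->|Hne]; [apply walk_end; auto|].
        rewrite lam_id; auto.
        - replace e' with (z + (e' - z)) at 2 by ring. apply walk_stay; auto; lra.
        - intro Hin. apply J_lt1 in Hz. pose proof (nx_spec z ltac:(lra)) as (_ & _ & H3). apply (H3 e' Hin). lra. }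
      assert (Hlf : lft f e = f x + (e - x)).
      { apply lft_eq. exists (e - x). split; [lra|]. intros s Hs.
        replace (e - s) with (x + (e - s - x)) by ring. rewrite Htr by lra. ring. }
      exists (lam e). split; [apply lam_J; auto|]. split; [|split].
      + destruct (classic (In e Q)) as [HeQ|HeQ]; [apply HQS, lam_Q; auto|].
        rewrite lam_id by auto. destruct N2 as [N2|N2]; auto. exfalso. apply HeQ.
        assert (E1 : nx x = e) by lra. rewrite <- E1. auto.
      + apply Hgen; auto. lra.
      + rewrite <- lam_f by auto. rewrite Hlf.
        replace (e - x) with (f x + (e - x) - f x) at 1 by ring. apply Hgen; auto; [lra|].
        rewrite <- Hlf. apply left_in_lft; auto. }
  destruct (list_gap ns S) as [g [Hg Hgap]]; [intros z Hz; apply Hns; auto|].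
  assert (HS : forall n t x, J x -> In x S -> 0 <= t -> t < INR n * g -> f (flow t x) = flow t (f x)).
  { induction n as [|n IH]; intros t' x' Hx' Hq Ht' Hlt; [simpl in Hlt; lra|].
    destruct (Hstep x' Hx') as [H1 (y & Hy & HyS & Hw1 & Hw2)].
    destruct (Rlt_dec (x' + t') (ns x')) as [Hs|Hs]; [apply H1; auto|].
    pose proof (J_lt1 x' Hx'). pose proof (Hgap x' Hq ltac:(lra)). pose proof (Hns x' ltac:(lra)).
    replace t' with ((ns x' - x') + (t' - (ns x' - x'))) by ring.
    rewrite !flow_add; auto; try lra; [|apply (proj1 (HJinv x')); auto].
    rewrite (flow_eq _ _ _ Hw1), (flow_eq _ _ _ Hw2). apply IH; auto; [lra|].
    rewrite S_INR in Hlt. lra. }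
  intros Hx Ht.
  destruct (Hstep x Hx) as [H1 (y & Hy & HyS & Hw1 & Hw2)].
  destruct (Rlt_dec (x + t) (ns x)) as [Hs|Hs]; [apply H1; auto|].
  pose proof (J_lt1 x Hx). pose proof (Hns x ltac:(lra)).
  replace t with ((ns x - x) + (t - (ns x - x))) by ring.
  rewrite !flow_add; auto; try lra; [|apply (proj1 (HJinv x)); auto].
  rewrite (flow_eq _ _ _ Hw1), (flow_eq _ _ _ Hw2).
  destruct (nat_floor (t - (ns x - x)) g) as [n Hn]; [lra|auto|].
  apply (HS (Datatypes.S n)); auto; [lra|]. rewrite S_INR. lra.
Qed.

Lemma flow_agree t x y : J x -> 0 <= t -> flow t x = x -> J y -> flow t y = y.
Proof.
  intros Hx Ht E. revert y. apply (mc_agree f J (flow t) (fun x => x) x); auto.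
  - intros y Hy. symmetry. apply flow_commutes; auto.
  - intros y Hy. apply flow_right_transl; auto.
  - intros y Hy. exists 1. split; [lra|auto].
Qed.

(** The successive landing points after jumps lie in the finite set [Q], so two of them coincide;
    the time between is a period there, hence everywhere by [flow_agree]. *)
Lemma flow_period : exists P, 0 < P /\ forall y, J y -> flow P y = y.
Proof.
  pose proof HJ as (_ & [x Hx] & _).
  set (nxt := fun q => lam (nx q)). set (q := fun i => iter (S i) nxt x).
  assert (HqJ : forall i, J (iter i nxt x)).
  { induction i; simpl; auto. apply lam_J, nx_left; auto. }
  assert (HqQ : forall i, In (q i) Q) by (intro i; apply lam_nx_Q; auto).
  assert (Hw : forall i k, exists T, walk (q i) T (q (i + k)%nat) /\ ((1 <= k)%nat -> 0 < T)).
  { intros i k. induction k as [|k [T [HT HT']]].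
    - exists 0. rewrite Nat.add_0_r. split; [apply walk_zero; apply HqJ|lia].
    - rewrite Nat.add_succ_r. exists (T + (nx (q (i + k)%nat) - q (i + k)%nat)).
      pose proof (HqJ (S (i + k))) as HqJ'. fold (q (i + k)%nat) in HqJ'.
      pose proof (nx_gt _ HqJ'). split.
      + eapply walk_add; [apply HT|]. apply walk_end; auto.
      + intros _. apply walk_J in HT. lra. }
  destruct (classic (forall i j, q i = q j -> i = j)) as [Hinj|Hno].
  - destruct (seq_eventually_avoids q Q Hinj) as [N HN]. exfalso. apply (HN N); auto.
  - assert (Hij : exists i k, (1 <= k)%nat /\ q i = q (i + k)%nat).
    { apply NNPP. intro Hn. apply Hno. intros i j E.
      destruct (Nat.lt_trichotomy i j) as [H|[H|H]]; auto; exfalso; apply Hn.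
      - exists i, (j - i)%nat. split; [lia|]. rewrite E. f_equal. lia.
      - exists j, (i - j)%nat. split; [lia|]. rewrite <- E. f_equal. lia. }
    destruct Hij as (i & k & Hk & E). destruct (Hw i k) as [T [HT HT']]. rewrite <- E in HT.
    exists T. split; auto. intros y Hy. apply (flow_agree T (q i)); auto.
    + apply HqJ.
    + specialize (HT' Hk). lra.
    + apply flow_eq; auto.
Qed.

(** Differences of periods at [x0] are periods, and every period is at least [d]. Each time cell of
    length [d] therefore contains at most one period, and the first occupied cell holds the
    least. *)
Lemma flow_least_period x0 : J x0 -> exists L, 0 < L /\ (forall y, J y -> flow L y = y) /\
  forall t, 0 < t < L -> flow t x0 <> x0.
Proof.
  intro Hx0. set (d := nx x0 - x0). pose proof (nx_gt x0 Hx0).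
  assert (Hd : 0 < d) by (unfold d; lra).
  set (per := fun t => 0 < t /\ flow t x0 = x0).
  assert (Hsmall : forall t, per t -> d <= t).
  { intros t [Ht E]. destruct (Rle_dec d t); auto. exfalso. unfold d in *.
    rewrite flow_small in E by (auto; lra). lra. }
  assert (Hdiff : forall s t, per s -> per t -> s < t -> per (t - s)).
  { intros s t [Hs Es] [Ht Et] Hst. split; [lra|].
    rewrite <- Et at 2. replace t with (s + (t - s)) at 2 by ring. rewrite flow_add, Es by (auto; lra). auto. }
  destruct flow_period as [P [HP HP']].
  destruct (least_nat (fun k => exists t, per t /\ INR k * d <= t < (INR k + 1) * d)) as (k & (L & HL & HLk) & Hmin).
  { destruct (nat_floor P d) as [k Hk]; [lra|auto|]. exists k, P. split; auto. split; auto. }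
  exists L. split; [apply HL|]. split.
  - intros y Hy. apply (flow_agree L x0); auto; try apply HL. destruct HL; lra.
  - intros t Ht E. assert (Hpt : per t) by (split; [lra|auto]).
    destruct (nat_floor t d) as [k' Hk']; [lra|auto|].
    assert (Hkk : (k <= k')%nat).
    { destruct (le_lt_dec k k') as [|Hlt]; auto. exfalso. apply (Hmin k' Hlt). eauto. }
    assert (INR k <= INR k') by (apply le_INR; auto).
    assert (INR k * d <= INR k' * d) by (apply Rmult_le_compat_r; lra).
    pose proof (Hsmall _ (Hdiff t L Hpt HL ltac:(lra))). lra.
Qed.

(** For times below the minimal gap at most one jump occurs; the cuts are the points of [Q] and
    their translates by [- s], where the jump begins to take place. *)
Lemma flow_pt : exists e, 0 < e /\ forall s, 0 <= s < e -> pt (flow s).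
Proof.
  destruct walk_gap as [e [He Hgap]]. exists e. split; auto. intros s Hs.
  exists (Q ++ map (fun q => q - s) Q). intros x y Hx Hy Hxy Ha. apply avoids_app in Ha. destruct Ha as [Ha1 Ha2].
  pose proof (Q_J x y Hx Hy Hxy Ha1) as HJxy.
  destruct (classic (J x)) as [HJx|HJx].
  - assert (HJy : J y) by tauto. pose proof (J_lt1 x HJx). pose proof (J_lt1 y HJy).
    pose proof (nx_spec x ltac:(lra)) as (M1 & M2 & M3).
    assert (Hyn : y < nx x). { destruct (Rlt_dec y (nx x)); auto. exfalso. apply (Ha1 _ M2). lra. }
    assert (Hny : nx y = nx x).
    { replace y with (x + (y - x)) by ring. apply nx_stay; auto; lra. }
    assert (Hmid : ~ (x + s < nx x <= y + s)).
    { intro Hi. apply (Ha2 (nx x - s)); [apply (in_map (fun q => q - s)); auto|lra]. }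
    assert (Hcr : forall z, J z -> nx z = nx x -> z < nx x -> nx x <= z + s -> flow s z = lam (nx x) + (s - (nx x - z))).
    { intros z Hz Ez Hz1 Hz2. apply flow_eq. apply walk_cross; auto; [lra|]. rewrite Ez.
      assert (HJl : J (lam (nx x))) by (apply lam_J, nx_left; auto).
      apply walk_stay; auto; [lra|].
      pose proof (Hgap (lam (nx x)) (lam_nx_Q x HJx) ltac:(apply J_lt1 in HJl; lra)). lra. }
    destruct (Rlt_dec (x + s) (nx x)) as [Hlt|Hge].
    + rewrite !flow_small; auto; try lra.
    + rewrite !Hcr; auto; lra.
  - rewrite !flow_out; tauto.
Qed.

End Walk.

(** * The circle action *)

(* [F t] moves points by [t] along the reglued circles; [L] is their common length and
   [Q] a finite set met by every flow line. *)
Definition is_flow (f : R -> R) (J : R -> Prop) (F : R -> R -> R) (L x0 : R) (Q : list R) : Prop :=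
  J x0 /\ 0 < L /\
  (forall t x, ~ J x -> F t x = x) /\
  (forall t x, J x -> 0 <= t -> J (F t x)) /\
  (forall s t x, J x -> 0 <= s -> 0 <= t -> F (s + t) x = F t (F s x)) /\
  (forall x, F 0 x = x) /\
  (forall x, J x -> exists e, 0 < e /\ forall s, 0 <= s < e -> F s x = x + s) /\
  (forall t x, J x -> 0 <= t -> right_transl (F t) x) /\
  (forall t x, J x -> 0 <= t -> f (F t x) = F t (f x)) /\
  (forall y, J y -> F L y = y) /\
  (forall t, 0 < t < L -> F t x0 <> x0) /\
  (exists e, 0 < e /\ forall s, 0 <= s < e -> pt (F s)) /\
  (forall x, J x -> exists t, 0 <= t /\ In (F t x) Q).

Lemma flow_exists f J : is_iet f -> minimal_component f J -> (forall l, ~ singular_germ f J l) ->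
  exists F L x0 Q, is_flow f J F L x0 Q.
Proof.
  intros Hf HJ Hns. pose proof (mc_aperiodic_domain f J Hf HJ) as HD.
  pose proof HD as (_ & H1 & H2 & H3 & H4).
  pose proof (aperiodic_domain_inv f J HD) as HDi. pose proof (iet_inv f Hf) as Hfi.
  assert (Hlam : exists lam : R -> R, forall l, left_in J l -> J (lam l) /\ glue f l (lam l)).
  { apply (fun_choice (fun l x => left_in J l -> J x /\ glue f l x)). intro l.
    destruct (classic (left_in J l)) as [Hl|Hl].
    - destruct (glue_exists f J l HD Hl) as [x Hx]. exists x. auto.
    - exists 0. tauto. }
  destruct Hlam as [lam Hlam].
  assert (Hglue : forall l x', left_in J l -> glue (inv f) l x' -> lam l = x').
  { intros l x' Hl Hx'. apply NNPP. intro Hne. apply (Hns l). split; auto.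
    exists (lam l), x'. repeat split; auto. apply Hlam; auto. }
  destruct (iet_regular f Hf) as [D1 HD1]. destruct (iet_regular (inv f) Hfi) as [D2 HD2].
  (* A germ moved by [lam] needs a discontinuity of [f] ahead and one of [inv f] behind: if one side
     is free, gluing on that side gives [l] itself, and both gluings agree. *)
  destruct (wandering_segments_finite (lft f) D1 D2) as [Q0 HQ0].
  assert (Hid : forall l, left_in J l -> ~ In l Q0 -> lam l = l).
  { intros l Hl Hn. pose proof (left_in_range J l H2 Hl) as Hr.
    destruct (classic (exists n, In (iter n (lft f) l) D1)) as [Hex|Hno].
    - apply Hglue; auto. apply (glue_regular (inv f) l D2); auto. intros n Hin. apply Hn.
      apply HQ0; auto; [apply (lft_wanders f J); auto|].
      exists n, (iter n (lft (inv f)) l). split; auto. apply iter_lft_inv_r; auto.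
    - apply (glue_unique f l); auto; [apply Hlam; auto|].
      apply (glue_regular f l D1); auto. intros n Hin. eauto. }
  destruct H1 as [DJ HDJ].
  (* The entry 1 guarantees a next point. One application of [lam] closes the list up, because [lam]
     is the identity on germs outside [Q1]. *)
  set (Q1 := 1 :: Q0 ++ DJ). set (Q := Q1 ++ map lam Q1).
  assert (Hnx : exists nx : R -> R, forall x, x < 1 -> x < nx x <= 1 /\ In (nx x) Q /\ forall d, In d Q -> ~ (x < d < nx x)).
  { apply (fun_choice (fun x v => x < 1 -> x < v <= 1 /\ In v Q /\ forall d, In d Q -> ~ (x < d < v))).
    intro x. destruct (Rlt_dec x 1) as [Hx|Hx].
    - destruct (next_exists Q x Hx) as [v [Hv1 [Hv2 Hv3]]]. exists v. intros _. repeat split; auto; try lra.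
      destruct Hv2 as [->|]; auto. unfold Q, Q1. left. auto.
    - exists 0. intro; lra. }
  destruct Hnx as [nx Hnx].
  assert (lam_J : forall l, left_in J l -> J (lam l)) by (intros; apply Hlam; auto).
  assert (lam_f : forall l, left_in J l -> lam (lft f l) = f (lam l)).
  { intros l Hl. apply (glue_unique f (lft f l)); auto.
    - apply Hlam. apply left_in_lft; auto.
    - apply (glue_equivariant f J); auto; [intro; auto|]. apply Hlam; auto. }
  assert (lam_id : forall l, left_in J l -> ~ In l Q -> lam l = l).
  { intros l Hl Hn. apply Hid; auto. intro Hin. apply Hn. unfold Q, Q1. apply in_or_app. left. right.
    apply in_or_app. auto. }
  assert (lam_Q : forall l, left_in J l -> In l Q -> In (lam l) Q).
  { intros l Hl Hin. destruct (classic (In l Q1)) as [Hi|Hi].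
    - unfold Q. apply in_or_app. right. apply in_map. auto.
    - rewrite Hid; auto. intro Hin'. apply Hi. unfold Q1. right. apply in_or_app; auto. }
  assert (Q_J : forall x y, in01 x -> in01 y -> x < y -> avoids Q x y -> (J x <-> J y)).
  { intros x y Hx Hy Hxy Ha. apply HDJ; auto. apply (avoids_incl DJ Q); auto.
    intros d Hd. unfold Q, Q1. apply in_or_app. left. right. apply in_or_app; auto. }
  pose proof HJ as (_ & [x0 Hx0] & _).
  destruct (flow_least_period f J Hf HJ lam nx Q lam_J lam_f lam_id lam_Q Q_J Hnx x0 Hx0) as (L & HL1 & HL2 & HL3).
  exists (flow J lam nx), L, x0, Q.
  split; auto. split; auto. split; [intros; apply flow_out; auto|].
  split; [intros; eapply flow_J; eauto|]. split; [intros; eapply flow_add; eauto|].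
  split; [intros; eapply flow_zero; eauto|].
  split.
  { intros x Hx. pose proof (nx_gt f J HJ nx Q Hnx x Hx). exists (nx x - x). split; [lra|].
    intros s Hs. eapply flow_small; eauto; lra. }
  split; [intros; eapply flow_right_transl; eauto|]. split; [intros; eapply flow_commutes; eauto|].
  split; auto. split; auto. split; [eapply flow_pt; eauto|].
  intros x Hx. pose proof (nx_gt f J HJ nx Q Hnx x Hx). exists (nx x - x). split; [lra|].
  rewrite (flow_eq f J HJ lam nx Q lam_J lam_Q Q_J Hnx _ _ (lam (nx x))).
  - eapply lam_nx_Q; eauto.
  - eapply walk_end; eauto.
Qed.

(* The circles are parametrised by [R/Z] through [psi], starting at [x0, f x0, ..., f^(m-1) x0]. *)
Definition circle_action (f : R -> R) (J : R -> Prop) (psi : R -> R -> R) (x0 : R) (m : nat) : Prop :=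
  J x0 /\ (1 <= m)%nat /\
  (forall t x, J x -> J (psi t x)) /\
  (forall s t x, J x -> psi (s + t) x = psi s (psi t x)) /\
  (forall z x, psi (IZR z) x = x) /\
  (forall t x, J x -> psi t x = x -> exists z, t = IZR z) /\
  (forall t, gmem (Cent_on f J) (psi t)) /\
  (forall h, gmem (Cent_on f J) h -> forall t x, J x -> h (psi t x) = psi t (h x)) /\
  (forall y, J y -> exists i t, (i < m)%nat /\ y = psi t (iter i f x0)) /\
  (forall i j t t', (i < m)%nat -> (j < m)%nat ->
     psi t (iter i f x0) = psi t' (iter j f x0) -> i = j).

Lemma frac1_add s t : frac1 s + frac1 t = frac1 (s + t) \/ frac1 s + frac1 t = frac1 (s + t) + 1.
Proof.
  pose proof (frac1_in01 s) as Hs. pose proof (frac1_in01 t) as Ht. unfold in01 in *.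
  destruct (frac1_int s) as [a Ha]. destruct (frac1_int t) as [b Hb].
  destruct (Rlt_dec (frac1 s + frac1 t) 1) as [Hlt|Hge].
  - left. symmetry. apply (frac1_unique _ _ (a + b)); [unfold in01; lra|]. rewrite plus_IZR. lra.
  - right. rewrite (frac1_unique (s + t) (frac1 s + frac1 t - 1) (a + b + 1)); [lra|unfold in01; lra|].
    rewrite !plus_IZR. lra.
Qed.

Lemma frac1_IZR z : frac1 (IZR z) = 0.
Proof. apply (frac1_unique _ 0 z); [unfold in01; lra|lra]. Qed.

Lemma right_transl_comp g h y : right_transl h y -> right_transl g (h y) -> right_transl (fun x => g (h x)) y.
Proof.
  intros [e1 [He1 H1]] [e2 [He2 H2]]. exists (Rmin e1 e2). split; [apply Rmin_pos; auto|].
  pose proof (Rmin_l e1 e2). pose proof (Rmin_r e1 e2). intros s Hs. rewrite H1, H2; auto; lra.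
Qed.

Lemma subdivide t e : 0 <= t -> 0 < e -> exists (n : nat) u, 0 <= u < e /\ t = INR n * u.
Proof.
  intros Ht He. destruct (nat_floor t e Ht He) as [n Hn]. exists (S n), (t / INR (S n)).
  assert (0 < INR (S n)) by (apply lt_0_INR; lia). split; [split|].
  - apply Rmult_le_pos; auto. left. apply Rinv_0_lt_compat; auto.
  - apply (Rmult_lt_reg_r (INR (S n))); auto. replace (t / INR (S n) * INR (S n)) with t by (field; lra).
    rewrite S_INR. lra.
  - field. lra.
Qed.

Section Circle.

Variables (f : R -> R) (J : R -> Prop) (F : R -> R -> R) (L x0 : R) (Q : list R).
Hypothesis Hf : is_iet f.
Hypothesis HJ : minimal_component f J.
Hypothesis HF : is_flow f J F L x0 Q.

Lemma flow_nat_mul n u x : J x -> 0 <= u -> F (INR n * u) x = iter n (F u) x.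
Proof.
  destruct HF as (Hx0 & HL & Hout & HJF & Hadd & H0 & Hsm & Hrt & Hcf & HLp & HLm & Hpt & HQ).
  intros Hx Hu. induction n as [|n IH]; [simpl; rewrite Rmult_0_l; auto|].
  rewrite S_INR, Rmult_plus_distr_r, Rmult_1_l, Hadd; auto.
  - rewrite IH. auto.
  - apply Rmult_le_pos; auto. apply pos_INR.
Qed.

Lemma flow_iter_J n u x : J x -> 0 <= u -> J (iter n (F u) x).
Proof.
  destruct HF as (Hx0 & HL & Hout & HJF & _). intros Hx Hu. induction n; simpl; auto.
Qed.

(** For times below [e], [F u], [h], and [F u] near [h x0] are plain translations, so the two
    composites agree at [x0]; both commute with [f], hence they agree on [J]. Longer times are
    iterates of short ones. *)
Lemma flow_centralizes h t x : gmem (Cent_on f J) h -> J x -> 0 <= t -> h (F t x) = F t (h x).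
Proof.
  pose proof HF as (Hx0 & HL & Hout & HJF & Hadd & H0 & Hsm & Hrt & Hcf & HLp & HLm & Hpt & HQ).
  intros Hm Hx Ht. pose proof Hm as (Hh & Hc & Hs).
  assert (HhJ : forall x, J x <-> J (h x)) by (apply (cent_on_inv f J); auto; intros; eapply mc_in01; eauto).
  assert (Hinv : forall x, J x <-> J (f x)) by (apply mc_invariant; auto).
  assert (Hhx0 : J (h x0)) by (apply (proj1 (HhJ x0)); auto).
  destruct (Hsm x0 Hx0) as [e1 [He1 E1]]. destruct (Hsm (h x0) Hhx0) as [e2 [He2 E2]].
  destruct (iet_right_transl h x0 Hh (mc_in01 f J x0 HJ Hx0)) as [e3 [He3 E3]].
  set (e := Rmin e1 (Rmin e2 e3)).
  assert (He : 0 < e /\ e <= e1 /\ e <= e2 /\ e <= e3).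
  { unfold e. split; [repeat apply Rmin_pos; auto|].
    pose proof (Rmin_l e1 (Rmin e2 e3)). pose proof (Rmin_r e1 (Rmin e2 e3)).
    pose proof (Rmin_l e2 e3). pose proof (Rmin_r e2 e3). lra. }
  assert (Hu : forall u y, 0 <= u < e -> J y -> h (F u y) = F u (h y)).
  { intros u y Hu. revert y. apply (mc_agree f J (fun y => h (F u y)) (fun y => F u (h y)) x0); auto.
    - intros y Hy. rewrite <- Hcf by (auto; lra). rewrite Hc. auto.
    - intros y Hy. rewrite <- Hc. rewrite Hcf; auto; [apply (proj1 (HhJ y)); auto|lra].
    - intros y Hy. apply right_transl_comp; [apply Hrt; auto; lra|].
      apply iet_right_transl; auto. apply (mc_in01 f J); auto. apply HJF; auto; lra.
    - intros y Hy. apply right_transl_comp; [apply iet_right_transl; auto; apply (mc_in01 f J); auto|].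
      apply Hrt; [apply (proj1 (HhJ y)); auto|lra].
    - rewrite E1, E2 by lra. destruct (Req_dec u 0) as [->|Hne]; [rewrite !Rplus_0_r; auto|]. apply E3. lra. }
  destruct (subdivide t e Ht ltac:(lra)) as (n & u & Hu' & ->).
  rewrite !flow_nat_mul; auto; try lra; [|apply (proj1 (HhJ x)); auto].
  clear Ht. induction n as [|n IH]; simpl; auto.
  rewrite Hu, IH; auto. apply flow_iter_J; auto; lra.
Qed.

(** Time is rescaled so that the common period becomes 1, and [frac1] extends it to negative
    times. *)
Definition circ (t x : R) : R := F (L * frac1 t) x.

Lemma circ_pos t : 0 <= L * frac1 t.
Proof.
  destruct HF as (Hx0 & HL & _). apply Rmult_le_pos; [lra|]. apply frac1_in01.
Qed.

Lemma circ_J t x : J x -> J (circ t x).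
Proof.
  pose proof HF as (Hx0 & HL & Hout & HJF & _).
  intro Hx. apply HJF; auto. apply circ_pos.
Qed.

Lemma circ_add s t x : J x -> circ (s + t) x = circ s (circ t x).
Proof.
  pose proof HF as (Hx0 & HL & Hout & HJF & Hadd & H0 & Hsm & Hrt & Hcf & HLp & HLm & Hpt & HQ).
  intro Hx. unfold circ. pose proof (circ_pos s). pose proof (circ_pos t). pose proof (circ_pos (s + t)).
  rewrite <- Hadd; auto. rewrite <- Rmult_plus_distr_l.
  destruct (frac1_add t s) as [E|E]; rewrite E, (Rplus_comm t s); auto.
  rewrite Rmult_plus_distr_l, Rmult_1_r, Hadd; auto; try lra. rewrite HLp; auto.
Qed.

Lemma circ_IZR z x : circ (IZR z) x = x.
Proof.
  pose proof HF as (Hx0 & HL & Hout & HJF & Hadd & H0 & _).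
  unfold circ. rewrite frac1_IZR, Rmult_0_r. auto.
Qed.

Lemma circ_zero x : circ 0 x = x.
Proof. apply (circ_IZR 0). Qed.

Lemma circ_out t x : ~ J x -> circ t x = x.
Proof. destruct HF as (_ & _ & Hout & _). intro. apply Hout; auto. Qed.

(** A time fixing one point of [J] fixes [x0] as well, and there [L] is the least positive
    period. *)
Lemma circ_free t x : J x -> circ t x = x -> exists z, t = IZR z.
Proof.
  pose proof HF as (Hx0 & HL & Hout & HJF & Hadd & H0 & Hsm & Hrt & Hcf & HLp & HLm & Hpt & HQ).
  intros Hx E. destruct (frac1_int t) as [z Hz]. exists z.
  assert (E0 : circ t x0 = x0).
  { pose proof (circ_pos t) as Hp. revert E. generalize x0 Hx0. clear x0 Hx0 HF HLm.
    intros x0 Hx0 E. apply (mc_agree f J (circ t) (fun x => x) x); auto.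
    - intros y Hy. unfold circ. rewrite Hcf; auto.
    - intros y Hy. unfold circ. apply Hrt; auto.
    - intros y Hy. exists 1. split; [lra|auto]. }
  pose proof (frac1_in01 t) as Ht. unfold in01 in Ht.
  destruct (Req_dec (frac1 t) 0) as [Hz0|Hnz]; [lra|]. exfalso.
  apply (HLm (L * frac1 t)); auto. split; [apply Rmult_lt_0_compat; lra|].
  rewrite <- (Rmult_1_r L) at 2. apply Rmult_lt_compat_l; lra.
Qed.

Lemma circ_nat_mul n u x : circ (INR n * u) x = iter n (circ u) x.
Proof.
  destruct (classic (J x)) as [Hx|Hx].
  - induction n as [|n IH]; [simpl; rewrite Rmult_0_l; apply circ_zero|].
    rewrite S_INR, Rmult_plus_distr_r, Rmult_1_l, Rplus_comm, circ_add, IH; auto.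
  - rewrite circ_out by auto. symmetry. apply iter_fix. apply circ_out; auto.
Qed.

Lemma circ_iet t : is_iet (circ t).
Proof.
  pose proof HF as (Hx0 & HL & Hout & HJF & Hadd & H0 & Hsm & Hrt & Hcf & HLp & HLm & [e [He Hpt]] & HQ).
  (* Only short times are known to be piecewise translations. The bound [e / L] makes [L * u] short,
     and the bound 1 gives [frac1 u = u]. *)
  destruct (subdivide (frac1 t) (Rmin 1 (e / L))) as (n & u & Hu & E).
  - apply frac1_in01.
  - apply Rmin_pos; [lra|]. apply Rdiv_lt_0_compat; auto.
  - pose proof (Rmin_l 1 (e / L)). pose proof (Rmin_r 1 (e / L)).
    assert (Hu01 : in01 u) by (unfold in01; lra).
    assert (Hiu : is_iet (circ u)).
    { apply (iet_of_inverse _ (circ (- u))).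
      - intros x Hx. apply circ_out. intro Hn. apply Hx. apply (mc_in01 f J); auto.
      - intro x. destruct (classic (J x)) as [Hx|Hx]; [|rewrite !circ_out; auto; rewrite circ_out; auto].
        rewrite <- circ_add, Rplus_opp_l by auto. apply circ_zero.
      - intro x. destruct (classic (J x)) as [Hx|Hx]; [|rewrite !circ_out; auto; rewrite circ_out; auto].
        rewrite <- circ_add, Rplus_opp_r by auto. apply circ_zero.
      - unfold circ. rewrite frac1_id by auto. apply Hpt. split; [apply Rmult_le_pos; lra|].
        assert (Hue : u < e / L) by lra. apply (Rmult_lt_compat_l L) in Hue; auto.
        replace (L * (e / L)) with e in Hue by (field; lra). auto. }
    assert (Et : circ t = iter n (circ u)).
    { extensionality x. rewrite <- circ_nat_mul, <- E.
      unfold circ. rewrite (frac1_id (frac1 t)); auto. apply frac1_in01. }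
    rewrite Et. apply iet_iter; auto.
Qed.

Lemma circ_cent t : gmem (Cent_on f J) (circ t).
Proof.
  pose proof HF as (Hx0 & HL & Hout & HJF & Hadd & H0 & Hsm & Hrt & Hcf & _).
  assert (Hinv : forall x, J x <-> J (f x)) by (apply mc_invariant; auto).
  split; [apply circ_iet|]. split.
  - intro x. destruct (classic (J x)) as [Hx|Hx].
    + unfold circ. rewrite Hcf; auto. apply circ_pos.
    + rewrite !circ_out; auto. rewrite <- Hinv. auto.
  - intros x _ Hne. apply NNPP. intro Hn. apply Hne. apply circ_out; auto.
Qed.

Lemma circ_commutes h t x : gmem (Cent_on f J) h -> J x -> h (circ t x) = circ t (h x).
Proof. intros Hm Hx. apply flow_centralizes; auto. apply circ_pos. Qed.

Lemma circ_commutes_iter n t x : J x -> iter n f (circ t x) = circ t (iter n f x).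
Proof.
  intro Hx. destruct (circ_cent t) as (_ & Hc & _).
  symmetry. apply (commute_iter (circ t) f n). apply commute_sym; auto.
Qed.

Lemma circ_orbit_rep x t y : J x -> y = circ t x -> x = circ (- t) y.
Proof. intros Hx ->. rewrite <- circ_add, Rplus_opp_l, circ_zero; auto. Qed.

Lemma flow_circ t x : J x -> 0 <= t -> exists s, F t x = circ s x.
Proof.
  pose proof HF as (Hx0 & HL & Hout & HJF & Hadd & H0 & Hsm & Hrt & Hcf & HLp & _).
  intros Hx Ht. destruct (nat_floor t L Ht HL) as [n Hn].
  assert (E : F t x = F (t - INR n * L) x).
  { assert (HnL : 0 <= INR n * L) by (apply Rmult_le_pos; [apply pos_INR|lra]).
    replace t with (INR n * L + (t - INR n * L)) at 1 by ring. rewrite Hadd by (auto; lra).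
    f_equal. rewrite flow_nat_mul by (auto; lra). apply iter_fix. auto. }
  exists ((t - INR n * L) / L). rewrite E. unfold circ. rewrite frac1_id.
  - f_equal. field. lra.
  - unfold in01. split.
    + apply Rmult_le_pos; [lra|]. left. apply Rinv_0_lt_compat; auto.
    + apply (Rmult_lt_reg_r L); auto. replace ((t - INR n * L) / L * L) with (t - INR n * L) by (field; lra). lra.
Qed.

(** [f] permutes the circles cyclically, and [m] is the first return time of the circle through
    [x0]; on all of [J], [f^m] is then a rotation by one time [t1]. *)
Lemma circle_action_exists : exists m, circle_action f J circ x0 m.
Proof.
  pose proof HF as (Hx0 & HL & Hout & HJF & Hadd & H0 & Hsm & Hrt & Hcf & HLp & HLm & Hpt & HQ).
  assert (Hinv : forall x, J x <-> J (f x)) by (apply mc_invariant; auto).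
  assert (HJn : forall n, J (iter n f x0)) by (intro n; apply (iter_invariant f J n x0 Hinv); auto).
  assert (Hm : exists n, (1 <= n)%nat /\ exists t, iter n f x0 = circ t x0).
  (* Every iterate of [x0] flows into the finite set [Q], so two iterates lie on one circle;
     cancelling the smaller power brings the coincidence back to [x0]. *)
  { assert (Hc : exists c : nat -> R, forall i, In (c i) Q /\ exists s, c i = circ s (iter i f x0)).
    { apply (fun_choice (fun i c => In c Q /\ exists s, c = circ s (iter i f x0))). intro i.
      destruct (HQ _ (HJn i)) as [t [Ht Hin]]. exists (F t (iter i f x0)). split; auto.
      apply flow_circ; auto. }
    destruct Hc as [c Hc].
    assert (Hij : exists i k, (1 <= k)%nat /\ c i = c (k + i)%nat).
    { apply NNPP. intro Hn. destruct (seq_eventually_avoids c Q) as [N HN].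
      - intros i j E. destruct (Nat.lt_trichotomy i j) as [H|[H|H]]; auto; exfalso; apply Hn.
        + exists i, (j - i)%nat. split; [lia|]. rewrite E. f_equal. lia.
        + exists j, (i - j)%nat. split; [lia|]. rewrite <- E. f_equal. lia.
      - apply (HN N); auto. apply Hc. }
    destruct Hij as (i & k & Hk & E). exists k. split; auto.
    destruct (Hc i) as [_ [s Hs]]. destruct (Hc (k + i)%nat) as [_ [s' Hs']].
    exists (- s' + s). apply (iet_inj (iter i f)); [apply iet_iter; auto|].
    rewrite circ_commutes_iter, circ_add, <- Hs, E by auto.
    rewrite <- iter_add, Nat.add_comm. apply circ_orbit_rep; auto. }
  apply least_nat in Hm. destruct Hm as (m & (Hm1 & t1 & Ht1) & Hmin).
  exists m.
  assert (Hfm : forall y, J y -> iter m f y = circ t1 y).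
  { apply (mc_agree_iet f J (iter m f) (circ t1) x0); auto.
    - apply iet_iter; auto.
    - apply circ_iet.
    - apply commute_iter. intro; auto.
    - apply circ_cent. }
  assert (HJy : forall n y, J y -> J (iter n f y)) by (intros n y Hy; apply (iter_invariant f J n y Hinv); auto).
  assert (Hfam : forall a y, J y -> iter (a * m) f y = circ (INR a * t1) y).
  { intros a y Hy. rewrite circ_nat_mul. induction a as [|a IH]; auto.
    change (S a * m)%nat with (m + a * m)%nat. rewrite iter_add, Hfm by auto. simpl. rewrite IH. auto. }
  assert (Hcov0 : forall n, exists i t, (i < m)%nat /\ iter n f x0 = circ t (iter i f x0)).
  { intro n. exists (n mod m), (INR (n / m) * t1). split; [apply Nat.mod_upper_bound; lia|].
    rewrite (Nat.div_mod n m) at 1 by lia. rewrite iter_add, Nat.mul_comm, Hfam; auto. }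
  split; auto. split; auto. split; [intros; apply circ_J; auto|]. split; [intros; apply circ_add; auto|].
  split; [intros; apply circ_IZR|]. split; [intros; eapply circ_free; eauto|].
  split; [apply circ_cent|]. split; [intros; apply circ_commutes; auto|]. split.
  (* Points just right of [x0] lie on its circle, and by density the orbit of [y] reaches them. *)
  - intros y Hy. destruct (Hsm x0 Hx0) as [e [He E]].
    destruct (mc_dense_right f J y x0 e Hf HJ Hy Hx0 He) as (z & [n Hz] & HzJ & Hzx).
    assert (Ez : exists s, z = circ s x0).
    { destruct (flow_circ (z - x0) x0 Hx0) as [s Hs]; [lra|]. exists s. rewrite <- Hs, E by lra. ring. }
    destruct Ez as [s Hs]. destruct Hz as [Hz|Hz].
    (* Here [y] is [n] steps before [z]. As [f^(n * m)] only rotates, going back [n] steps is going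
       forward [n * m - n] steps up to rotation. *)
    + destruct (Hcov0 (n * m - n)%nat) as (i & t & Hi & Et). exists i, (- (INR n * t1) + (s + t)). split; auto.
      rewrite circ_add, circ_add, <- Et by auto. apply circ_orbit_rep; auto.
      rewrite <- Hfam by auto. rewrite <- circ_commutes_iter, <- Hs, <- Hz, <- iter_add by auto.
      f_equal. nia.
    + destruct (Hcov0 n) as (i & t & Hi & Et). exists i, (s + t). split; auto.
      rewrite circ_add, <- Et, <- circ_commutes_iter, <- Hs by auto. auto.
  - assert (Hlt : forall i j t t', (i < j)%nat -> (j < m)%nat -> circ t (iter i f x0) = circ t' (iter j f x0) -> False).
    { intros i j t t' Hij Hj E. apply (Hmin (j - i)%nat); [lia|]. split; [lia|].
      exists (- t' + t). apply (iet_inj (iter i f)); [apply iet_iter; auto|].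
      rewrite circ_commutes_iter, circ_add, E, <- iter_add by auto.
      replace (i + (j - i))%nat with j by lia. apply circ_orbit_rep; auto. }
    intros i j t t' Hi Hj E. destruct (Nat.lt_trichotomy i j) as [H|[H|H]]; auto; exfalso; eauto.
Qed.

End Circle.

(** * Embedding into the torus extension *)

Lemma first_pre_some s j k i : first_pre s j k = Some i -> (i < k)%nat /\ s i = j.
Proof.
  induction k as [|k IH]; simpl; [discriminate|].
  destruct (first_pre s j k) as [i'|] eqn:E.
  - intro H. injection H as <-. destruct (IH eq_refl). split; [lia|auto].
  - destruct (Nat.eqb_spec (s k) j); [|discriminate]. intro H. injection H as <-. split; auto.
Qed.

Lemma first_pre_none s j k : first_pre s j k = None -> forall i, (i < k)%nat -> s i <> j.
Proof.
  induction k as [|k IH]; simpl; intros H i Hi; [lia|].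
  destruct (first_pre s j k) as [i'|] eqn:E; [discriminate|].
  destruct (Nat.eqb_spec (s k) j); [discriminate|].
  destruct (Nat.eq_dec i k) as [->|]; auto. apply IH; auto. lia.
Qed.

Lemma sym_surj n s j : gmem (Sym n) s -> (j < n)%nat -> exists i, (i < n)%nat /\ s i = j.
Proof.
  intros (H1 & H2 & H3) Hj.
  assert (Hb : bSurjective n s).
  { apply (bInjective_bSurjective H1). intros x y Hx Hy. apply H2; auto. }
  destruct (Hb j Hj) as [i [Hi E]]. eauto.
Qed.

Lemma perm_inv_r n s j : gmem (Sym n) s -> (j < n)%nat -> (perm_inv n s j < n)%nat /\ s (perm_inv n s j) = j.
Proof.
  intros Hs Hj. unfold perm_inv. destruct (first_pre s j n) as [i|] eqn:E.
  - apply (first_pre_some s j n); auto.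
  - exfalso. destruct (sym_surj n s j Hs Hj) as [i [Hi Ei]]. apply (first_pre_none s j n E i); auto.
Qed.

Lemma perm_inv_l n s i : gmem (Sym n) s -> (i < n)%nat -> perm_inv n s (s i) = i.
Proof.
  intros Hs Hi. pose proof Hs as (H1 & H2 & H3).
  destruct (perm_inv_r n s (s i) Hs (H1 i Hi)) as [H4 H5]. apply H2; auto.
Qed.

Lemma perm_inv_out n s j : gmem (Sym n) s -> (n <= j)%nat -> perm_inv n s j = j.
Proof.
  intros (H1 & H2 & H3) Hj. unfold perm_inv. destruct (first_pre s j n) as [i|] eqn:E; auto.
  apply first_pre_some in E. destruct E as [Hi Ei]. specialize (H1 i Hi). lia.
Qed.

Lemma cent_on_id f X : gmem (Cent_on f X) (fun x => x).
Proof. split; [apply iet_id|]. split; [intro; auto|]. intros x _ H. tauto. Qed.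

Lemma cent_on_comp f X g h : gmem (Cent_on f X) g -> gmem (Cent_on f X) h ->
  gmem (Cent_on f X) (fun x => g (h x)).
Proof.
  intros Hg Hh. pose proof Hg as (G1 & G2 & G3). pose proof Hh as (K1 & K2 & K3).
  split; [apply iet_comp; auto|]. split; [apply commute_comp; auto|].
  intros x Hx Hne. apply NNPP. intro Hn. apply Hne.
  rewrite (cent_on_out f X h x), (cent_on_out f X g x); auto.
Qed.

Lemma cent_on_inverse f X g : gmem (Cent_on f X) g -> gmem (Cent_on f X) (inv g).
Proof.
  intros Hg. pose proof Hg as (G1 & G2 & G3). split; [apply iet_inv; auto|].
  split; [apply commute_inv; auto|]. intros x Hx Hne. apply NNPP. intro Hn. apply Hne.
  apply inv_eq; auto. apply (cent_on_out f X); auto.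
Qed.

Section Torus.

Variables (f : R -> R) (J : R -> Prop) (psi : R -> R -> R) (x0 : R) (m : nat).
Hypothesis Hf : is_iet f.
Hypothesis HJ : minimal_component f J.
Hypothesis HP : circle_action f J psi x0 m.

Let C := Cent_on f J.

Lemma circle_J i : J (iter i f x0).
Proof. apply (iter_invariant f J i x0 (mc_invariant f J Hf HJ)). apply HP. Qed.

Lemma circle_frac t x : J x -> psi t x = psi (frac1 t) x.
Proof.
  destruct HP as (Hx0 & Hm & HJp & Hadd & Hz & Hfree & Hcent & Hcomm & Hcov & Hsep).
  intro Hx. destruct (frac1_int t) as [z E]. rewrite E at 1. rewrite Hadd, Hz; auto.
Qed.

Lemma circle_time_unique s t x : J x -> in01 s -> in01 t -> psi s x = psi t x -> s = t.
Proof.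
  destruct HP as (Hx0 & Hm & HJp & Hadd & Hz & Hfree & Hcent & Hcomm & Hcov & Hsep).
  intros Hx Hs Ht E. assert (E' : psi (- t + s) x = x).
  { rewrite Hadd, E, <- Hadd by auto. replace (- t + t) with (IZR 0) by (simpl; ring). auto. }
  destruct (Hfree _ _ Hx E') as [z Ez]. unfold in01 in *.
  assert (z = 0%Z). { assert (-1 < z < 1)%Z; [|lia]. split; apply lt_IZR; simpl; lra. }
  subst z. lra.
Qed.

Definition coord (h : R -> R) (i : nat) (p : nat * R) : Prop :=
  (fst p < m)%nat /\ in01 (snd p) /\ h (iter i f x0) = psi (snd p) (iter (fst p) f x0).

Definition crd (h : R -> R) (i : nat) : nat * R := epsilon (inhabits (O, 0)) (coord h i).

Lemma crd_spec h i : gmem C h -> coord h i (crd h i).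
Proof.
  destruct HP as (Hx0 & Hm & HJp & Hadd & Hz & Hfree & Hcent & Hcomm & Hcov & Hsep).
  intro Hh. unfold crd. apply epsilon_spec.
  destruct (Hcov (h (iter i f x0))) as (j & t & Hj & E).
  - apply (proj1 (cent_on_inv f J h (fun x => mc_in01 f J x HJ) Hh _)). apply circle_J.
  - exists (j, frac1 t). split; auto. split; [apply frac1_in01|]. simpl.
    rewrite <- circle_frac; auto. apply circle_J.
Qed.

Lemma crd_eq h i j t : gmem C h -> (j < m)%nat ->
  h (iter i f x0) = psi t (iter j f x0) -> crd h i = (j, frac1 t).
Proof.
  pose proof HP as (Hx0 & Hm & HJp & Hadd & Hz & Hfree & Hcent & Hcomm & Hcov & Hsep).
  intros Hh Hj E. destruct (crd_spec h i Hh) as (H1 & H2 & H3). destruct (crd h i) as [j' t']. simpl in *.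
  assert (j' = j) by (apply (Hsep j' j t' t); auto; congruence). subst j'. f_equal.
  apply (circle_time_unique _ _ (iter j f x0)); auto; [apply circle_J|apply frac1_in01|].
  rewrite <- circle_frac by apply circle_J. congruence.
Qed.

Definition tsym (h : R -> R) (i : nat) : nat := if Nat.ltb i m then fst (crd h i) else i.
(** Indexed by the target circle, to match [torus_act], which reads the vector through the inverse
    permutation. *)
Definition tvec (h : R -> R) (j : nat) : R := if Nat.ltb j m then snd (crd h (perm_inv m (tsym h) j)) else 0.
Definition tmap (h : R -> R) : (nat -> R) * (nat -> nat) := (tvec h, tsym h).

Lemma tsym_lt h i : (i < m)%nat -> tsym h i = fst (crd h i).
Proof. intro Hi. unfold tsym. apply Nat.ltb_lt in Hi. rewrite Hi. auto. Qed.

Lemma tsym_ge h i : (m <= i)%nat -> tsym h i = i.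
Proof. intro Hi. unfold tsym. apply Nat.ltb_ge in Hi. rewrite Hi. auto. Qed.

Lemma tsym_mem h : gmem C h -> gmem (Sym m) (tsym h).
Proof.
  pose proof HP as (Hx0 & Hm & HJp & Hadd & Hz & Hfree & Hcent & Hcomm & Hcov & Hsep).
  intro Hh. split; [|split].
  - intros i Hi. rewrite tsym_lt by auto. apply (crd_spec h i Hh).
  - intros i j Hi Hj E. rewrite !tsym_lt in E by auto.
    destruct (crd_spec h i Hh) as (H1 & H2 & H3). destruct (crd_spec h j Hh) as (H4 & H5 & H6).
    rewrite E in H3. set (a := snd (crd h i)) in *. set (b := snd (crd h j)) in *. set (c := fst (crd h j)) in *.
    (* If base points [i] and [j] land on one circle at times [a] and [b], then [i] rotated by [b]
       and [j] rotated by [a] have the same image under [h]. *)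
    apply (Hsep i j b a); auto. apply (iet_inj h); [apply Hh|].
    rewrite !Hcomm, H3, H6 by (auto; apply circle_J).
    rewrite <- !Hadd by apply circle_J. f_equal. ring.
  - intros i Hi. apply tsym_ge; auto.
Qed.

Lemma tvec_sym h i : gmem C h -> (i < m)%nat -> tvec h (tsym h i) = snd (crd h i).
Proof.
  intros Hh Hi. pose proof (tsym_mem h Hh) as Hs. unfold tvec.
  destruct (Nat.ltb_spec (tsym h i) m) as [Hl|Hl].
  - rewrite perm_inv_l; auto.
  - destruct Hs as [Hs _]. specialize (Hs i Hi). lia.
Qed.

Lemma tvec_ge h j : (m <= j)%nat -> tvec h j = 0.
Proof. intro Hj. unfold tvec. apply Nat.ltb_ge in Hj. rewrite Hj. auto. Qed.

Lemma tmap_mem h : gmem C h -> gmem (TorusSym m) (tmap h).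
Proof.
  intro Hh. pose proof (tsym_mem h Hh) as Hs. split; [|exact Hs]. simpl. split.
  - intros j Hj. destruct (perm_inv_r m (tsym h) j Hs Hj) as [H1 H2].
    rewrite <- H2, tvec_sym by auto. apply (crd_spec h _ Hh).
  - intros j Hj. apply tvec_ge; auto.
Qed.

Lemma tmap_mul g h : gmem C g -> gmem C h -> tmap (fun x => g (h x)) = gmul (TorusSym m) (tmap g) (tmap h).
Proof.
  pose proof HP as (Hx0 & Hm & HJp & Hadd & Hz & Hfree & Hcent & Hcomm & Hcov & Hsep).
  intros Hg Hh. pose proof (cent_on_comp f J g h Hg Hh) as Hgh.
  pose proof (tsym_mem g Hg) as Sg. pose proof (tsym_mem h Hh) as Sh. pose proof (tsym_mem _ Hgh) as Sgh.
  assert (Ecrd : forall i, (i < m)%nat -> crd (fun x => g (h x)) i =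
     (tsym g (tsym h i), frac1 (snd (crd g (tsym h i)) + snd (crd h i)))).
  { intros i Hi. destruct (crd_spec h i Hh) as (H1 & H2 & H3).
    destruct (crd_spec g (tsym h i) Hg) as (H4 & H5 & H6).
    assert (Hsi : (tsym h i < m)%nat) by (apply Sh; auto).
    apply crd_eq; auto; [apply Sg; auto|].
    rewrite H3, Hcomm by (auto; apply circle_J). rewrite <- tsym_lt by auto. rewrite H6.
    rewrite (tsym_lt g) by auto. rewrite <- Hadd by apply circle_J. f_equal. ring. }
  assert (Es : tsym (fun x => g (h x)) = fun i => tsym g (tsym h i)).
  { extensionality i. destruct (le_lt_dec m i) as [Hi|Hi].
    - rewrite !tsym_ge; auto. rewrite tsym_ge; auto.
    - rewrite tsym_lt, Ecrd; auto. }
  unfold tmap. simpl. rewrite Es. f_equal. extensionality j. unfold torus_act.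
  destruct (le_lt_dec m j) as [Hj|Hj].
  - rewrite perm_inv_out, !tvec_ge by auto. replace (0 + 0) with (IZR 0) by (simpl; ring). rewrite frac1_IZR. auto.
  - destruct (perm_inv_r m _ j Sg Hj) as [H1 H2].
    destruct (perm_inv_r m _ _ Sh H1) as [H3 H4].
    set (i := perm_inv m (tsym h) (perm_inv m (tsym g) j)) in *.
    assert (Ej : j = tsym (fun x => g (h x)) i) by (rewrite Es; cbv beta; congruence).
    rewrite Ej at 1. rewrite tvec_sym, Ecrd by auto. simpl. f_equal. f_equal.
    + rewrite <- H2 at 1. rewrite H4, tvec_sym; auto.
    + rewrite <- H4. rewrite tvec_sym; auto.
Qed.

Lemma tmap_circle t : in01 t -> tmap (psi t) = ((fun j => if Nat.ltb j m then t else 0), (fun i => i)).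
Proof.
  pose proof HP as (Hx0 & Hm & HJp & Hadd & Hz & Hfree & Hcent & Hcomm & Hcov & Hsep).
  intro Ht.
  assert (E : forall i, (i < m)%nat -> crd (psi t) i = (i, t)).
  { intros i Hi. rewrite (crd_eq (psi t) i i t); auto. rewrite frac1_id; auto. }
  unfold tmap. f_equal; apply functional_extensionality; intro i.
  - unfold tvec. destruct (Nat.ltb_spec i m) as [Hi|Hi]; auto.
    destruct (perm_inv_r m (tsym (psi t)) i) as [H1 _]; auto; [apply tsym_mem, Hcent|].
    rewrite E; auto.
  - destruct (le_lt_dec m i) as [Hi|Hi]; [apply tsym_ge; auto|]. rewrite tsym_lt, E; auto.
Qed.

Lemma psi_zero : psi 0 = fun x => x.
Proof. extensionality x. destruct HP as (_ & _ & _ & _ & Hz & _). apply (Hz 0%Z x). Qed.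

(** The coordinates at the base point [x0] already fix the value there, and one value determines the
    map on [J]. *)
Lemma tmap_inj g h : gmem C g -> gmem C h -> tmap g = tmap h -> g = h.
Proof.
  pose proof HP as (Hx0 & Hm & HJp & Hadd & Hz & Hfree & Hcent & Hcomm & Hcov & Hsep).
  intros Hg Hh E. unfold tmap in E. injection E as Ev Es.
  assert (E0 : g x0 = h x0).
  { destruct (crd_spec g 0 Hg) as (_ & _ & H1). destruct (crd_spec h 0 Hh) as (_ & _ & H2). simpl in H1, H2.
    rewrite <- tvec_sym, <- tsym_lt in H1, H2 by auto. rewrite Ev, Es in H1. congruence. }
  extensionality y. destruct (classic (J y)) as [Hy|Hy].
  - apply (mc_agree_iet f J g h x0); auto; apply Hg || apply Hh.
  - rewrite !(cent_on_out f J); auto.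
Qed.

Lemma cent_on_torus : exists S, subgroup (TorusSym m) S /\ (forall p, diagonal m p -> S p) /\
  grp_iso (Cent_on f J) (restrict (TorusSym m) S).
Proof.
  pose proof HP as (Hx0 & Hm & HJp & Hadd & Hz & Hfree & Hcent & Hcomm & Hcov & Hsep).
  assert (H0 : in01 0) by (unfold in01; lra).
  assert (Eone : tmap (fun x => x) = gone (TorusSym m)).
  { rewrite <- psi_zero, tmap_circle by auto. simpl. f_equal. extensionality j.
    destruct (Nat.ltb j m); auto. }
  exists (fun p => exists h, gmem C h /\ tmap h = p). split; [|split].
  - split; [|split; [|split]].
    + intros p [h [Hh <-]]. apply tmap_mem; auto.
    + exists (fun x => x). split; auto. apply cent_on_id.
    + intros p q [g [Hg <-]] [h [Hh <-]]. exists (fun x => g (h x)). split; [apply cent_on_comp; auto|].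
      apply tmap_mul; auto.
    + intros p [h [Hh <-]]. pose proof (cent_on_inverse f J h Hh) as Hi.
      exists (tmap (inv h)). split; [eauto|]. rewrite <- !tmap_mul by auto. rewrite <- Eone.
      split; f_equal; extensionality x; [apply inv_r|apply inv_l]; apply Hh.
  - intros p [t [Ht ->]]. exists (psi t). split; [apply Hcent|]. apply tmap_circle; auto.
  - exists tmap. split; [|split; [|split]].
    + intros h Hh. exists h. auto.
    + intros g h Hg Hh. apply tmap_inj; auto.
    + intros p Hp. exact Hp.
    + intros g h Hg Hh. apply (tmap_mul g h); auto.
Qed.

End Torus.

Lemma cent_on_dichotomy f J : is_iet f -> minimal_component f J ->
  (infinite_grp (Cent_on f J) /\ virtually_cyclic (Cent_on f J)) \/
  (exists m : nat, (1 <= m)%nat /\ exists S,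
     subgroup (TorusSym m) S /\ (forall p, diagonal m p -> S p) /\
     grp_iso (Cent_on f J) (restrict (TorusSym m) S)).
Proof.
  intros Hf HJ. destruct (classic (exists l, singular_germ f J l)) as [[l Hl]|Hno].
  - left. split; [apply cent_on_infinite; auto|]. apply (cent_on_virtually_cyclic f J l); auto.
  - right. destruct (flow_exists f J Hf HJ) as (F & L & x0 & Q & HF); [intros l Hl; eauto|].
    destruct (circle_action_exists f J F L x0 Q Hf HJ HF) as [m Hm].
    exists m. split; [apply Hm|]. apply (cent_on_torus f J (circ F L) x0 m); auto.
Qed.

(** * The periodic part *)

(** The cells of [X] are pushed together side by side, from left to right, until they fill one
    interval of length [l]. *)
Lemma linear_chart (X : R -> Prop) : pset X -> (forall x, X x -> in01 x) ->
  exists (psi : R -> R) (l : R),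
    (forall x, X x -> 0 <= psi x < l) /\ inj_on X psi /\
    (forall y, 0 <= y < l -> exists x, X x /\ psi x = y) /\ paff 1 X psi.
Proof.
  intros [D HD] HX. destruct (sorted_partition D) as (n & a & Ha0 & Ha1 & Hlt & Hav).
  pose proof (partition_range n a Ha0 Ha1 Hlt) as Hr.
  assert (Hcell : forall i x, (i < n)%nat -> a i <= x < a (S i) -> (X (a i) <-> X x)).
  { intros i x Hi Hx. destruct (Req_dec x (a i)) as [->|Hne]; [tauto|].
    assert (0 <= a i <= 1) by (apply Hr; lia). assert (0 <= a (S i) <= 1) by (apply Hr; lia).
    apply HD; unfold in01; try lra. intros d Hd Hi'. apply (Hav i d Hi Hd). lra. }
  assert (Hk : forall k, (k <= n)%nat -> exists psi l, 0 <= l /\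
    (forall x, X x -> x < a k -> 0 <= psi x < l) /\
    (forall x y, X x -> X y -> x < a k -> y < a k -> psi x = psi y -> x = y) /\
    (forall y, 0 <= y < l -> exists x, X x /\ x < a k /\ psi x = y) /\
    (forall i x, (i < k)%nat -> X x -> a i <= x < a (S i) -> psi x = psi (a i) + (x - a i))).
  { induction k as [|k IH]; intro Hkn.
    - exists (fun x => x), 0. split; [lra|]. rewrite Ha0. split; [|split; [|split]].
      + intros x Hx Hx0. apply HX in Hx. unfold in01 in Hx. lra.
      + intros x y Hx _ Hx0. apply HX in Hx. unfold in01 in Hx. lra.
      + intros y Hy. lra.
      + intros i x Hi. lia.
    - destruct IH as (psi & l & Hl & H1 & H2 & H3 & H4); [lia|].
      specialize (Hlt k ltac:(lia)) as Hltk.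
      destruct (classic (X (a k))) as [HXk|HXk].
      (* A cell inside [X] is appended at the right end of the interval built so far. *)
      + exists (fun x => if Rlt_dec x (a k) then psi x else l + (x - a k)), (l + (a (S k) - a k)).
        assert (Hak : forall i, (i < k)%nat -> a i < a k).
        { intros i Hi. assert (HH : forall j, (S i <= j)%nat -> (j <= k)%nat -> a i < a j).
          { intros j Hj. induction Hj as [|j Hj IHj]; intro Hjk; [apply Hlt; lia|].
            assert (a j < a (S j)) by (apply Hlt; lia). assert (a i < a j) by (apply IHj; lia). lra. }
          apply HH; lia. }
        split; [lra|]. split; [|split; [|split]].
        * intros x Hx Hxk. destruct (Rlt_dec x (a k)); [|lra]. specialize (H1 x Hx ltac:(lra)). lra.
        * intros x y Hx Hy Hxk Hyk E. destruct (Rlt_dec x (a k)), (Rlt_dec y (a k)).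
          -- apply H2; auto.
          -- pose proof (H1 x Hx ltac:(lra)). lra.
          -- pose proof (H1 y Hy ltac:(lra)). lra.
          -- lra.
        * intros y Hy. destruct (Rlt_dec y l) as [Hyl|Hyl].
          -- destruct (H3 y ltac:(lra)) as (x & Hx1 & Hx2 & Hx3). exists x. split; [auto|]. split; [lra|].
             destruct (Rlt_dec x (a k)); auto; lra.
          -- exists (a k + (y - l)). split; [|split].
             ++ apply (Hcell k); auto; lra || lia.
             ++ lra.
             ++ destruct (Rlt_dec (a k + (y - l)) (a k)); lra.
        * intros i x Hi Hx Hxi. destruct (Nat.eq_dec i k) as [->|Hne].
          -- destruct (Rlt_dec x (a k)), (Rlt_dec (a k) (a k)); lra.
          -- assert (Hik : (i < k)%nat) by lia. pose proof (Hak i Hik).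
             assert (a (S i) <= a k). { destruct (Nat.eq_dec (S i) k) as [->|]; [lra|]. left. apply Hak; lia. }
             destruct (Rlt_dec x (a k)), (Rlt_dec (a i) (a k)); try lra. apply H4; auto.
      + exists psi, l.
        assert (Hxk : forall x, X x -> x < a (S k) -> x < a k).
        { intros x Hx Hxs. destruct (Rlt_dec x (a k)); auto. exfalso. apply HXk. apply (Hcell k x); auto; lra || lia. }
        split; auto. split; [|split; [|split]].
        * intros x Hx Hxs. auto.
        * intros x y Hx Hy Hxs Hys. auto.
        * intros y Hy. destruct (H3 y Hy) as (x & Hx1 & Hx2 & Hx3). exists x. split; [auto|]. split; [lra|auto].
        * intros i x Hi Hx Hxi. destruct (Nat.eq_dec i k) as [->|Hne]; [|apply H4; auto; lia].
          exfalso. apply HXk. apply (Hcell k x); auto. }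
  destruct (Hk n (le_n n)) as (psi & l & Hl & H1 & H2 & H3 & H4).
  assert (HX1 : forall x, X x -> x < a n) by (intros x Hx; apply HX in Hx; unfold in01 in Hx; lra).
  exists psi, l. split; [auto|]. split; [|split].
  - intros x y Hx Hy. auto.
  - intros y Hy. destruct (H3 y Hy) as (x & Hx1 & Hx2 & Hx3). eauto.
  - exists (map a (seq 0 (S n))). intros x y Hx Hy Hxy Ha HXx.
    destruct (partition_locate n a x) as [i [Hi Hxi]]; [unfold in01 in Hx; lra|].
    assert (Hyi : y < a (S i)).
    { destruct (Rlt_dec y (a (S i))); auto. exfalso. apply (Ha (a (S i))); [|lra].
      apply in_map. apply in_seq. lia. }
    assert (HXy : X y) by (apply (Hcell i y); [auto|lra|]; apply (Hcell i x); auto).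
    rewrite (H4 i x), (H4 i y); auto; lra.
Qed.

(** * Charts and conjugation *)

Definition transport (B : R -> Prop) (u w h : R -> R) : R -> R := res B (fun y => u (h (w y))).

Definition chart (c : R) (A B : R -> Prop) (u w : R -> R) : Prop :=
  0 < c /\ pset A /\ pset B /\ (forall x, A x -> in01 x) /\ (forall x, B x -> in01 x) /\
  (forall x, A x -> B (u x)) /\ (forall y, B y -> A (w y)) /\
  (forall x, A x -> w (u x) = x) /\ (forall y, B y -> u (w y) = y) /\ paff c A u.

Lemma chart_sym c A B u w : chart c A B u w -> chart (/ c) B A w u.
Proof.
  intros (H1 & H2 & H3 & H4 & H5 & H6 & H7 & H8 & H9 & H10).
  split; [apply Rinv_0_lt_compat; auto|]. repeat (split; auto).
  apply (paff_inverse c A B u w); auto.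
Qed.

(** The slopes [c] and [/ c] of the chart and of its inverse cancel, so conjugation keeps
    translations. This is why a chart has a single slope on all its pieces. *)
Lemma transport_pt c A B u w h : chart c A B u w -> is_iet h -> (forall x, A x <-> A (h x)) ->
  pt (transport B u w h).
Proof.
  intros HC Hh HA. pose proof (chart_sym c A B u w HC) as (_ & _ & _ & _ & _ & _ & _ & _ & _ & Hw).
  destruct HC as (H1 & H2 & H3 & H4 & H5 & H6 & H7 & H8 & H9 & H10).
  assert (Hq : pcw (fun x y => A x -> u (h y) - u (h x) = c * (y - x))).
  { eapply pcw_impl; [|apply (pcw_and _ _ (iet_pullback h _ Hh H10) (iet_pt h Hh))].
    cbv beta. intros x y _ _ _ [E1 E2] Hx. rewrite E1 by (apply (proj1 (HA x)); auto). rewrite E2. auto. }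
  assert (Hq' : pcw (fun x y => B x -> B y /\ (A (w x) -> u (h (w y)) - u (h (w x)) = c * (w y - w x)))).
  { apply (pcw_pullback (/ c) B w (fun x y => A x -> u (h y) - u (h x) = c * (y - x))); auto.
    - apply Rinv_0_lt_compat; auto.
    - intros x y Hx Hy E. rewrite <- (H9 x), <- (H9 y), E; auto. }
  eapply pcw_impl; [|apply (pcw_and _ _ H3 (pcw_and _ _ Hq' Hw))]. cbv beta.
  intros x y _ _ _ (E1 & E2 & E3). unfold transport.
  destruct (classic (B x)) as [Hx|Hx].
  - rewrite !res_in by tauto. destruct (E2 Hx) as [_ E4]. rewrite E4, E3 by auto. field. lra.
  - rewrite !res_out; tauto.
Qed.

Lemma transport_in (B : R -> Prop) u w h y : B y -> transport B u w h y = u (h (w y)).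
Proof. apply (res_in B (fun y => u (h (w y)))). Qed.

Lemma transport_out (B : R -> Prop) u w h y : ~ B y -> transport B u w h y = y.
Proof. apply (res_out B (fun y => u (h (w y)))). Qed.

Lemma transport_invariant c A B u w h : chart c A B u w -> (forall x, A x <-> A (h x)) ->
  forall y, B y -> B (transport B u w h y).
Proof.
  intros (H1 & H2 & H3 & H4 & H5 & H6 & H7 & H8 & H9 & H10) HA y Hy. rewrite transport_in by auto.
  apply H6. apply (proj1 (HA _)). auto.
Qed.

Lemma transport_comp c A B u w g h : chart c A B u w ->
  (forall x, A x <-> A (h x)) ->
  forall y, transport B u w (fun x => g (h x)) y = transport B u w g (transport B u w h y).
Proof.
  intros HC HA y. pose proof HC as (H1 & H2 & H3 & H4 & H5 & H6 & H7 & H8 & H9 & H10).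
  destruct (classic (B y)) as [Hy|Hy].
  - rewrite (transport_in B u w g) by (eapply transport_invariant; eauto).
    rewrite !transport_in by auto. rewrite H8; auto. apply (proj1 (HA _)). auto.
  - rewrite !transport_out; auto. rewrite transport_out; auto.
Qed.

Lemma transport_iet c A B u w h : chart c A B u w -> is_iet h -> (forall x, A x <-> A (h x)) ->
  is_iet (transport B u w h).
Proof.
  intros HC Hh HA. pose proof HC as (H1 & H2 & H3 & H4 & H5 & H6 & H7 & H8 & H9 & H10).
  pose proof (inv_invariant A h Hh HA) as HAi.
  apply (iet_of_inverse _ (transport B u w (inv h))).
  - intros x Hx. apply transport_out. auto.
  - intro x. rewrite <- (transport_comp c A B u w (inv h) h) by auto.
    destruct (classic (B x)); [|apply transport_out; auto]. rewrite transport_in, inv_l; auto.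
  - intro x. rewrite <- (transport_comp c A B u w h (inv h)) by auto.
    destruct (classic (B x)); [|apply transport_out; auto]. rewrite transport_in, inv_r; auto.
  - apply (transport_pt c A); auto.
Qed.

Lemma transport_back c A B u w h : chart c A B u w -> (forall x, A x <-> A (h x)) ->
  forall x, A x -> transport A w u (transport B u w h) x = h x.
Proof.
  intros (H1 & H2 & H3 & H4 & H5 & H6 & H7 & H8 & H9 & H10) HA x Hx.
  rewrite transport_in by auto. rewrite transport_in by auto. rewrite (H8 x) by auto. apply H8.
  apply (proj1 (HA x)); auto.
Qed.

(** A fundamental domain for [f] on the points of period [n]: the leftmost point of each orbit. The
    comparisons defining it are constant on pieces where the iterates are translations. *)
Definition orbit_min (f : R -> R) (n : nat) (x : R) : Prop :=
  min_period f n x /\ forall j, (j < n)%nat -> x <= iter j f x.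

Lemma pset_orbit_min f n : is_iet f -> pset (orbit_min f n).
Proof.
  intro Hf. apply pset_and; [apply pset_min_period; auto|]. apply pset_forall_lt. intros j _.
  eapply pcw_impl; [|apply (iet_pt _ (iet_iter j f Hf))]. cbv beta. intros x y _ _ _ E. lra.
Qed.

Lemma orbit_min_exists f n x : is_iet f -> min_period f n x ->
  exists j x', (j < n)%nat /\ orbit_min f n x' /\ x = iter j f x'.
Proof.
  intros Hf Hx. pose proof Hx as (Hx01 & Hn & Hp & Hm).
  destruct (argmin_lt n (fun j => iter j f x) Hn) as [i [Hi Hmi]].
  assert (Hx' : min_period f n (iter i f x)).
  { apply (proj1 (min_period_invariant f (iter i f) n x Hf (iet_iter i f Hf) (commute_iter f f i (fun _ => eq_refl)))); auto. }
  assert (Ho : orbit_min f n (iter i f x)).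
  { split; auto. intros j Hj. rewrite <- iter_add, (iter_mod f n (j + i) x Hn Hp). apply Hmi.
    apply Nat.mod_upper_bound. lia. }
  destruct (Nat.eq_dec i 0) as [->|Hi0].
  - exists O, x. auto.
  - exists (n - i)%nat, (iter i f x). split; [lia|]. split; auto. rewrite <- iter_add.
    replace (n - i + i)%nat with n by lia. auto.
Qed.

(** Two minima on the same orbit bound each other from both sides, so they coincide; minimality of
    the period then gives [i = j]. *)
Lemma orbit_min_unique f n i j x y : is_iet f -> orbit_min f n x -> orbit_min f n y ->
  (i < n)%nat -> (j < n)%nat -> iter i f x = iter j f y -> i = j /\ x = y.
Proof.
  intros Hf [Hx Hxm] [Hy Hym] Hi Hj E.
  pose proof Hx as (Hx01 & Hn & Hpx & Hmx). pose proof Hy as (Hy01 & _ & Hpy & Hmy).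
  assert (Hle : forall x y i j, min_period f n x -> (forall j, (j < n)%nat -> x <= iter j f x) ->
    iter n f y = y -> (i < n)%nat -> (j < n)%nat -> iter i f x = iter j f y -> x <= y).
  { clear. intros x y i j (H1 & Hn & H3 & H4) Hmin Hpy Hi Hj E.
    assert (Ey : y = iter ((n - j + i) mod n) f x).
    { rewrite <- iter_mod by auto. rewrite iter_add, E, <- iter_add.
      replace (n - j + j)%nat with n by lia. auto. }
    rewrite Ey. apply Hmin. apply Nat.mod_upper_bound. lia. }
  assert (Exy : x = y) by (apply Rle_antisym; [eapply (Hle x y i j)|eapply (Hle y x j i)]; eauto).
  split; auto. subst y.
  assert (Hlt : forall a b, (a < b)%nat -> (b < n)%nat -> iter a f x = iter b f x -> False).
  { intros a b Hab Hb Eab. apply (Hmx (b - a)%nat); [lia|].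
    apply (iet_inj (iter a f)); [apply iet_iter; auto|]. rewrite <- iter_add, Eab. f_equal. lia. }
  destruct (Nat.lt_trichotomy i j) as [H|[H|H]]; auto; exfalso; eauto.
Qed.

Lemma rot_in n x : in01 x -> rot n x = frac1 (x + / INR n).
Proof.
  intros [H1 H2]. unfold rot. destruct (Rle_dec 0 x); [|lra]. destruct (Rlt_dec x 1); [auto|lra].
Qed.

Lemma rot_out n x : ~ in01 x -> rot n x = x.
Proof.
  intro H. unfold rot. destruct (Rle_dec 0 x); auto. destruct (Rlt_dec x 1); auto.
  exfalso. apply H. split; auto.
Qed.

Lemma rot_in01 n x : in01 x -> in01 (rot n x).
Proof. intro H. rewrite rot_in by auto. apply frac1_in01. Qed.

(* The chart sends the [j]-th iterate of the orbit minimum [x'] to [(psi x' / l + j) / n]. *)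
Lemma period_chart f n : is_iet f -> (exists x, min_period f n x) ->
  exists c u w, chart c (min_period f n) in01 u w /\
    forall x, min_period f n x -> u (f x) = rot n (u x).
Proof.
  intros Hf [x1 Hx1]. set (A := min_period f n). set (X := orbit_min f n).
  assert (Hn : (1 <= n)%nat) by apply Hx1.
  assert (HnR : 0 < INR n) by (apply lt_0_INR; lia).
  assert (HX01 : forall x, X x -> in01 x) by (intros x [[H _] _]; auto).
  destruct (linear_chart X (pset_orbit_min f n Hf) HX01) as (psi & l & P1 & P2 & P3 & P4).
  assert (Hl : 0 < l).
  { destruct (orbit_min_exists f n x1 Hf Hx1) as (j & x' & _ & Hx' & _). specialize (P1 x' Hx'). lra. }
  set (val := fun (j : nat) x' => (psi x' / l + INR j) / INR n).
  assert (Hu : exists u : R -> R, forall x, A x -> exists j x', (j < n)%nat /\ X x' /\ x = iter j f x' /\ u x = val j x').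
  { apply (fun_choice (fun x v => A x -> exists j x', (j < n)%nat /\ X x' /\ x = iter j f x' /\ v = val j x')).
    intro x. destruct (classic (A x)) as [Hx|Hx]; [|exists 0; tauto].
    destruct (orbit_min_exists f n x Hf Hx) as (j & x' & H1 & H2 & H3).
    exists (val j x'). intros _. exists j, x'. auto. }
  destruct Hu as [u Hu].
  assert (HXA : forall j x', X x' -> A (iter j f x')).
  { intros j x' [Hx' _]. apply (proj1 (min_period_invariant f (iter j f) n x' Hf (iet_iter j f Hf) (commute_iter f f j (fun _ => eq_refl)))); auto. }
  assert (Huv : forall j x', (j < n)%nat -> X x' -> u (iter j f x') = val j x').
  { intros j x' Hj Hx'. destruct (Hu (iter j f x') (HXA j x' Hx')) as (j' & x'' & H1 & H2 & H3 & H4).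
    destruct (orbit_min_unique f n j j' x' x'' Hf Hx' H2 Hj H1 H3) as [-> ->]. auto. }
  assert (Hfr : forall x', X x' -> 0 <= psi x' / l < 1).
  { intros x' Hx'. specialize (P1 x' Hx'). split.
    - apply Rmult_le_pos; [lra|]. left. apply Rinv_0_lt_compat; auto.
    - apply (Rmult_lt_reg_r l); auto. replace (psi x' / l * l) with (psi x') by (field; lra). lra. }
  assert (Hval01 : forall j x', (j < n)%nat -> X x' -> in01 (val j x')).
  { intros j x' Hj Hx'. specialize (Hfr x' Hx'). unfold val, in01.
    assert (INR j + 1 <= INR n) by (rewrite <- S_INR; apply le_INR; lia). pose proof (pos_INR j). split.
    - apply Rmult_le_pos; [lra|]. left. apply Rinv_0_lt_compat; auto.
    - apply (Rmult_lt_reg_r (INR n)); auto. unfold Rdiv at 1. rewrite Rmult_assoc, Rinv_l by lra. lra. }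
  assert (Hinj : inj_on A u).
  { intros x y Hx Hy E. destruct (Hu x Hx) as (j & x' & H1 & H2 & H3 & H4).
    destruct (Hu y Hy) as (i & y' & H5 & H6 & H7 & H8).
    assert (Ev : psi x' / l + INR j = psi y' / l + INR i).
    { unfold val in *. rewrite E, H8 in H4. apply (f_equal (fun z => z * INR n)) in H4.
      unfold Rdiv in H4 at 1. rewrite Rmult_assoc, Rinv_l in H4 by lra.
      unfold Rdiv in H4 at 2. rewrite Rmult_assoc, Rinv_l in H4 by lra. lra. }
    pose proof (Hfr x' H2). pose proof (Hfr y' H6).
    assert (j = i).
    { destruct (Nat.lt_trichotomy j i) as [Hlt|[Hlt|Hlt]]; auto; exfalso.
      - assert (INR j + 1 <= INR i) by (rewrite <- S_INR; apply le_INR; lia). lra.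
      - assert (INR i + 1 <= INR j) by (rewrite <- S_INR; apply le_INR; lia). lra. }
    subst i. assert (Exy : psi x' / l = psi y' / l) by lra.
    apply (f_equal (fun z => z * l)) in Exy. unfold Rdiv in Exy. rewrite !Rmult_assoc, Rinv_l in Exy by lra.
    assert (x' = y') by (apply P2; auto; lra). congruence. }
  assert (Hsurj : forall y, in01 y -> exists x, A x /\ u x = y).
  { intros y [Hy0 Hy1]. destruct (nat_floor (INR n * y) 1) as [j Hj]; [apply Rmult_le_pos; lra|lra|].
    assert (Hjn : (j < n)%nat).
    { apply INR_lt. assert (INR n * y < INR n * 1) by (apply Rmult_lt_compat_l; auto). lra. }
    destruct (P3 ((INR n * y - INR j) * l)) as [x' [Hx' Ex']].
    { split; [apply Rmult_le_pos; lra|]. rewrite <- (Rmult_1_l l) at 2. apply Rmult_lt_compat_r; lra. }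
    exists (iter j f x'). split; auto. rewrite Huv by auto. unfold val. rewrite Ex'. field. lra. }
  assert (Hw : exists w : R -> R, forall y, in01 y -> A (w y) /\ u (w y) = y).
  { apply (fun_choice (fun y x => in01 y -> A x /\ u x = y)). intro y.
    destruct (classic (in01 y)) as [Hy|Hy]; [|exists 0; tauto]. destruct (Hsurj y Hy) as [x Hx]. exists x. auto. }
  destruct Hw as [w Hw].
  assert (HA01 : forall x, A x -> in01 (u x)).
  { intros x Hx. destruct (Hu x Hx) as (j & x' & H1 & H2 & H3 & ->). auto. }
  (* [psi] has slope 1; division by [l] normalises its image to [0,1), and division by [n] makes
     room for [n] copies. *)
  exists (/ (INR n * l)), u, w. split.
  - split; [apply Rinv_0_lt_compat, Rmult_lt_0_compat; auto|].
    split; [apply pset_min_period; auto|]. split; [apply pset_in01|].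
    split; [intros x [Hx _]; auto|]. split; [auto|]. split; [auto|]. split; [intros; apply Hw; auto|].
    split; [|split; [intros; apply Hw; auto|]].
    + intros x Hx. apply Hinj; auto; apply Hw; auto.
    (* Pulling back by [j] steps shows that two points of one piece sit at the same level [j] over
       the fundamental domain. *)
    + assert (Hj : forall j, (j < n)%nat -> pcw (fun x y => X (iter j (inv f) x) ->
         X (iter j (inv f) y) /\ psi (iter j (inv f) y) - psi (iter j (inv f) x) = y - x)).
      { intros j _. assert (Hij : is_iet (iter j (inv f))) by (apply iet_iter, iet_inv; auto).
        eapply pcw_impl; [|apply (pcw_and _ _ (iet_pullback _ _ Hij (pcw_and _ _ (pset_orbit_min f n Hf) P4)) (iet_pt _ Hij))].
        cbv beta. intros x y _ _ _ ((E1 & E2) & E3) Hx. split; [apply E1; auto|]. rewrite E2, E3 by auto. ring. }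
      eapply pcw_impl; [|apply (pcw_all_lt n _ Hj)]. cbv beta. intros x y _ _ _ HH Hx.
      destruct (Hu x Hx) as (j & x' & H1 & H2 & H3 & H4).
      assert (Ex : iter j (inv f) x = x') by (rewrite H3; apply iter_inv_l; auto).
      destruct (HH j H1) as [H5 H6]; [rewrite Ex; auto|]. rewrite Ex in H6.
      set (y' := iter j (inv f) y) in *.
      assert (Ey : y = iter j f y') by (symmetry; apply iter_inv_r; auto).
      rewrite H4. rewrite Ey at 1. rewrite Huv by auto. unfold val.
      replace (psi y') with (psi x' + (y - x)) by lra. field. lra.
  - intros x Hx. destruct (Hu x Hx) as (j & x' & H1 & H2 & H3 & H4).
    rewrite rot_in by auto. rewrite H4, H3. change (f (iter j f x')) with (iter (S j) f x').
    destruct (Nat.eq_dec (S j) n) as [E|Hne].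
    (* The last level returns to the orbit minimum, and the rotation passes 1 exactly there. *)
    + rewrite E. destruct H2 as [H2a H2b]. pose proof H2a as (_ & _ & Hp & _). rewrite Hp.
      symmetry. assert (HXx' : X x') by (split; auto). apply (frac1_unique _ _ 1).
      * apply (HA01 x'); auto.
      * change x' with (iter 0 f x') at 2. rewrite Huv by (auto; lia). unfold val.
        rewrite <- E, S_INR. simpl. pose proof (pos_INR j). field. lra.
    + rewrite Huv by (auto; lia). symmetry. apply (frac1_unique _ _ 0); [apply Hval01; auto; lia|].
      unfold val. rewrite S_INR. field. lra.
Qed.

Fixpoint comp_family (g : nat -> R -> R) (k : nat) (x : R) : R :=
  match k with O => x | S k' => comp_family g k' (g k' x) end.

Lemma comp_family_out (g : nat -> R -> R) k x : (forall i, (i < k)%nat -> g i x = x) -> comp_family g k x = x.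
Proof.
  induction k as [|k IH]; intro H; simpl; auto. rewrite H by lia. apply IH. intros; apply H; lia.
Qed.

Lemma comp_family_in (A : nat -> R -> Prop) (g : nat -> R -> R) k j x :
  (forall i j x, (i < k)%nat -> (j < k)%nat -> A i x -> A j x -> i = j) ->
  (forall i x, (i < k)%nat -> ~ A i x -> g i x = x) ->
  (forall i x, (i < k)%nat -> A i x -> A i (g i x)) ->
  (j < k)%nat -> A j x -> comp_family g k x = g j x.
Proof.
  induction k as [|k IH]; intros Hd Ho Hi Hj Hx; [lia|]. simpl.
  destruct (Nat.eq_dec j k) as [->|Hne].
  - apply comp_family_out. intros i Hik. apply Ho; [lia|]. intro HA.
    assert (i = k) by (apply (Hd i k (g k x)); auto; lia). lia.
  - rewrite (Ho k x); [|lia|intro HA; assert (j = k) by (apply (Hd j k x); auto; lia); lia].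
    apply IH; auto; try lia.
    intros i i' y H1 H2. apply Hd; lia.
Qed.

Lemma comp_family_iet (g : nat -> R -> R) k : (forall i, (i < k)%nat -> is_iet (g i)) -> is_iet (comp_family g k).
Proof.
  induction k as [|k IH]; intro H; simpl; [apply iet_id|].
  apply (iet_comp (comp_family g k) (g k)); [apply IH; intros|]; apply H; lia.
Qed.

Lemma comp_family_commute f (g : nat -> R -> R) k : (forall i, (i < k)%nat -> commute_fun f (g i)) ->
  commute_fun f (comp_family g k).
Proof.
  induction k as [|k IH]; intro H; simpl; [intro; auto|].
  apply (commute_comp f (comp_family g k) (g k)); [apply IH; intros|]; apply H; lia.
Qed.

Lemma setA_iff f x : setA f x <-> exists n, (2 <= n)%nat /\ min_period f n x.
Proof.
  split.
  - intros [HP HF]. destruct (Per_min_period f x HP) as [n Hn]. exists n. split; auto.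
    destruct (le_lt_dec 2 n); auto. exfalso. apply HF. destruct Hn as (H1 & H2 & H3 & H4).
    assert (n = 1)%nat by lia. subst n. split; auto.
  - intros [n [Hn Hx]]. split; [eapply min_period_Per; eauto|]. intros [_ E].
    destruct Hx as (H1 & H2 & H3 & H4). apply (H4 1%nat); auto.
Qed.

(** A centralising map preserves minimal periods, so it splits over the finitely many periods that
    occur, and each chart turns one piece into the centraliser of a rotation. *)
Lemma cent_on_setA f : is_iet f ->
  exists (s : nat) (ms : nat -> nat), (forall j, (j < s)%nat -> (1 <= ms j)%nat) /\
     grp_iso (Cent_on f (setA f)) (prodFam (fun j => Ggrp (ms j)) s).
Proof.
  intro Hf. destruct (periods_bounded f Hf) as [N HN].
  (* The range starts at 2 because fixed points belong to the other factor, and ends at [N + 1],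
     past the bound on periods. *)
  set (l := filter (fun n => if excluded_middle_informative (exists x, min_period f n x) then true else false) (seq 2 N)).
  assert (Hl : forall n, In n l <-> (2 <= n)%nat /\ exists x, min_period f n x).
  { intro n. unfold l. rewrite filter_In, in_seq. destruct (excluded_middle_informative _) as [H|H].
    - destruct H as [x Hx]. pose proof (HN n x Hx). intuition (try lia; eauto).
    - intuition discriminate. }
  assert (Hnd : NoDup l) by (apply NoDup_filter, seq_NoDup).
  set (s := length l). set (ms := fun j => nth j l O).
  assert (Hms : forall j, (j < s)%nat -> (2 <= ms j)%nat /\ exists x, min_period f (ms j) x).
  { intros j Hj. apply Hl. apply nth_In. auto. }
  exists s, ms. split; [intros j Hj; destruct (Hms j Hj); lia|].
  set (A := fun j => min_period f (ms j)).
  assert (Hch : exists u w : nat -> R -> R, exists c : nat -> R, forall j, (j < s)%nat ->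
     chart (c j) (A j) in01 (u j) (w j) /\ forall x, A j x -> u j (f x) = rot (ms j) (u j x)).
  { destruct (fun_choice (fun j (p : R * (R -> R) * (R -> R)) => (j < s)%nat ->
       chart (fst (fst p)) (A j) in01 (snd (fst p)) (snd p) /\ forall x, A j x -> snd (fst p) (f x) = rot (ms j) (snd (fst p) x))) as [F HF].
    - intro j. destruct (classic (j < s)%nat) as [Hj|Hj].
      + destruct (period_chart f (ms j) Hf) as (c & u & w & H); [apply Hms; auto|]. exists (c, u, w). auto.
      + exists (0, fun x => x, fun x => x). tauto.
    - exists (fun j => snd (fst (F j))), (fun j => snd (F j)), (fun j => fst (fst (F j))). auto. }
  destruct Hch as (u & w & c & Hch).
  assert (Hdis : forall i j x, (i < s)%nat -> (j < s)%nat -> A i x -> A j x -> i = j).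
  { intros i j x Hi Hj H1 H2. pose proof (min_period_unique f _ _ x H1 H2) as E.
    apply (proj1 (NoDup_nth l O) Hnd i j); auto. }
  assert (HCA : forall h, gmem (Cent_on f (setA f)) h -> forall j x, A j x <-> A j (h x)).
  { intros h (Hh & Hc & _) j x. apply min_period_invariant; auto. }
  assert (Hfix : forall j, (j < s)%nat -> forall x, A j x <-> A j (f x)).
  { intros j _ x. apply min_period_invariant; auto. intro; auto. }
  assert (Hwf : forall j y, (j < s)%nat -> in01 y -> w j (rot (ms j) y) = f (w j y)).
  { intros j y Hj Hy. destruct (Hch j Hj) as [(H1 & H2 & H3 & H4 & H5 & H6 & H7 & H8 & H9 & H10) Hrot].
    rewrite <- (H9 y) at 1 by auto. rewrite <- Hrot by auto. apply H8. apply (proj1 (Hfix j Hj _)). auto. }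
  set (Phi := fun (h : R -> R) j => if Nat.ltb j s then transport in01 (u j) (w j) h else fun x => x).
  assert (Phi_lt : forall h j, (j < s)%nat -> Phi h j = transport in01 (u j) (w j) h).
  { intros h j Hj. unfold Phi. apply Nat.ltb_lt in Hj. rewrite Hj. auto. }
  exists Phi. split; [|split; [|split]].
  - intros h Hh j. split.
    + intro Hj. rewrite Phi_lt by auto. destruct (Hch j Hj) as [HC Hrot].
      pose proof HC as (H1 & H2 & H3 & H4 & H5 & H6 & H7 & H8 & H9 & H10).
      split; [apply (transport_iet (c j) (A j)); auto; apply Hh|].
      intro y. destruct (classic (in01 y)) as [Hy|Hy].
      * rewrite !transport_in by (auto; apply rot_in01; auto). rewrite Hwf by auto.
        destruct Hh as (Hh & Hc & Hs). rewrite <- Hc. rewrite Hrot; auto.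
        apply (proj1 (HCA h (conj Hh (conj Hc Hs)) j _)). auto.
      * rewrite (rot_out (ms j) y), transport_out by auto. rewrite rot_out; auto.
    + intro Hj. unfold Phi. apply Nat.ltb_ge in Hj. rewrite Hj. auto.
  - intros g h Hg Hh E. extensionality x.
    destruct (classic (setA f x)) as [Hx|Hx].
    + apply setA_iff in Hx. destruct Hx as [n [Hn Hx]].
      assert (Hin : In n l) by (apply Hl; eauto). destruct (In_nth l n O Hin) as [j [Hj En]]. fold s in Hj. fold (ms j) in En.
      assert (HAx : A j x) by (unfold A; rewrite En; auto).
      destruct (Hch j Hj) as [HC _].
      rewrite <- (transport_back (c j) (A j) in01 (u j) (w j) g HC (HCA g Hg j) x HAx).
      rewrite <- (transport_back (c j) (A j) in01 (u j) (w j) h HC (HCA h Hh j) x HAx).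
      rewrite <- !Phi_lt, E; auto.
    + rewrite !(cent_on_out f (setA f)); auto.
  - intros g Hg.
    (* Surjectivity: each factor is carried back through its chart, and the results have disjoint
       supports, so they may be composed. *)
    set (gh := fun j => transport (A j) (w j) (u j) (g j)).
    assert (Hgin : forall j, (j < s)%nat -> forall x, in01 x <-> in01 (g j x)).
    { intros j Hj x. symmetry. apply iet_in_iff. apply (Hg j); auto. }
    assert (Hgh : forall j, (j < s)%nat -> gmem (Cent_on f (setA f)) (gh j)).
    { intros j Hj. destruct (Hch j Hj) as [HC Hrot]. pose proof (chart_sym _ _ _ _ _ HC) as HC'.
      destruct (proj1 (Hg j) Hj) as [Hgi Hgc].
      pose proof HC as (H1 & H2 & H3 & H4 & H5 & H6 & H7 & H8 & H9 & H10).
      split; [apply (transport_iet (/ c j) in01); auto|]. split.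
      - intro x. destruct (classic (A j x)) as [Hx|Hx].
        + unfold gh. rewrite !transport_in by (auto; apply (proj1 (Hfix j Hj x)); auto).
          rewrite Hrot by auto. rewrite <- Hgc. rewrite Hwf; auto. apply (proj1 (Hgin j Hj _)). auto.
        + unfold gh. rewrite !transport_out; auto. rewrite <- Hfix; auto.
      - intros x Hx Hne. apply setA_iff. exists (ms j). split; [apply Hms; auto|].
        apply NNPP. intro Hn. apply Hne. apply transport_out; auto. }
    exists (comp_family gh s). split.
    + split; [apply comp_family_iet; intros i Hi; apply Hgh; auto|].
      split; [apply comp_family_commute; intros i Hi; apply (Hgh i Hi)|].
      intros x Hx Hne. apply NNPP. intro Hn. apply Hne. apply comp_family_out.
      intros i Hi. apply (cent_on_out f (setA f)); auto.
    + extensionality j. destruct (le_lt_dec s j) as [Hj|Hj].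
      * unfold Phi. destruct (Nat.ltb_spec j s); [lia|]. symmetry. apply (proj2 (Hg j)). auto.
      * rewrite Phi_lt by auto. extensionality y.
        destruct (Hch j Hj) as [HC Hrot]. pose proof HC as (H1 & H2 & H3 & H4 & H5 & H6 & H7 & H8 & H9 & H10).
        destruct (classic (in01 y)) as [Hy|Hy].
        -- rewrite transport_in by auto. rewrite (comp_family_in A gh s j (w j y)); auto.
           ++ unfold gh. rewrite transport_in by auto. rewrite (H9 y) by auto. apply H9. apply (proj1 (Hgin j Hj y)); auto.
           ++ intros i x Hi Hx. apply transport_out; auto.
           ++ intros i x Hi Hx. destruct (Hch i Hi) as [HCi _]. unfold gh.
              apply (transport_invariant (/ c i) in01); auto. apply chart_sym; auto.
        -- rewrite transport_out by auto. symmetry. apply iet_out; auto. apply (proj1 (Hg j) Hj).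
  - intros g h Hg Hh. extensionality j. simpl.
    destruct (le_lt_dec s j) as [Hj|Hj].
    + unfold Phi. destruct (Nat.ltb_spec j s); [lia|]. auto.
    + rewrite !Phi_lt by auto. extensionality y.
      apply (transport_comp (c j) (A j)); auto. apply Hch; auto.
Qed.

(** * Splitting the centraliser *)

Lemma grp_iso_sym {T U} (G : grpOn T) (H : grpOn U) :
  (forall x y, gmem G x -> gmem G y -> gmem G (gmul G x y)) -> grp_iso G H -> grp_iso H G.
Proof.
  intros Hcl (phi & H1 & H2 & H3 & H4).
  set (psi := fun y => epsilon (inhabits (gone G)) (fun x => gmem G x /\ phi x = y)).
  assert (Hpsi : forall y, gmem H y -> gmem G (psi y) /\ phi (psi y) = y).
  { intros y Hy. apply (epsilon_spec (inhabits (gone G)) (fun x => gmem G x /\ phi x = y)). auto. }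
  exists psi. split; [|split; [|split]].
  - intros y Hy. apply Hpsi; auto.
  - intros x y Hx Hy E. rewrite <- (proj2 (Hpsi x Hx)), <- (proj2 (Hpsi y Hy)), E. auto.
  - intros x Hx. exists (phi x). split; auto. apply H2; auto; apply Hpsi; auto.
  - intros x y Hx Hy.
    assert (Hxy : gmem H (gmul H x y)).
    { rewrite <- (proj2 (Hpsi x Hx)), <- (proj2 (Hpsi y Hy)), <- H4 by (apply Hpsi; auto).
      apply H1. apply Hcl; apply Hpsi; auto. }
    apply H2.
    + apply Hpsi; auto.
    + apply Hcl; apply Hpsi; auto.
    + rewrite H4 by (apply Hpsi; auto). rewrite (proj2 (Hpsi x Hx)), (proj2 (Hpsi y Hy)). apply Hpsi; auto.
Qed.

Lemma sym_comp n s t : gmem (Sym n) s -> gmem (Sym n) t -> gmem (Sym n) (fun i => s (t i)).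
Proof.
  intros (S1 & S2 & S3) (T1 & T2 & T3). split; [|split].
  - intros i Hi. auto.
  - intros i j Hi Hj E. apply T2; auto.
  - intros i Hi. rewrite T3, S3; auto.
Qed.

Lemma sym_perm_inv n s : gmem (Sym n) s -> gmem (Sym n) (perm_inv n s).
Proof.
  intro Hs. split; [|split].
  - intros i Hi. apply perm_inv_r; auto.
  - intros i j Hi Hj E. destruct (perm_inv_r n s i Hs Hi) as [_ H1]. destruct (perm_inv_r n s j Hs Hj) as [_ H2].
    congruence.
  - intros i Hi. apply perm_inv_out; auto.
Qed.

Lemma sym_id n : gmem (Sym n) (fun i => i).
Proof. split; [|split]; auto. Qed.

Section Decomposition.

Variables (f : R -> R) (k : nat) (J : nat -> R -> Prop).
Hypothesis Hf : is_iet f.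
Hypothesis HJmin : forall i, (i < k)%nat -> minimal_component f (J i).
Hypothesis HJinj : forall i j, (i < k)%nat -> (j < k)%nat -> J i = J j -> i = j.
Hypothesis HJall : forall K, minimal_component f K -> exists i, (i < k)%nat /\ K = J i.

Lemma components_disjoint i j x : (i < k)%nat -> (j < k)%nat -> J i x -> J j x -> i = j.
Proof. intros Hi Hj Hx Hy. apply HJinj; auto. apply (mc_eq f (J i) (J j) x); auto. Qed.

Lemma component_aperiodic i x : (i < k)%nat -> J i x -> ~ Per f x.
Proof. intros Hi Hx. apply (mc_aperiodic f (J i)); auto. Qed.

Lemma component_cover x : in01 x -> (exists i, (i < k)%nat /\ J i x) \/ setA f x \/ setB f x.
Proof.
  intro Hx. destruct (classic (Per f x)) as [HP|HP].
  - right. unfold setA, setB. tauto.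
  - left. destruct (minimal_component_exists f x Hf (conj Hx HP)) as [K [HK HKx]].
    destruct (HJall K HK) as [i [Hi ->]]. eauto.
Qed.

Lemma setA_Per x : setA f x -> Per f x.
Proof. intros [H _]; auto. Qed.

Lemma setB_Per x : setB f x -> Per f x.
Proof. intros [H E]. split; auto. exists O. auto. Qed.

Definition moves (h : R -> R) (i j : nat) : Prop := forall x, J i x <-> J j (h x).

Lemma moves_exists h i : gmem (Cent f) h -> (i < k)%nat -> exists j, (j < k)%nat /\ moves h i j.
Proof.
  intros [Hh Hc] Hi. destruct (HJall _ (mc_image f (J i) h Hf Hh Hc (HJmin i Hi))) as [j [Hj E]].
  exists j. split; auto. intro x. rewrite <- E, inv_l; tauto.
Qed.

Lemma component_point i : (i < k)%nat -> exists x, J i x.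
Proof. intro Hi. destruct (HJmin i Hi) as (_ & H & _). auto. Qed.

Lemma moves_comp g h i j l : moves h i j -> moves g j l -> moves (fun x => g (h x)) i l.
Proof. intros H1 H2 x. rewrite (H1 x). apply H2. Qed.

Lemma moves_inv h i j : is_iet h -> moves h i j -> moves (inv h) j i.
Proof. intros Hh H x. rewrite (H (inv h x)), inv_r; tauto. Qed.

Lemma cent_comp g h : gmem (Cent f) g -> gmem (Cent f) h -> gmem (Cent f) (fun x => g (h x)).
Proof. intros [G1 G2] [K1 K2]. split; [apply iet_comp|apply commute_comp]; auto. Qed.

Lemma cent_inverse g : gmem (Cent f) g -> gmem (Cent f) (inv g).
Proof. intros [G1 G2]. split; [apply iet_inv|apply commute_inv]; auto. Qed.

(** * Classes of components under the centraliser *)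

Definition linked (i j : nat) : Prop :=
  (i < k)%nat /\ (j < k)%nat /\ exists h, gmem (Cent f) h /\ moves h i j.

Lemma linked_refl i : (i < k)%nat -> linked i i.
Proof.
  intro Hi. split; auto. split; auto. exists (fun x => x). split; [split; [apply iet_id|intro; auto]|].
  intro x. tauto.
Qed.

Lemma linked_sym i j : linked i j -> linked j i.
Proof.
  intros (Hi & Hj & h & Hh & Hm). split; auto. split; auto. exists (inv h).
  split; [apply cent_inverse; auto|]. apply moves_inv; auto. apply Hh.
Qed.

Lemma linked_trans i j l : linked i j -> linked j l -> linked i l.
Proof.
  intros (Hi & Hj & h & Hh & Hm) (_ & Hl & g & Hg & Hm'). split; auto. split; auto.
  exists (fun x => g (h x)). split; [apply cent_comp; auto|]. apply (moves_comp g h i j l); auto.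
Qed.

(** The choice depends only on the predicate [linked] in its first argument. Equivalent components
    give equal predicates and hence the same representative. *)
Definition rep (i : nat) : nat := epsilon (inhabits O) (fun j => linked j i).

Lemma rep_linked i : (i < k)%nat -> linked (rep i) i.
Proof.
  intro Hi. apply (epsilon_spec (inhabits O) (fun j => linked j i)). exists i. apply linked_refl; auto.
Qed.

Lemma rep_eq i j : linked i j -> rep i = rep j.
Proof.
  intro H. unfold rep. f_equal. extensionality l. apply propositional_extensionality.
  split; intro Hl; [apply (linked_trans l i j)|apply (linked_trans l j i)]; auto. apply linked_sym; auto.
Qed.

(** The map chosen for the representative itself may differ from the identity. This is harmless, as
    only a base map composed with the inverse of another one enters. *)
Definition base_map (i : nat) : R -> R :=
  epsilon (inhabits (fun x => x)) (fun h => gmem (Cent f) h /\ moves h (rep i) i).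

Lemma base_map_spec i : (i < k)%nat -> gmem (Cent f) (base_map i) /\ moves (base_map i) (rep i) i.
Proof.
  intro Hi. unfold base_map. apply epsilon_spec. destruct (rep_linked i Hi) as (_ & _ & H). auto.
Qed.

Definition loc (x : R) : nat := epsilon (inhabits O) (fun i => (i < k)%nat /\ J i x).

Lemma loc_eq i x : (i < k)%nat -> J i x -> loc x = i.
Proof.
  intros Hi Hx. assert (H : (loc x < k)%nat /\ J (loc x) x).
  { apply (epsilon_spec (inhabits O) (fun i => (i < k)%nat /\ J i x)). eauto. }
  apply (components_disjoint _ _ x); tauto.
Qed.

Definition in_some (x : R) : Prop := exists i, (i < k)%nat /\ J i x.

(* The permutation [s] of the components, realised by the fixed identifications
   [base_map i] of each component with the chosen representative of its class. *)
Definition permute (s : nat -> nat) (x : R) : R :=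
  ifp (in_some x) (base_map (s (loc x)) (inv (base_map (loc x)) x)) x.

Definition class_perm (s : nat -> nat) : Prop :=
  gmem (Sym k) s /\ forall i, (i < k)%nat -> rep (s i) = rep i.

Lemma class_perm_lt s i : class_perm s -> (i < k)%nat -> (s i < k)%nat.
Proof. intros [(H & _) _]. auto. Qed.

Lemma permute_in s i x : (i < k)%nat -> J i x -> permute s x = base_map (s i) (inv (base_map i) x).
Proof.
  intros Hi Hx. unfold permute. rewrite ifp_true by (exists i; auto). rewrite (loc_eq i x); auto.
Qed.

Lemma permute_out s x : ~ in_some x -> permute s x = x.
Proof. apply ifp_false. Qed.

Lemma permute_J s i x : class_perm s -> (i < k)%nat -> J i x -> J (s i) (permute s x).
Proof.
  intros Hs Hi Hx. rewrite (permute_in s i x) by auto.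
  destruct (base_map_spec i Hi) as [[H1 _] H2].
  destruct (base_map_spec (s i) (class_perm_lt s i Hs Hi)) as [_ H3].
  destruct Hs as [_ Hs]. rewrite Hs in H3 by auto.
  apply (proj1 (H3 _)). apply (proj1 (moves_inv _ _ _ H1 H2 x)). auto.
Qed.

Lemma class_perm_inv s : class_perm s -> class_perm (perm_inv k s).
Proof.
  intros [S1 S2]. split; [apply sym_perm_inv; auto|]. intros i Hi.
  destruct (perm_inv_r k s i S1 Hi) as [H1 H2]. rewrite <- S2, H2; auto.
Qed.

(** The base map of the intermediate component cancels. This exact cancellation is what makes the
    permutation action split. *)
Lemma permute_comp s t x : class_perm s -> class_perm t -> permute (fun i => s (t i)) x = permute s (permute t x).
Proof.
  intros Hs Ht. destruct (classic (in_some x)) as [[i [Hi Hx]]|Hn].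
  - rewrite (permute_in s (t i)) by (try apply (class_perm_lt t); try apply permute_J; auto).
    rewrite !(permute_in _ i) by auto.
    destruct (base_map_spec (t i) (class_perm_lt t i Ht Hi)) as [[H1 _] _]. rewrite inv_l; auto.
  - rewrite !permute_out; auto. rewrite permute_out; auto.
Qed.

Lemma permute_ext s t x : (forall i, (i < k)%nat -> s i = t i) -> permute s x = permute t x.
Proof.
  intro H. destruct (classic (in_some x)) as [[i [Hi Hx]]|Hn].
  - rewrite !(permute_in _ i) by auto. rewrite H; auto.
  - rewrite !permute_out; auto.
Qed.

Lemma permute_id x : permute (fun i => i) x = x.
Proof.
  destruct (classic (in_some x)) as [[i [Hi Hx]]|Hn]; [|apply permute_out; auto].
  rewrite (permute_in _ i) by auto. destruct (base_map_spec i Hi) as [[H1 _] _]. apply inv_r; auto.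
Qed.

Lemma permute_iet s : class_perm s -> is_iet (permute s).
Proof.
  intro Hs. pose proof (class_perm_inv s Hs) as Hsi. pose proof Hs as [S1 S2].
  apply (iet_of_inverse _ (permute (perm_inv k s))).
  - intros x Hx. apply permute_out. intros [i [Hi Hi']]. apply Hx. apply (mc_in01 f (J i)); auto.
  - intro x. rewrite <- permute_comp by auto. rewrite <- permute_id. apply permute_ext.
    intros i Hi. apply perm_inv_l; auto.
  - intro x. rewrite <- permute_comp by auto. rewrite <- permute_id. apply permute_ext.
    intros i Hi. apply perm_inv_r; auto.
  - assert (HpJ : pset in_some) by (apply pset_exists_lt; intros i Hi; apply (mc_pset f); auto).
    (* The additional index [k] stands for the complement of all components, where the map is the
       identity. *)
    apply (pt_glue (S k) (fun i => if Nat.ltb i k then J i else fun x => ~ in_some x)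
      (fun i => if Nat.ltb i k then fun x => base_map (s i) (inv (base_map i) x) else fun x => x)).
    + intros i _. destruct (Nat.ltb_spec i k) as [Hi|Hi]; [apply (mc_pset f); auto|apply pset_not; auto].
    + intros i _. destruct (Nat.ltb_spec i k) as [Hi|Hi]; [|apply iet_pt, iet_id].
      apply iet_pt. apply (iet_comp (base_map (s i)) (inv (base_map i))).
      * apply base_map_spec. apply class_perm_lt; auto.
      * apply iet_inv. apply base_map_spec; auto.
    + intros x _. destruct (classic (in_some x)) as [[i [Hi Hx]]|Hn].
      * exists i. split; [lia|]. destruct (Nat.ltb_spec i k); [auto|lia].
      * exists k. split; [lia|]. destruct (Nat.ltb_spec k k); [lia|auto].
    + intros i x _ _ Hx. destruct (Nat.ltb_spec i k) as [Hi|Hi]; [apply permute_in; auto|apply permute_out; auto].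
Qed.

Lemma in_some_f x : in_some x <-> in_some (f x).
Proof.
  split; intros [i [Hi Hx]]; exists i; split; auto; apply (mc_invariant f (J i) Hf (HJmin i Hi) x); auto.
Qed.

Lemma permute_cent s : class_perm s -> gmem (Cent f) (permute s).
Proof.
  intro Hs. split; [apply permute_iet; auto|]. intro x.
  destruct (classic (in_some x)) as [[i [Hi Hx]]|Hn].
  - assert (Hfx : J i (f x)) by (apply (proj1 (mc_invariant f (J i) Hf (HJmin i Hi) x)); auto).
    rewrite !(permute_in s i) by auto.
    destruct (base_map_spec i Hi) as [[H1 H2] _].
    destruct (base_map_spec (s i) (class_perm_lt s i Hs Hi)) as [[H3 H4] _].
    rewrite H4, (commute_inv f _ H1 H2). auto.
  - rewrite !permute_out; auto. rewrite <- in_some_f. auto.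
Qed.

Lemma permute_moves s i : class_perm s -> (i < k)%nat -> moves (permute s) i (s i).
Proof.
  intros Hs Hi x. split; [apply permute_J; auto|]. intro Hx.
  destruct (classic (in_some x)) as [[j [Hj Hjx]]|Hn].
  - pose proof (permute_J s j x Hs Hj Hjx) as Hx'.
    assert (E : s i = s j) by (apply (components_disjoint _ _ (permute s x)); auto; apply class_perm_lt; auto).
    destruct Hs as [(_ & Hinj & _) _]. rewrite (Hinj i j); auto.
  - exfalso. rewrite permute_out in Hx by auto. apply Hn. exists (s i). split; auto. apply class_perm_lt; auto.
Qed.

Definition class (c : nat) : list nat :=
  filter (fun i => Nat.eqb (rep i) c) (seq 0 k).
Definition csize (c : nat) : nat := length (class c).

Lemma class_In c i : In i (class c) <-> (i < k)%nat /\ rep i = c.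
Proof. unfold class. rewrite filter_In, in_seq, Nat.eqb_eq. intuition lia. Qed.

Lemma class_NoDup c : NoDup (class c).
Proof. apply NoDup_filter, seq_NoDup. Qed.

Definition elt (c a : nat) : nat := nth a (class c) O.

Lemma elt_spec c a : (a < csize c)%nat -> (elt c a < k)%nat /\ rep (elt c a) = c.
Proof. intro Ha. apply class_In. apply nth_In. auto. Qed.

Definition idx (i : nat) : nat := epsilon (inhabits O) (fun a => (a < csize (rep i))%nat /\ elt (rep i) a = i).

Lemma idx_spec i : (i < k)%nat -> (idx i < csize (rep i))%nat /\ elt (rep i) (idx i) = i.
Proof.
  intro Hi. unfold idx. apply epsilon_spec. apply (In_nth (class (rep i)) i O). apply class_In. auto.
Qed.

Lemma elt_inj c a b : (a < csize c)%nat -> (b < csize c)%nat -> elt c a = elt c b -> a = b.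
Proof. intros Ha Hb E. apply (proj1 (NoDup_nth (class c) O) (class_NoDup c)); auto. Qed.

Lemma idx_elt c a : (a < csize c)%nat -> idx (elt c a) = a.
Proof.
  intro Ha. destruct (elt_spec c a Ha) as [H1 H2]. destruct (idx_spec (elt c a) H1) as [H3 H4].
  rewrite H2 in *. apply (elt_inj c); auto.
Qed.

Let F := prodFam (fun c => Sym (csize c)) k.

Definition spread (sg : nat -> nat -> nat) (i : nat) : nat :=
  if Nat.ltb i k then elt (rep i) (sg (rep i) (idx i)) else i.

Lemma spread_lt sg i : (i < k)%nat -> spread sg i = elt (rep i) (sg (rep i) (idx i)).
Proof. intro Hi. unfold spread. apply Nat.ltb_lt in Hi. rewrite Hi. auto. Qed.

Lemma F_sym sg c : gmem F sg -> gmem (Sym (csize c)) (sg c).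
Proof.
  intro H. destruct (H c) as [H1 H2]. destruct (le_lt_dec k c) as [Hc|Hc]; auto.
  rewrite H2 by auto. apply sym_id.
Qed.

Lemma rep_lt i : (i < k)%nat -> (rep i < k)%nat.
Proof. intro Hi. apply (rep_linked i Hi). Qed.

Lemma spread_spec sg i : gmem F sg -> (i < k)%nat ->
  (spread sg i < k)%nat /\ rep (spread sg i) = rep i /\ idx (spread sg i) = sg (rep i) (idx i).
Proof.
  intros Hsg Hi. rewrite spread_lt by auto. destruct (idx_spec i Hi) as [H1 H2].
  assert (H3 : (sg (rep i) (idx i) < csize (rep i))%nat) by (apply (F_sym sg (rep i) Hsg); auto).
  destruct (elt_spec _ _ H3) as [H4 H5]. split; auto. split; auto. apply idx_elt; auto.
Qed.

Lemma spread_perm sg : gmem F sg -> class_perm (spread sg).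
Proof.
  intro Hsg. split; [split; [|split]|].
  - intros i Hi. apply spread_spec; auto.
  - intros i j Hi Hj E. destruct (spread_spec sg i Hsg Hi) as (H1 & H2 & H3).
    destruct (spread_spec sg j Hsg Hj) as (H4 & H5 & H6). rewrite E in H2, H3.
    assert (Er : rep i = rep j) by congruence. rewrite H6 in H3. rewrite Er in *.
    destruct (idx_spec i Hi) as [H7 H8]. destruct (idx_spec j Hj) as [H9 H10].
    rewrite Er in *.
    assert (idx j = idx i) by (apply (F_sym sg (rep j) Hsg); auto). congruence.
  - intros i Hi. unfold spread. apply Nat.ltb_ge in Hi. rewrite Hi. auto.
  - intros i Hi. apply spread_spec; auto.
Qed.

Lemma spread_mul sg tau i : gmem F sg -> gmem F tau ->
  spread (gmul F sg tau) i = spread sg (spread tau i).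
Proof.
  intros Hs Ht. destruct (le_lt_dec k i) as [Hi|Hi].
  - assert (E : forall r, spread r i = i) by (intro r; unfold spread; apply Nat.ltb_ge in Hi; rewrite Hi; auto).
    rewrite !E. auto.
  - destruct (spread_spec tau i Ht Hi) as (H1 & H2 & H3).
    rewrite (spread_lt sg) by auto. rewrite H2, H3. rewrite spread_lt by auto. reflexivity.
Qed.

Lemma spread_inj sg tau : gmem F sg -> gmem F tau ->
  (forall i, (i < k)%nat -> spread sg i = spread tau i) -> sg = tau.
Proof.
  intros Hs Ht E. extensionality c. extensionality a.
  destruct (le_lt_dec (csize c) a) as [Ha|Ha].
  - destruct (F_sym sg c Hs) as (_ & _ & H1). destruct (F_sym tau c Ht) as (_ & _ & H2). rewrite H1, H2; auto.
  - destruct (elt_spec c a Ha) as [H1 H2].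
    destruct (spread_spec sg _ Hs H1) as (_ & _ & H3). destruct (spread_spec tau _ Ht H1) as (_ & _ & H4).
    rewrite H2, idx_elt in H3, H4 by auto. rewrite <- H3, <- H4, E; auto.
Qed.

Lemma spread_surj s : class_perm s -> exists sg, gmem F sg /\ forall i, (i < k)%nat -> spread sg i = s i.
Proof.
  intros Hs. pose proof Hs as [(S1 & S2 & S3) S4].
  set (sg := fun c a => if Nat.ltb a (csize c) then idx (s (elt c a)) else a).
  assert (Esg : forall c a, (a < csize c)%nat -> sg c a = idx (s (elt c a)) /\ (sg c a < csize c)%nat /\ elt c (sg c a) = s (elt c a)).
  { intros c a Ha. destruct (elt_spec c a Ha) as [H1 H2].
    assert (E : sg c a = idx (s (elt c a))) by (unfold sg; apply Nat.ltb_lt in Ha; rewrite Ha; auto).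
    split; auto. destruct (idx_spec (s (elt c a)) (S1 _ H1)) as [H3 H4].
    rewrite S4, H2 in H3, H4 by auto. rewrite E. auto. }
  assert (Hsg : forall c, gmem (Sym (csize c)) (sg c)).
  { intro c. split; [|split].
    - intros a Ha. apply Esg; auto.
    - intros a b Ha Hb E. destruct (Esg c a Ha) as (_ & _ & H1). destruct (Esg c b Hb) as (_ & _ & H2).
      apply (elt_inj c); auto. apply S2; [apply elt_spec; auto|apply elt_spec; auto|]. congruence.
    - intros a Ha. unfold sg. apply Nat.ltb_ge in Ha. rewrite Ha. auto. }
  exists sg. split.
  - intro c. split; [intros _; apply Hsg|]. intro Hc. extensionality a.
    destruct (Hsg c) as (_ & _ & H). apply H.
    (* Representatives are smaller than [k], so a label beyond [k] has an empty class. *)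
    replace (csize c) with O; [lia|]. symmetry. unfold csize. destruct (class c) as [|i l] eqn:E; auto.
    assert (Hin : In i (class c)) by (rewrite E; left; auto). apply class_In in Hin. destruct Hin as [Hi Er].
    pose proof (rep_lt i Hi). lia.
  - intros i Hi. rewrite spread_lt by auto. destruct (idx_spec i Hi) as [H1 H2].
    destruct (Esg _ _ H1) as (_ & _ & H3). rewrite H3, H2. auto.
Qed.

Let C := fun i => Cent_on f (J i).
Let N := prodFam C k.

Lemma N_in n i : gmem N n -> (i < k)%nat -> gmem (C i) (n i).
Proof. intros H Hi. apply (H i); auto. Qed.

Lemma C_J i h x : (i < k)%nat -> gmem (C i) h -> J i x <-> J i (h x).
Proof. intros Hi Hh. apply (cent_on_inv f (J i)); auto. intros y. apply (mc_in01 f (J i)); auto. Qed.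

Lemma N_family n i x : gmem N n -> (i < k)%nat -> J i x -> comp_family n k x = n i x.
Proof.
  intros Hn Hi Hx. apply (comp_family_in J n k i x); auto.
  - intros. eapply components_disjoint; eauto.
  - intros j y Hj Hy. apply (cent_on_out f (J j)); auto. apply N_in; auto.
  - intros j y Hj Hy. apply (proj1 (C_J j (n j) y Hj (N_in n j Hn Hj))); auto.
Qed.

Lemma N_family_out n x : gmem N n -> ~ in_some x -> comp_family n k x = x.
Proof.
  intros Hn Hx. apply comp_family_out. intros i Hi. apply (cent_on_out f (J i)); [apply N_in; auto|].
  intro. apply Hx. exists i. auto.
Qed.

(** Conjugation by the realised permutation carries the factor at [i] to the one at [spread sg i];
    the [j]-th new factor thus comes from the preimage of [j]. *)
Definition conj_act (sg : nat -> nat -> nat) (n : nat -> R -> R) (j : nat) : R -> R :=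
  if Nat.ltb j k then
    fun x => permute (spread sg) (n (perm_inv k (spread sg) j) (inv (permute (spread sg)) x))
  else fun x => x.

Lemma conj_act_lt sg n i x : gmem F sg -> (i < k)%nat ->
  conj_act sg n (spread sg i) x = permute (spread sg) (n i (inv (permute (spread sg)) x)).
Proof.
  intros Hsg Hi. pose proof (spread_perm sg Hsg) as Hp. unfold conj_act.
  pose proof (class_perm_lt _ _ Hp Hi) as H. apply Nat.ltb_lt in H. rewrite H.
  rewrite perm_inv_l; auto. apply Hp.
Qed.

Lemma conj_act_ge sg n j : (k <= j)%nat -> conj_act sg n j = fun x => x.
Proof. intro Hj. unfold conj_act. apply Nat.ltb_ge in Hj. rewrite Hj. auto. Qed.

Lemma spread_preimage sg j : gmem F sg -> (j < k)%nat -> exists i, (i < k)%nat /\ spread sg i = j.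
Proof. intros Hsg Hj. apply (sym_surj k); auto. apply (spread_perm sg Hsg). Qed.

Lemma conj_act_mem sg n : gmem F sg -> gmem N n -> gmem N (conj_act sg n).
Proof.
  intros Hsg Hn j. pose proof (spread_perm sg Hsg) as Hp. split; [|intro Hj; apply conj_act_ge; auto].
  intro Hj. destruct (spread_preimage sg j Hsg Hj) as [i [Hi <-]].
  set (T := permute (spread sg)). assert (HT : gmem (Cent f) T) by (apply permute_cent; auto).
  assert (E : conj_act sg n (spread sg i) = fun x => T (n i (inv T x))).
  { extensionality x. apply conj_act_lt; auto. }
  rewrite E. pose proof (N_in n i Hn Hi) as Hni. pose proof Hni as (N1 & N2 & N3).
  destruct HT as [T1 T2]. split; [apply (iet_comp T (fun x => n i (inv T x))); auto; apply (iet_comp (n i) (inv T)); auto; apply iet_inv; auto|].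
  split.
  - apply (commute_comp f T (fun x => n i (inv T x))); auto. apply (commute_comp f (n i) (inv T)); auto. apply commute_inv; auto.
  - intros x _ Hne. apply NNPP. intro Hx. apply Hne.
    assert (Hx' : ~ J i (inv T x)).
    { intro H. apply Hx. apply (proj1 (permute_moves (spread sg) i Hp Hi _)) in H. fold T in H. rewrite inv_r in H; auto. }
    rewrite (cent_on_out f (J i) (n i)) by auto. apply inv_r; auto.
Qed.

Lemma N_ext n m : gmem N n -> gmem N m -> (forall i x, (i < k)%nat -> n i x = m i x) -> n = m.
Proof.
  intros Hn Hm E. extensionality i. destruct (le_lt_dec k i) as [Hi|Hi].
  - rewrite (proj2 (Hn i)), (proj2 (Hm i)) by auto. auto.
  - apply functional_extensionality. auto.
Qed.

Lemma N_mul n m : gmem N n -> gmem N m -> gmem N (gmul N n m).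
Proof.
  intros Hn Hm i. split.
  - intro Hi. apply (cent_on_comp f (J i) (n i) (m i)); apply N_in; auto.
  - intro Hi. simpl. rewrite (proj2 (Hn i)), (proj2 (Hm i)) by auto. auto.
Qed.

Lemma F_mul sg tau : gmem F sg -> gmem F tau -> gmem F (gmul F sg tau).
Proof.
  intros Hs Ht c. split.
  - intro Hc. apply (sym_comp (csize c) (sg c) (tau c)); apply F_sym; auto.
  - intro Hc. simpl. rewrite (proj2 (Hs c)), (proj2 (Ht c)) by auto. auto.
Qed.

Lemma F_one : gmem F (gone F).
Proof. intro c. split; auto. intros _. apply sym_id. Qed.

Lemma spread_one i : spread (gone F) i = i.
Proof.
  destruct (le_lt_dec k i) as [Hi|Hi].
  - unfold spread. apply Nat.ltb_ge in Hi. rewrite Hi. auto.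
  - rewrite spread_lt by auto. simpl. apply idx_spec; auto.
Qed.

Lemma permute_one x : permute (spread (gone F)) x = x.
Proof. rewrite <- (permute_id x) at 2. apply permute_ext. intros; apply spread_one. Qed.

Lemma permute_mul sg tau x : gmem F sg -> gmem F tau ->
  permute (spread (gmul F sg tau)) x = permute (spread sg) (permute (spread tau) x).
Proof.
  intros Hs Ht. rewrite <- permute_comp by (apply spread_perm; auto). apply permute_ext.
  intros; apply spread_mul; auto.
Qed.

Lemma spread_iet sg : gmem F sg -> is_iet (permute (spread sg)).
Proof. intro. apply permute_iet, spread_perm; auto. Qed.

Lemma conj_act_action : is_action F N conj_act.
Proof.
  split; [|split].
  - intros sg Hsg. pose proof (spread_perm sg Hsg) as Hp. pose proof (spread_iet sg Hsg) as HT.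
    set (T := permute (spread sg)) in *. split; [|split; [|split]].
    + intros n Hn. apply conj_act_mem; auto.
    + intros n m Hn Hm. apply N_ext.
      * apply conj_act_mem; auto. apply N_mul; auto.
      * apply N_mul; apply conj_act_mem; auto.
      * intros j x Hj. destruct (spread_preimage sg j Hsg Hj) as [i [Hi <-]].
        cbn [gmul N prodFam C Cent_on IETgrp]. rewrite !conj_act_lt by auto. fold T. rewrite inv_l; auto.
    + intros n m Hn Hm E. apply N_ext; auto. intros i x Hi.
      apply (iet_inj T); auto. rewrite <- (inv_l T x HT).
      unfold T. rewrite <- !conj_act_lt by auto. rewrite E. auto.
    + intros m Hm. set (n := fun i => if Nat.ltb i k then fun x => inv T (m (spread sg i) (T x)) else fun x => x).
      assert (En : forall i x, (i < k)%nat -> n i x = inv T (m (spread sg i) (T x))).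
      { intros i x Hi. unfold n. apply Nat.ltb_lt in Hi. rewrite Hi. auto. }
      assert (Hn : gmem N n).
      { intro i. split.
        - intro Hi. pose proof (class_perm_lt _ _ Hp Hi) as Hsi.
          pose proof (N_in m _ Hm Hsi) as Hmi. pose proof Hmi as (M1 & M2 & M3).
          assert (E : n i = fun x => inv T (m (spread sg i) (T x))) by (apply functional_extensionality; intro; apply En; auto).
          rewrite E. destruct (permute_cent _ Hp) as [_ Tc]. fold T in Tc. pose proof (commute_inv f T HT Tc) as Tci.
          split; [apply (iet_comp (inv T) (fun x => m (spread sg i) (T x))); [apply iet_inv; auto|apply (iet_comp (m (spread sg i)) T); auto]|].
          split.
          + apply (commute_comp f (inv T) (fun x => m (spread sg i) (T x))); auto. apply (commute_comp f (m (spread sg i)) T); auto.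
          + intros x _ Hne. apply NNPP. intro Hx. apply Hne.
            rewrite (cent_on_out f (J (spread sg i)) (m (spread sg i))); [apply inv_l; auto|auto|].
            intro H. apply Hx. apply (proj2 (permute_moves _ i Hp Hi x)). auto.
        - intro Hi. unfold n. apply Nat.ltb_ge in Hi. rewrite Hi. auto. }
      exists n. split; auto. apply N_ext; auto; [apply conj_act_mem; auto|].
      intros j x Hj. destruct (spread_preimage sg j Hsg Hj) as [i [Hi <-]].
      rewrite conj_act_lt, En by auto. fold T. rewrite !inv_r; auto.
  - intros n Hn. apply N_ext; auto; [apply conj_act_mem; auto; apply F_one|].
    intros i x Hi. rewrite <- (spread_one i) at 1. rewrite conj_act_lt by (auto; apply F_one).
    rewrite permute_one. f_equal. apply inv_eq; [apply spread_iet, F_one|]. apply permute_one.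
  - intros sg tau n Hs Ht Hn. apply N_ext.
    + apply conj_act_mem; auto. apply F_mul; auto.
    + repeat apply conj_act_mem; auto.
    + intros j x Hj. destruct (spread_preimage _ j (F_mul _ _ Hs Ht) Hj) as [i [Hi <-]].
      rewrite conj_act_lt by (auto; apply F_mul; auto).
      rewrite spread_mul by auto.
      rewrite conj_act_lt by (auto; apply (spread_spec tau); auto).
      rewrite conj_act_lt by auto. rewrite permute_mul by auto. do 3 f_equal.
      apply inv_eq; [apply spread_iet, F_mul; auto|]. rewrite permute_mul by auto.
      rewrite !inv_r; auto; apply spread_iet; auto.
Qed.

Let CA := Cent_on f (setA f).
Let EB := E_on (setB f).
Let H := dprod (dprod (sdprod N F conj_act) CA) EB.

(** Components are permuted before the inner factors act, so a point of [J i] feels only the factor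
    of its target [spread sg i]. The two remaining maps live on the disjoint periodic sets. *)
Definition assemble (p : (nat -> R -> R) * (nat -> nat -> nat) * (R -> R) * (R -> R)) (x : R) : R :=
  comp_family (fst (fst (fst p))) k (permute (spread (snd (fst (fst p)))) (snd (fst p) (snd p x))).

Lemma EB_out b x : gmem EB b -> ~ setB f x -> b x = x.
Proof.
  intros [Hb Hs] Hx. apply NNPP. intro Hne. apply Hx. apply Hs; auto.
  apply NNPP. intro Hn. apply Hne. apply iet_out; auto.
Qed.

Lemma EB_in b x : gmem EB b -> setB f x -> setB f (b x).
Proof.
  intros Hb Hx. destruct (classic (b x = x)) as [->|Hne]; auto. pose proof Hb as [H1 H2]. apply H2.
  - apply iet_in; auto. apply Hx.
  - intro E. apply Hne. apply (iet_inj b); auto.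
Qed.

Lemma CA_in a x : gmem CA a -> setA f x -> setA f (a x).
Proof.
  intros Ha Hx. apply (proj1 (cent_on_inv f (setA f) a (fun y Hy => proj1 (setA_Per y Hy)) Ha x)). auto.
Qed.

Lemma Per_not_some x : Per f x -> ~ in_some x.
Proof. intros HP [i [Hi Hx]]. apply (component_aperiodic i x); auto. Qed.

Lemma assemble_J n sg a b i x : gmem H (n, sg, a, b) -> (i < k)%nat -> J i x ->
  assemble (n, sg, a, b) x = n (spread sg i) (permute (spread sg) x) /\
  J (spread sg i) (assemble (n, sg, a, b) x).
Proof.
  intros [[[Hn Hsg] Ha] Hb] Hi Hx. simpl in Hn, Hsg, Ha, Hb.
  pose proof (spread_perm sg Hsg) as Hp. pose proof (component_aperiodic i x Hi Hx) as HnP.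
  unfold assemble. simpl. rewrite (EB_out b x), (cent_on_out f (setA f) a x); auto.
  - pose proof (permute_J (spread sg) i x Hp Hi Hx) as HJx.
    pose proof (class_perm_lt _ _ Hp Hi) as Hsi.
    rewrite (N_family n (spread sg i)); auto. split; auto.
    apply (proj1 (C_J (spread sg i) (n (spread sg i)) _ Hsi (N_in n _ Hn Hsi))). auto.
  - intro. apply HnP, setA_Per; auto.
  - intro. apply HnP, setB_Per; auto.
Qed.

Lemma assemble_A n sg a b x : gmem H (n, sg, a, b) -> setA f x -> assemble (n, sg, a, b) x = a x.
Proof.
  intros [[[Hn Hsg] Ha] Hb] Hx. simpl in Hn, Hsg, Ha, Hb. unfold assemble. simpl.
  rewrite (EB_out b x) by (auto; intro; apply (proj2 Hx); auto).
  assert (Hns : ~ in_some (a x)) by (apply Per_not_some, setA_Per, CA_in; auto).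
  rewrite permute_out, N_family_out; auto.
Qed.

Lemma assemble_B n sg a b x : gmem H (n, sg, a, b) -> setB f x -> assemble (n, sg, a, b) x = b x.
Proof.
  intros [[[Hn Hsg] Ha] Hb] Hx. simpl in Hn, Hsg, Ha, Hb. unfold assemble. simpl.
  pose proof (EB_in b x Hb Hx) as Hbx.
  rewrite (cent_on_out f (setA f) a) by (auto; intros [_ H']; auto).
  assert (Hns : ~ in_some (b x)) by (apply Per_not_some, setB_Per; auto).
  rewrite permute_out, N_family_out; auto.
Qed.

Lemma cent_on_cent X h : gmem (Cent_on f X) h -> gmem (Cent f) h.
Proof. intros (H1 & H2 & _). split; auto. Qed.

Lemma EB_cent b : gmem EB b -> gmem (Cent f) b.
Proof.
  intros Hb. split; [apply Hb|]. intro x. destruct (classic (setB f x)) as [Hx|Hx].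
  - pose proof (EB_in b x Hb Hx) as [_ E]. destruct Hx as [_ Ex]. rewrite Ex, E. auto.
  - rewrite !(EB_out b); auto. intros [H1 H2]. apply Hx. split.
    + apply (iet_in_iff f); auto.
    + apply (iet_inj f); auto.
Qed.

Lemma assemble_cent p : gmem H p -> gmem (Cent f) (assemble p).
Proof.
  destruct p as [[[n sg] a] b]. intros [[[Hn Hsg] Ha] Hb]. simpl in Hn, Hsg, Ha, Hb.
  apply (cent_comp (comp_family n k) (fun x => permute (spread sg) (a (b x)))).
  - split; [apply comp_family_iet|apply comp_family_commute]; intros i Hi;
      destruct (N_in n i Hn Hi) as (N1 & N2 & N3); auto.
  - apply (cent_comp (permute (spread sg)) (fun x => a (b x))).
    + apply permute_cent, spread_perm; auto.
    + apply (cent_comp a b); [apply (cent_on_cent (setA f)); auto|apply EB_cent; auto].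
Qed.

Lemma assemble_out p x : gmem H p -> ~ in01 x -> assemble p x = x.
Proof. intros Hp Hx. apply iet_out; auto. apply assemble_cent; auto. Qed.

Lemma EB_comp b c : gmem EB b -> gmem EB c -> gmem EB (fun x => b (c x)).
Proof.
  intros Hb Hc. split; [apply iet_comp; [apply Hb|apply Hc]|].
  intros x Hx Hne. apply NNPP. intro Hn. apply Hne. rewrite (EB_out c x), (EB_out b x); auto.
Qed.

Lemma H_mul p q : gmem H p -> gmem H q -> gmem H (gmul H p q).
Proof.
  destruct p as [[[n sg] a] b], q as [[[n' sg'] a'] b'].
  intros [[[Hn Hsg] Ha] Hb] [[[Hn' Hsg'] Ha'] Hb']. simpl in *.
  split; [split; [split|]|].
  - apply N_mul; auto. apply conj_act_mem; auto.
  - apply F_mul; auto.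
  - apply cent_on_comp; auto.
  - apply EB_comp; auto.
Qed.

(** Compared separately on the components and on the two periodic sets. On a component,
    [conj_act sg n'] after the permutation equals the permutation after [n'], which is the twist of
    the semidirect product. *)
Lemma assemble_mul p q : gmem H p -> gmem H q ->
  assemble (gmul H p q) = fun x => assemble p (assemble q x).
Proof.
  intros Hp Hq. pose proof (H_mul p q Hp Hq) as Hpq.
  extensionality x.
  destruct (classic (in01 x)) as [Hx01|Hx01].
  2:{ rewrite (assemble_out q x), (assemble_out p x), (assemble_out _ x); auto. }
  destruct p as [[[n sg] a] b], q as [[[n' sg'] a'] b'].
  change (gmul H (n, sg, a, b) (n', sg', a', b')) with
    (gmul N n (conj_act sg n'), gmul F sg sg', (fun x => a (a' x)), (fun x => b (b' x))) in *.
  pose proof Hp as [[[Hn Hsg] Ha] Hb]. pose proof Hq as [[[Hn' Hsg'] Ha'] Hb']. simpl in Hn, Hsg, Ha, Hb, Hn', Hsg', Ha', Hb'.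
  destruct (component_cover x Hx01) as [[i [Hi Hx]]|[Hx|Hx]].
  - destruct (assemble_J n' sg' a' b' i x Hq Hi Hx) as [E1 E2].
    destruct (spread_spec sg' i Hsg' Hi) as (Hi' & _).
    destruct (assemble_J n sg a b _ _ Hp Hi' E2) as [E3 _].
    destruct (assemble_J _ _ _ _ i x Hpq Hi Hx) as [E4 _].
    rewrite E4, E3, E1. rewrite spread_mul, permute_mul by auto.
    change (gmul N n (conj_act sg n') (spread sg (spread sg' i))) with
      (fun y => n (spread sg (spread sg' i)) (conj_act sg n' (spread sg (spread sg' i)) y)). cbv beta.
    rewrite conj_act_lt by auto. rewrite inv_l; auto. apply spread_iet; auto.
  - rewrite !assemble_A; auto. rewrite (assemble_A n' sg' a' b') by auto. apply CA_in; auto.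
  - rewrite !assemble_B; auto. rewrite (assemble_B n' sg' a' b') by auto. apply EB_in; auto.
Qed.

(** Restriction to the periodic sets recovers [a] and [b], the images of the components recover
    [sg], and undoing the permutation recovers the inner factors. *)
Lemma assemble_inj p q : gmem H p -> gmem H q -> assemble p = assemble q -> p = q.
Proof.
  intros Hp Hq E. destruct p as [[[n sg] a] b], q as [[[n' sg'] a'] b'].
  pose proof Hp as [[[Hn Hsg] Ha] Hb]. pose proof Hq as [[[Hn' Hsg'] Ha'] Hb']. simpl in Hn, Hsg, Ha, Hb, Hn', Hsg', Ha', Hb'.
  assert (Ea : a = a').
  { extensionality x. destruct (classic (setA f x)) as [Hx|Hx].
    - rewrite <- (assemble_A n sg a b x), <- (assemble_A n' sg' a' b' x), E; auto.
    - rewrite !(cent_on_out f (setA f)); auto. }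
  assert (Eb : b = b').
  { extensionality x. destruct (classic (setB f x)) as [Hx|Hx].
    - rewrite <- (assemble_B n sg a b x), <- (assemble_B n' sg' a' b' x), E; auto.
    - rewrite !EB_out; auto. }
  assert (Es : sg = sg').
  { apply spread_inj; auto. intros i Hi. destruct (component_point i Hi) as [x Hx].
    destruct (assemble_J n sg a b i x Hp Hi Hx) as [_ H1].
    destruct (assemble_J n' sg' a' b' i x Hq Hi Hx) as [_ H2]. rewrite E in H1.
    apply (components_disjoint _ _ _ (proj1 (spread_spec sg i Hsg Hi)) (proj1 (spread_spec sg' i Hsg' Hi)) H1 H2). }
  subst a' b' sg'. f_equal. f_equal. f_equal.
  apply N_ext; auto. intros j y Hj. destruct (spread_preimage sg j Hsg Hj) as [i [Hi <-]].
  destruct (classic (J (spread sg i) y)) as [Hy|Hy].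
  - pose proof (spread_iet sg Hsg) as HT. pose proof (spread_perm sg Hsg) as Hpm.
    assert (Hx : J i (inv (permute (spread sg)) y)).
    { apply (proj2 (permute_moves _ i Hpm Hi _)). rewrite inv_r; auto. }
    destruct (assemble_J n sg a b i _ Hp Hi Hx) as [H1 _].
    destruct (assemble_J n' sg a b i _ Hq Hi Hx) as [H2 _].
    rewrite inv_r in H1, H2 by auto. rewrite <- H1, <- H2, E. auto.
  - rewrite !(cent_on_out f (J (spread sg i))); auto; apply N_in; auto.
Qed.

Lemma pset_setA : pset (setA f).
Proof.
  unfold setA. apply pset_and; [apply pset_Per; auto|]. apply pset_not. unfold Fix.
  apply pset_and; [apply pset_in01|]. apply (pset_iter_fix f 1); auto.
Qed.

Lemma pset_setB : pset (setB f).
Proof. unfold setB, Fix. apply pset_and; [apply pset_in01|]. apply (pset_iter_fix f 1); auto. Qed.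

Lemma setB_invariant h x : gmem (Cent f) h -> setB f x <-> setB f (h x).
Proof.
  intros [Hh Hc]. unfold setB, Fix. rewrite (iet_in_iff h) by auto. rewrite Hc.
  split; intros [H1 H2]; split; auto; [congruence|]. apply (iet_inj h); auto.
Qed.

Lemma setA_invariant h x : gmem (Cent f) h -> setA f x <-> setA f (h x).
Proof.
  intros Hh. unfold setA. pose proof (setB_invariant h x Hh) as HB. unfold setB in HB.
  rewrite (Per_invariant_gen f h x Hf (proj1 Hh) (proj2 Hh)). tauto.
Qed.

Lemma cent_f : gmem (Cent f) f.
Proof. split; auto. intro; auto. Qed.

(** [h] induces a permutation of the components that respects classes. Dividing [h] by its
    realisation [T] leaves a map preserving every component, whose restrictions are the inner
    factors. *)
Lemma assemble_surj h : gmem (Cent f) h -> exists p, gmem H p /\ assemble p = h.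
Proof.
  intro Hh. pose proof Hh as [Hh1 Hh2].
  assert (Hpi : exists s : nat -> nat, forall i, ((i < k)%nat -> (s i < k)%nat /\ moves h i (s i)) /\ ((k <= i)%nat -> s i = i)).
  { apply (fun_choice (fun i j => ((i < k)%nat -> (j < k)%nat /\ moves h i j) /\ ((k <= i)%nat -> j = i))).
    intro i. destruct (le_lt_dec k i) as [Hi|Hi].
    - exists i. split; [lia|auto].
    - destruct (moves_exists h i Hh Hi) as [j Hj]. exists j. split; [auto|lia]. }
  destruct Hpi as [s Hs].
  assert (Hsp : class_perm s).
  { split; [split; [|split]|].
    - intros i Hi. apply (Hs i); auto.
    - intros i j Hi Hj E. destruct (proj1 (Hs i) Hi) as [H1 H2]. destruct (proj1 (Hs j) Hj) as [H3 H4].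
      destruct (component_point i Hi) as [x Hx]. apply (components_disjoint i j x); auto.
      apply (H4 x). rewrite <- E. apply (H2 x); auto.
    - intros i Hi. apply (Hs i); auto.
    - intros i Hi. destruct (proj1 (Hs i) Hi) as [H1 H2]. symmetry. apply rep_eq. split; auto. split; auto. exists h. auto. }
  destruct (spread_surj s Hsp) as [sg [Hsg Esg]]. pose proof (spread_perm sg Hsg) as Hpm.
  set (T := permute (spread sg)). assert (HT : gmem (Cent f) T) by (apply permute_cent; auto).
  pose proof (cent_inverse T HT) as HTi.
  pose proof (cent_comp h (inv T) Hh HTi) as Hg. set (g := fun x => h (inv T x)) in *.
  set (n := fun i => if Nat.ltb i k then res (J i) g else fun x => x).
  assert (En : forall i, (i < k)%nat -> n i = res (J i) g).
  { intros i Hi. unfold n. apply Nat.ltb_lt in Hi. rewrite Hi. auto. }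
  assert (Hgm : forall j, (j < k)%nat -> moves g j j).
  { intros j Hj. destruct (spread_preimage sg j Hsg Hj) as [i [Hi <-]].
    apply (moves_comp h (inv T) (spread sg i) i).
    - apply moves_inv; [apply HT|]. apply permute_moves; auto.
    - rewrite Esg by auto. apply (Hs i); auto. }
  assert (Hn : gmem N n).
  { intro i. split.
    - intro Hi. rewrite En by auto. split; [apply iet_res; [apply (mc_pset f); auto|apply Hg|apply Hgm; auto]|].
      split; [|apply res_supported]. apply commute_res; [apply Hg|]. apply mc_invariant; auto.
    - intro Hi. unfold n. apply Nat.ltb_ge in Hi. rewrite Hi. auto. }
  set (a := res (setA f) h). set (b := res (setB f) h).
  assert (Ha : gmem CA a).
  { split; [apply iet_res; [apply pset_setA|auto|intro; apply setA_invariant; auto]|].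
    split; [|apply res_supported]. apply commute_res; auto. intro; apply setA_invariant. apply cent_f. }
  assert (Hb : gmem EB b).
  { split; [apply iet_res; [apply pset_setB|auto|intro; apply setB_invariant; auto]|]. apply res_supported. }
  assert (Hp : gmem H (n, sg, a, b)) by (split; [split; [split|]|]; auto).
  exists (n, sg, a, b). split; auto. extensionality x.
  destruct (classic (in01 x)) as [Hx01|Hx01].
  2:{ rewrite assemble_out by auto. symmetry. apply iet_out; auto. }
  destruct (component_cover x Hx01) as [[i [Hi Hx]]|[Hx|Hx]].
  - destruct (assemble_J n sg a b i x Hp Hi Hx) as [E _]. rewrite E.
    rewrite En by (apply (spread_spec sg); auto).
    rewrite res_in by (apply permute_J; auto). unfold g. fold T. rewrite inv_l; auto. apply HT.
  - rewrite assemble_A by auto. apply res_in; auto.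
  - rewrite assemble_B by auto. apply res_in; auto.
Qed.

Lemma cent_decomposition : exists (r : nat) (ns : nat -> nat) phi,
  let F := prodFam (fun j => Sym (ns j)) r in
  is_action F (prodFam C k) phi /\
  grp_iso (Cent f) (dprod (dprod (sdprod (prodFam C k) F phi) CA) EB) /\
  (finite_order f -> trivial_grp F).
Proof.
  exists k, csize, conj_act. split; [apply conj_act_action|]. split.
  - apply grp_iso_sym; [apply H_mul|]. exists assemble. split; [|split; [|split]].
    + apply assemble_cent.
    + apply assemble_inj.
    + apply assemble_surj.
    + apply assemble_mul.
  (* Finite order makes every point of [0,1) periodic, so there is no component and no index below
     [k]. *)
  - intros [m [Hm Hfin]] sg Hsg. extensionality c.
    apply (proj2 (Hsg c)). destruct (le_lt_dec k c) as [|Hc]; auto. exfalso.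
    destruct (component_point c Hc) as [x Hx]. apply (component_aperiodic c x Hc Hx).
    split; [apply (mc_in01 f (J c)); auto|]. exists (m - 1)%nat. replace (S (m - 1)) with m by lia. auto.
Qed.

End Decomposition.

Theorem theorem5p7 (f : R -> R) (Hf : is_iet f)
  (k : nat) (J : nat -> R -> Prop)
  (HJmin : forall i, (i < k)%nat -> minimal_component f (J i))
  (HJinj : forall i j, (i < k)%nat -> (j < k)%nat -> J i = J j -> i = j)
  (HJall : forall K, minimal_component f K -> exists i, (i < k)%nat /\ K = J i) :
  let C := fun i => Cent_on f (J i) in
  let CA := Cent_on f (setA f) in
  let EB := E_on (setB f) in
  (* structure of the C_i *)
  (forall i, (i < k)%nat ->
     (infinite_grp (C i) /\ virtually_cyclic (C i)) \/
     (exists m : nat, (1 <= m)%nat /\ exists S,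
        subgroup (TorusSym m) S /\ (forall p, diagonal m p -> S p) /\
        grp_iso (C i) (restrict (TorusSym m) S))) /\
  (* C_A is a finite direct product of groups G_m *)
  (exists (s : nat) (ms : nat -> nat), (forall j, (j < s)%nat -> (1 <= ms j)%nat) /\
     grp_iso CA (prodFam (fun j => Ggrp (ms j)) s)) /\
  (* the decomposition of C(f) *)
  (exists (r : nat) (ns : nat -> nat) phi,
     let F := prodFam (fun j => Sym (ns j)) r in
     is_action F (prodFam C k) phi /\
     grp_iso (Cent f) (dprod (dprod (sdprod (prodFam C k) F phi) CA) EB) /\
     (finite_order f -> trivial_grp F)) /\
  (* triviality statements *)
  ((forall x, ~ Per f x) -> trivial_grp CA /\ trivial_grp EB) /\
  (finite_order f -> forall i, (i < k)%nat -> trivial_grp (C i)).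
Proof.
  intros C CA EB. split; [|split; [|split; [|split]]].
  - intros i Hi. apply cent_on_dichotomy; auto.
  - apply cent_on_setA; auto.
  - apply cent_decomposition; auto.
  - intro HP. split; intros h Hh; apply functional_extensionality; intro x.
    + apply (cent_on_out f (setA f)); auto. intro Hx. apply (HP x). apply setA_Per; auto.
    + apply (EB_out f); auto. intro Hx. apply (HP x). apply setB_Per; auto.
  (* A point of [J i] would be periodic, so the range of [i] is empty. *)
  - intros [m [Hm Hfin]] i Hi. exfalso. destruct (HJmin i Hi) as (_ & [x Hx] & _).
    apply (mc_aperiodic f (J i) x Hf (HJmin i Hi) Hx).
    split; [apply (mc_in01 f (J i)); auto|]. exists (m - 1)%nat. replace (S (m - 1)) with m by lia. auto.
Qed.
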